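(* Let $(M^3,g(t))$ be a $3$-dimensional Riemannian manifold evolving by the Ricci flow $\frac{\partial}{\partial t}g_{ij}=-2R_{ij}$ on some time interval. Then the Bach tensor satisfies \begin{align*} (\partial_t-\Delta)B_{ik}={}&\big[3\nabla_pR\,C_{ipk}+\nabla_pR\,C_{pki}-\nabla_pR\nabla_kR_{ip}\big]\\ &+\big[-2R_{pl}\nabla_pC_{ikl}-3R_{pk}B_{pi}-5R_{pi}B_{pk}+2\Delta R_{ip}\,R_{kp}\\ &\qquad-2\nabla_l\nabla_kR_{pi}\,R_{pl}+\nabla_l\nabla_kR\,R_{li}-\Delta R\,R_{ik}\big]\\ &+\big[-2\nabla_pR_{kl}C_{lpi}-2\nabla_pR_{kl}C_{ilp}-4\nabla_pR_{il}C_{lpk}-2\nabla_iR_{pl}C_{pkl}\big]\\ &+\big[3R\,B_{ik}+2\nabla_sR_{pl}C_{psl}\,g_{ik}+2R_{pl}B_{pl}\,g_{ik}\\ &\qquad+\tfrac12\big(|\nabla R|^2+R\Delta R-\Delta|\mathrm{Ric}|^2\big)g_{ik}-\tfrac12\big(R\nabla_i\nabla_kR-\nabla_i\nabla_k|\mathrm{Ric}|^2\big)\\ &\qquad+2\nabla_lR_{ip}\nabla_lR_{kp}-\nabla_lR\nabla_lR_{ik}\big]. \end{align*} Hence, if the Bach tensor vanishes identically along the flow, then \begin{align*} 0={}&3\nabla_pR\,C_{ipk}+\nabla_pR\,C_{pki}-\nabla_pR\nabla_kR_{ip}-2R_{pl}\nabla_pC_{ikl}\\ &+2\Delta R_{ip}\,R_{kp}-2\nabla_l\nabla_kR_{pi}\,R_{pl}+\nabla_l\nabla_kR\,R_{li}-\Delta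 R\,R_{ik}\\ &-2\nabla_pR_{kl}C_{lpi}-2\nabla_pR_{kl}C_{ilp}-4\nabla_pR_{il}C_{lpk}-2\nabla_iR_{pl}C_{pkl}\\ &+2\nabla_sR_{pl}C_{psl}\,g_{ik}+\tfrac12\big(|\nabla R|^2+R\Delta R-\Delta|\mathrm{Ric}|^2\big)g_{ik}\\ &-\tfrac12\big(R\nabla_i\nabla_kR-\nabla_i\nabla_k|\mathrm{Ric}|^2\big)+2\nabla_lR_{ip}\nabla_lR_{kp}-\nabla_lR\nabla_lR_{ik}. \end{align*}
   Context: Repeated indices are summed; an index repeated in two lower positions is contracted with the inverse metric (equivalently, the right-hand sides are written in an orthonormal basis / normal coordinates at a point). $R_{ij}$ is the Ricci tensor (denoted $\mathrm{Ric}$; normalized to be positive on round spheres), $R$ the scalar curvature, $|\mathrm{Ric}|^2=g^{ia}g^{jb}R_{ij}R_{ab}$, $\nabla$ the Levi-Civita connection of $g(t)$, $\Delta=g^{ab}\nabla_a\nabla_b$ the rough Laplacian. Each derivative acts only on the tensor immediately following it (e.g. $\Delta R_{ip}\,R_{kp}$ means $(\Delta R_{ip})R_{kp}$ and $\nabla_l\nabla_kR_{pi}\,R_{pl}$ means $(\nabla_l\nabla_kR_{pi})R_{pl}$, with $\nabla_l$ the outer derivative). The Cotton tensor in dimension three is $$C_{ijk}=\nabla_kR_{ij}-\nabla_jR_{ik}-\tfrac14\big(\nabla_kR\,g_{ij}-\nabla_jR\,g_{ik}\big),$$ and the Bach tensor in dimension three is $B_{ik}=\nabla_jC_{ijk}$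 (i.e. $B_{ik}=g^{jl}\nabla_lC_{ijk}$), which is symmetric and trace-free. $\partial_tB_{ik}$ is the time derivative of the components in a fixed (time-independent) local coordinate frame, not a moving frame. *)

(* Defs.v *)
From HB Require Import structures.
From mathcomp Require Import all_boot all_order all_algebra.
From mathcomp Require Import all_classical all_reals all_analysis.

Set Implicit Arguments.
Unset Strict Implicit.
Unset Printing Implicit Defensive.

Import Order.TTheory GRing.Theory Num.Theory.
Import numFieldNormedType.Exports.

Local Open Scope classical_set_scope.
Local Open Scope ring_scope.

Section Calculus.
Variable R : realType.
Notation pt := 'rV[R]_3.

Definition partial (i : 'I_3) (f : pt -> R) : pt -> R :=
  fun x => 'D_(delta_mx 0 i) f x.

(* The time derivative is taken along the time interval I, hence it is
   one-sided at an endpoint that belongs to I. *)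
Definition diff_quot (f : R -> R) (t s : R) : R := (s - t)^-1 * (f s - f t).

Definition derivable_in (I : set R) (f : R -> R) (t : R) : Prop :=
  cvg (diff_quot f t @ within I t^').

Definition deriv_in (I : set R) (f : R -> R) (t : R) : R :=
  lim (diff_quot f t @ within I t^').

Definition iter_partial (w : seq 'I_3) (f : pt -> R) : pt -> R :=
  foldr partial f w.

Definition smooth_on (U : set pt) (f : pt -> R) : Prop :=
  forall w : seq 'I_3,
    {within U, continuous (iter_partial w f)} /\
    forall x, U x -> forall i, derivable (iter_partial w f) x (delta_mx 0 i).

(* Mixed partial derivatives in space and time: Some i stands for the i-th
   space derivative, None for the time derivative. *)
Definition partial_st (I : set R) (d : option 'I_3) (f : R -> pt -> R) :
    R -> pt -> R :=
  fun t x => if d is Some i then partial i (f t) x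
             else deriv_in I (fun s => f s x) t.

Definition iter_partial_st (I : set R) (w : seq (option 'I_3))
    (f : R -> pt -> R) : R -> pt -> R :=
  foldr (partial_st I) f w.

Definition smooth_family_on (I : set R) (U : set pt) (f : R -> pt -> R) :
    Prop :=
  forall w : seq (option 'I_3),
    {within I `*` U, continuous (fun p : R * pt => iter_partial_st I w f p.1 p.2)} /\
    forall t x, I t -> U x ->
      (forall i, derivable (iter_partial_st I w f t) x (delta_mx 0 i)) /\
      derivable_in I (fun s => iter_partial_st I w f s x) t.

End Calculus.

Section Manifold.
Variable R : realType.
Notation pt := 'rV[R]_3.

Record chart (M : topologicalType) := Chart {
  chart_dom : set M;
  chart_cod : set pt;
  chart_map : M -> pt;
  chart_inv : pt -> M;
  chart_dom_open : open chart_dom;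
  chart_cod_open : open chart_cod;
  chart_map_in : forall m, chart_dom m -> chart_cod (chart_map m);
  chart_inv_in : forall x, chart_cod x -> chart_dom (chart_inv x);
  chart_mapK : forall m, chart_dom m -> chart_inv (chart_map m) = m;
  chart_invK : forall x, chart_cod x -> chart_map (chart_inv x) = x;
  chart_map_cont : {within chart_dom, continuous chart_map};
  chart_inv_cont : {within chart_cod, continuous chart_inv}
}.

Definition transition (M : topologicalType) (c d : chart M) : pt -> pt :=
  fun x => chart_map d (chart_inv c x).

Definition overlap (M : topologicalType) (c d : chart M) : set pt :=
  [set x | chart_cod c x /\ chart_dom d (chart_inv c x)].

Record manifold3 := Manifold3 {
  carrier :> topologicalType;
  atlas : set (chart carrier);
  manifold_hausdorff : hausdorff_space carrier;
  manifold_second_countable : @second_countable carrier;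
  atlas_cover : forall m : carrier, exists2 c, atlas c & chart_dom c m;
  atlas_smooth : forall c d, atlas c -> atlas d -> forall a : 'I_3,
    smooth_on (overlap c d) (fun x => transition c d x 0 a)
}.

(* Entry (a, i) is the i-th partial derivative of the a-th coordinate of the
   transition map. *)
Definition jacobian3 (M : topologicalType) (c d : chart M) (x : pt) :
    'M[R]_3 :=
  \matrix_(a, i) partial i (fun y => transition c d y 0 a) x.

(* A family of metrics is given by its component matrices in all the charts of
   the atlas, subject to the transformation law of covariant 2-tensors. *)
Record metric_family (M : manifold3) (I : set R)
    (g : chart M -> R -> pt -> 'M[R]_3) : Prop := MetricFamily {
  metric_smooth : forall c, atlas c -> forall i j : 'I_3,
    smooth_family_on I (chart_cod c) (fun t x => g c t x i j);
  metric_sym : forall c t x, atlas c -> I t -> chart_cod c x ->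
    (g c t x)^T = g c t x;
  metric_posdef : forall c t x, atlas c -> I t -> chart_cod c x ->
    forall v : 'rV[R]_3, v != 0 -> 0 < (v *m g c t x *m v^T) 0 0;
  metric_change : forall c d t x, atlas c -> atlas d -> I t ->
    overlap c d x ->
    g c t x = (jacobian3 c d x)^T *m g d t (transition c d x)
                *m jacobian3 c d x
}.

End Manifold.

Section Curvature.
Variable R : realType.
Notation pt := 'rV[R]_3.
Notation field := (pt -> R).

(* Components in a chart of the metric at one fixed time. *)
Variable G : pt -> 'M[R]_3.

(* Contraction of two lower indices with the inverse metric:
   g^{pq} F_{pq} and g^{pq} g^{lm} F_{pqlm}. *)
Definition ctr (x : pt) (F : 'I_3 -> 'I_3 -> R) : R :=
  \sum_(p < 3) \sum_(q < 3) invmx (G x) p q * F p q.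

Definition ctr2 (x : pt) (F : 'I_3 -> 'I_3 -> 'I_3 -> 'I_3 -> R) : R :=
  ctr x (fun p q => ctr x (fun l m => F p q l m)).

(* christoffel k i j is Gamma^k_{ij}. *)
Definition christoffel (k i j : 'I_3) : field := fun x =>
  2^-1 * \sum_(l < 3) invmx (G x) k l *
    (partial i (fun y => G y j l) x + partial j (fun y => G y i l) x
     - partial l (fun y => G y i j) x).

(* Covariant derivatives of covariant tensors of rank 0, 1, 2, 3; the
   differentiation index comes first: cov2 T l i j is nabla_l T_{ij}. *)
Definition cov0 (f : field) (l : 'I_3) : field := partial l f.

Definition cov1 (T : 'I_3 -> field) (l i : 'I_3) : field := fun x =>
  partial l (T i) x - \sum_(p < 3) christoffel p l i x * T p x.

Definition cov2 (T : 'I_3 -> 'I_3 -> field) (l i j : 'I_3) : field := fun x =>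
  partial l (T i j) x
  - \sum_(p < 3) christoffel p l i x * T p j x
  - \sum_(p < 3) christoffel p l j x * T i p x.

Definition cov3 (T : 'I_3 -> 'I_3 -> 'I_3 -> field) (l i j k : 'I_3) : field :=
  fun x =>
  partial l (T i j k) x
  - \sum_(p < 3) christoffel p l i x * T p j k x
  - \sum_(p < 3) christoffel p l j x * T i p k x
  - \sum_(p < 3) christoffel p l k x * T i j p x.

(* hess f a b is nabla_a nabla_b f, cov22 T a b i j is
   nabla_a nabla_b T_{ij}. *)
Definition hess (f : field) : 'I_3 -> 'I_3 -> field := cov1 (cov0 f).

Definition cov22 (T : 'I_3 -> 'I_3 -> field) :
  'I_3 -> 'I_3 -> 'I_3 -> 'I_3 -> field := cov3 (cov2 T).

Definition lap0 (f : field) : field := fun x =>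
  ctr x (fun a b => hess f a b x).

Definition lap2 (T : 'I_3 -> 'I_3 -> field) (i j : 'I_3) : field := fun x =>
  ctr x (fun a b => cov22 T a b i j x).

(* riemann l i j k is the d_l-component of
   nabla_i nabla_j d_k - nabla_j nabla_i d_k. *)
Definition riemann (l i j k : 'I_3) : field := fun x =>
  partial i (christoffel l j k) x - partial j (christoffel l i k) x
  + \sum_(p < 3) (christoffel p j k x * christoffel l i p x
                  - christoffel p i k x * christoffel l j p x).

Definition ricci (j k : 'I_3) : field := fun x =>
  \sum_(i < 3) riemann i i j k x.

Definition scal : field := fun x => ctr x (fun p q => ricci p q x).

Definition ricci_norm2 : field := fun x =>
  ctr2 x (fun i a j b => ricci i j x * ricci a b x).

Definition cotton (i j k : 'I_3) : field := fun x =>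
  cov2 ricci k i j x - cov2 ricci j i k x
  - 4^-1 * (cov0 scal k x * G x i j - cov0 scal j x * G x i k).

(* B_{ik} = g^{jl} nabla_l C_{ijk} *)
Definition bach (i k : 'I_3) : field := fun x =>
  ctr x (fun j l => cov3 cotton l i j k x).

(* In the two formulas below a contracted pair of indices p p (resp. l l, s s)
   is written p q (resp. l m, s u), and S is the scalar curvature. *)
Definition bach_flow_rhs (i k : 'I_3) : field := fun x =>
  let g a b := G x a b in
  let Rc a b := ricci a b x in
  let dRc a b c := cov2 ricci a b c x in
  let ddRc a b c d := cov22 ricci a b c d x in
  let LRc a b := lap2 ricci a b x in
  let S := scal x in
  let dS a := cov0 scal a x in
  let ddS a b := hess scal a b x in
  let LS := lap0 scal x in
  let C a b c := cotton a b c x in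
  let dC a b c d := cov3 cotton a b c d x in
  let B a b := bach a b x in
  (3 * ctr x (fun p q => dS p * C i q k)
   + ctr x (fun p q => dS p * C q k i)
   - ctr x (fun p q => dS p * dRc k i q))
  + (- 2 * ctr2 x (fun p q l m => Rc p l * dC q i k m)
     - 3 * ctr x (fun p q => Rc p k * B q i)
     - 5 * ctr x (fun p q => Rc p i * B q k)
     + 2 * ctr x (fun p q => LRc i p * Rc k q)
     - 2 * ctr2 x (fun p q l m => ddRc l k p i * Rc q m)
     + ctr x (fun l m => ddS l k * Rc m i)
     - LS * Rc i k)
  + (- 2 * ctr2 x (fun p q l m => dRc p k l * C m q i)
     - 2 * ctr2 x (fun p q l m => dRc p k l * C i m q)
     - 4 * ctr2 x (fun p q l m => dRc p i l * C m q k)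
     - 2 * ctr2 x (fun p q l m => dRc i p l * C q k m))
  + (3 * S * B i k
     + 2 * ctr x (fun s u => ctr2 x (fun p q l m => dRc s p l * C q u m)) * g i k
     + 2 * ctr2 x (fun p q l m => Rc p l * B q m) * g i k
     + 2^-1 * (ctr x (fun p q => dS p * dS q) + S * LS
               - lap0 ricci_norm2 x) * g i k
     - 2^-1 * (S * ddS i k - hess ricci_norm2 i k x)
     + 2 * ctr2 x (fun l m p q => dRc l i p * dRc m k q)
     - ctr x (fun l m => dS l * dRc m i k)).

Definition bach_flat_rhs (i k : 'I_3) : field := fun x =>
  let g a b := G x a b in
  let Rc a b := ricci a b x in
  let dRc a b c := cov2 ricci a b c x in
  let ddRc a b c d := cov22 ricci a b c d x in
  let LRc a b := lap2 ricci a b x in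
  let S := scal x in
  let dS a := cov0 scal a x in
  let ddS a b := hess scal a b x in
  let LS := lap0 scal x in
  let C a b c := cotton a b c x in
  let dC a b c d := cov3 cotton a b c d x in
  3 * ctr x (fun p q => dS p * C i q k)
  + ctr x (fun p q => dS p * C q k i)
  - ctr x (fun p q => dS p * dRc k i q)
  - 2 * ctr2 x (fun p q l m => Rc p l * dC q i k m)
  + 2 * ctr x (fun p q => LRc i p * Rc k q)
  - 2 * ctr2 x (fun p q l m => ddRc l k p i * Rc q m)
  + ctr x (fun l m => ddS l k * Rc m i)
  - LS * Rc i k
  - 2 * ctr2 x (fun p q l m => dRc p k l * C m q i)
  - 2 * ctr2 x (fun p q l m => dRc p k l * C i m q)
  - 4 * ctr2 x (fun p q l m => dRc p i l * C m q k)
  - 2 * ctr2 x (fun p q l m => dRc i p l * C q k m)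
  + 2 * ctr x (fun s u => ctr2 x (fun p q l m => dRc s p l * C q u m)) * g i k
  + 2^-1 * (ctr x (fun p q => dS p * dS q) + S * LS
            - lap0 ricci_norm2 x) * g i k
  - 2^-1 * (S * ddS i k - hess ricci_norm2 i k x)
  + 2 * ctr2 x (fun l m p q => dRc l i p * dRc m k q)
  - ctr x (fun l m => dS l * dRc m i k).

End Curvature.

Definition ricci_flow (R : realType) (M : manifold3 R) (I : set R)
    (g : chart R M -> R -> 'rV[R]_3 -> 'M[R]_3) : Prop :=
  forall c t x, atlas c -> I t -> chart_cod c x -> forall i j : 'I_3,
    derivable_in I (fun s => g c s x i j) t /\
    deriv_in I (fun s => g c s x i j) t = - 2 * ricci (g c t) i j x.

(* Main.v *)
Require Import Defs.
From HB Require Import structures.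
From mathcomp Require Import all_boot all_order all_algebra.
From mathcomp Require Import all_classical all_reals all_analysis.
From mathcomp Require Import ring lra zify.
Import Order.TTheory GRing.Theory Num.Theory.
Import numFieldNormedType.Exports.

(** Fix a chart.  Over the time interval and the chart, the components of the
    metric, of its inverse, and everything obtained from them by field
    operations and differentiation in space or time are smooth families.  These
    families form a commutative ring [sfam] on which the three space derivatives
    and the time derivative act as commuting derivations (partial derivatives
    commute by [partial_comm]; the time derivative is taken along the interval
    and is one-sided at an endpoint).  All of the Riemannian geometry that is
    needed takes place in such a ring: Christoffel symbols, curvature, covariant
    derivatives of tensors of any rank, and the evolution equation of the
    metric.

    In this differential ring the argument is the classical one.

    - The Ricci identity ([ricci_identity]) is a computation with commuting
      derivations.  Applied to the metric it gives the skew symmetry of the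
      curvature in the outer pair of indices ([alt2_0]); the second Bianchi
      identity is the Jacobi identity for covariant derivatives of a covector
      ([bianchi2_covector0]); contracting it twice gives
      [contracted_bianchi0].  In dimension three the symmetries of the
      curvature tensor force it to be the usual expression in the metric, the
      Ricci tensor and the scalar curvature ([evA_Rie_of_Rc]).
    - The flow determines the variation of the Christoffel symbols
      ([dt_Gam]), hence that of any covariant derivative ([dt_cov]).
      Differentiating the Ricci identity in time gives the variation of the
      curvature ([dt_riem]), and then Hamilton's equation for the Ricci tensor
      ([dt_ricA]).  From there the time derivatives of the scalar curvature,
      of the Cotton tensor and of the Bach tensor follow term by term
      ([dt_Sc], [dt_Cotton], [dt_Bach]).
    - What remains is an identity between contractions of the metric, the
      Ricci tensor and its covariant derivatives up to order four
      ([bach_evolution]).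

    Identities of the last kind, and several of the intermediate ones, are
    decided by computation.  Tensor expressions are represented as data, with
    a covariant derivative acting on them by the Leibniz rule.  Such an
    expression is multilinear in its free arguments, so it vanishes as soon as
    its components in an orthonormal basis do.  These components are
    polynomials in the components of the iterated covariant derivatives of the
    Ricci tensor, and they are brought to normal form by rewriting with the
    symmetry of the Ricci tensor, the Ricci identity (which sorts the
    derivatives) and the contracted Bianchi identity.  Each rewriting step adds
    a multiple of an instance of a proved relation, so that the procedure is
    sound whatever strategy chooses the steps ([check_zero_frame]).  The
    orthonormal basis lives at one point and one time only; the conclusion is
    an identity in the ring, which can be differentiated again.

    The last part identifies the coordinate formulas defining the Ricci,
    Cotton and Bach tensors with the values of the symbolic expressions.  If
    the Bach tensor vanishes identically, so do its time derivative and its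
    Laplacian, and the evolution equation becomes the second claim. *)


Set Implicit Arguments.
Unset Strict Implicit.
Unset Printing Implicit Defensive.

Local Open Scope ring_scope.

(** * Tensor components over a commutative ring *)

Notation idx := 'I_3.

Section Tensors.
Variable A : comNzRingType.

(** Components of covariant tensors of all ranks at once: a word of indices is
    mapped to the component with these indices. *)
Definition tensor := seq idx -> A.

(** The derivation action of a matrix on a covariant tensor, one slot at a
    time; with a matrix of Christoffel symbols this is the correction term of
    a covariant derivative. *)
Fixpoint act (ga : idx -> idx -> A) (T : tensor) (w : seq idx) : A :=
  if w is i :: w' then
    \sum_p ga i p * T (p :: w') + act ga (fun v => T (i :: v)) w'
  else 0.

Lemma act_cat ga T u v :
  act ga T (u ++ v) = act ga (fun u' => T (u' ++ v)) u
                      + act ga (fun v' => T (u ++ v')) v.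
Proof.
elim: u T => [|i u IH] T /=; first by rewrite add0r.
by rewrite IH addrA.
Qed.

Lemma act_ext ga T S w :
  (forall v, size v = size w -> T v = S v) -> act ga T w = act ga S w.
Proof.
elim: w T S => [//|i w IH] T S TS /=; congr (_ + _).
  by apply: eq_bigr => p _; rewrite TS.
by apply: IH => v sv; rewrite TS //= sv.
Qed.

Lemma act_sum ga (J : Type) (r : seq J) (c : J -> A) (T : J -> tensor) w :
  act ga (fun v => \sum_(j <- r) c j * T j v) w
  = \sum_(j <- r) c j * act ga (T j) w.
Proof.
elim: w T => [|i w IH] T /=; first by rewrite big1 // => j _; rewrite mulr0.
rewrite IH; under [RHS]eq_bigr do rewrite mulrDr.
rewrite big_split /=; congr (_ + _).
under eq_bigr do rewrite mulr_sumr.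
rewrite exchange_big /=; apply: eq_bigr => j _.
by rewrite mulr_sumr; apply: eq_bigr => p _; rewrite mulrCA.
Qed.

Lemma actD ga T S w : act ga (fun v => T v + S v) w = act ga T w + act ga S w.
Proof.
have := @act_sum ga bool [:: true; false] (fun=> 1) (fun b => if b then T else S) w.
rewrite !big_cons !big_nil !mul1r addr0 => <-.
by apply: act_ext => v _; rewrite !big_cons big_nil !mul1r addr0.
Qed.

Lemma actZ ga a T w : act ga (fun v => a * T v) w = a * act ga T w.
Proof.
have := @act_sum ga unit [:: tt] (fun=> a) (fun=> T) w.
rewrite !big_cons !big_nil addr0 => <-.
by apply: act_ext => v _; rewrite big_cons big_nil addr0.
Qed.

Lemma actN ga T w : act ga (fun v => - T v) w = - act ga T w.
Proof.
rewrite -[RHS]mulN1r -actZ; apply: act_ext => v _; by rewrite mulN1r.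
Qed.

Lemma act0 ga w : act ga (fun=> 0) w = 0.
Proof. by elim: w => [//|i w IH] /=; rewrite IH addr0 big1 // => p _; rewrite mulr0. Qed.

Lemma act_lin2 ga ga' a b T w :
  act (fun i p => a * ga i p + b * ga' i p) T w = a * act ga T w + b * act ga' T w.
Proof.
elim: w T => [|i w IH] T /=; first by rewrite !mulr0 addr0.
rewrite IH.
under eq_bigr do rewrite mulrDl -!mulrA.
by rewrite big_split /= -!mulr_sumr !mulrDr addrACA.
Qed.

(** The derivation action represents the Lie algebra of matrices: corrections in
    two different slots commute, so that only the commutator of the two matrices
    survives.  This is where the quadratic part of the curvature comes from. *)
Lemma act_comm ga ga' T w :
  act ga (act ga' T) w - act ga' (act ga T) w
  = act (fun i q => \sum_p ga i p * ga' p q - \sum_p ga' i p * ga p q) T w.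
Proof.
elim: w T => [|i w IH] T /=; first by rewrite subr0.
under eq_bigr do rewrite mulrDr mulr_sumr.
under [X in _ - (X + _)]eq_bigr do rewrite mulrDr mulr_sumr.
rewrite !big_split /= !actD !act_sum -IH.
under [\sum_p _ * T _ in RHS]eq_bigr do rewrite mulrBl !mulr_suml.
rewrite sumrB [X in _ = X - _ + _]exchange_big [X in _ = _ - X + _]exchange_big /=.
under [\sum_j \sum_i _ in RHS]eq_bigr do under eq_bigr do rewrite -mulrA.
under [X in _ = _ - X + _]eq_bigr do under eq_bigr do rewrite -mulrA.
set a := \sum_i0 \sum_i1 _; set b := \sum_i0 _; set c := \sum_j _; set d := act ga _ w.
set e := \sum_i0 \sum_i1 _; set f := act ga' _ w.
ring.
Qed.

(** Contraction of the last two slots with [H].  Iterating it contracts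
    consecutive pairs, so that a fully contracted product needs its factors to
    read their indices at chosen positions of one common word. *)
Definition ctrA (H : idx -> idx -> A) (F : tensor) : tensor :=
  fun w => \sum_p \sum_q H p q * F (w ++ [:: p; q]).

Lemma ctrA_ext H F F' w :
  (forall v, size v = (size w).+2 -> F v = F' v) -> ctrA H F w = ctrA H F' w.
Proof.
move=> FF'; apply: eq_bigr => p _; apply: eq_bigr => q _.
by rewrite FF' // size_cat /= addn2.
Qed.

Lemma iter_ctrA_ext H m F F' w :
  (forall v, size v = (size w + m.*2)%N -> F v = F' v) ->
  iter m (ctrA H) F w = iter m (ctrA H) F' w.
Proof.
elim: m w => [|m IH] w FF' /=; first by rewrite FF' // addn0.
apply: ctrA_ext => v sv; apply: IH => u su; apply: FF'.
by rewrite su sv doubleS !addnS !addSn.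
Qed.

Lemma ctrA_sum H (J : Type) (r : seq J) (T : J -> tensor) w :
  ctrA H (fun v => \sum_(j <- r) T j v) w = \sum_(j <- r) ctrA H (T j) w.
Proof.
rewrite /ctrA.
under eq_bigr do under eq_bigr do rewrite mulr_sumr.
under eq_bigr do rewrite exchange_big.
by rewrite exchange_big.
Qed.

Lemma ctrAZ H a T w : ctrA H (fun v => a * T v) w = a * ctrA H T w.
Proof.
rewrite /ctrA mulr_sumr; apply: eq_bigr => p _.
by rewrite mulr_sumr; apply: eq_bigr => q _; rewrite mulrCA.
Qed.

Lemma iter_ctrA_sum H m (J : Type) (r : seq J) (T : J -> tensor) w :
  iter m (ctrA H) (fun v => \sum_(j <- r) T j v) w = \sum_(j <- r) iter m (ctrA H) (T j) w.
Proof.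
elim: m w => [//|m IH] w /=.
by rewrite -ctrA_sum; apply: ctrA_ext => v _; rewrite IH.
Qed.

Lemma iter_ctrAZ H m a T w :
  iter m (ctrA H) (fun v => a * T v) w = a * iter m (ctrA H) T w.
Proof.
elim: m w => [//|m IH] w /=.
by rewrite -ctrAZ; apply: ctrA_ext => v _; rewrite IH.
Qed.

Section Derivation.
Variable de : A -> A.
Hypothesis deD : forall a b, de (a + b) = de a + de b.
Hypothesis deM : forall a b, de (a * b) = de a * b + a * de b.

Lemma de0 : de 0 = 0.
Proof. by apply: (addrI (de 0)); rewrite -deD !addr0. Qed.
Lemma de1 : de 1 = 0.
Proof. by have := deM 1 1; rewrite !mulr1 mul1r => /eqP; rewrite -{1}[de 1]addr0 (inj_eq (addrI _)) eq_sym => /eqP. Qed.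
Lemma deN a : de (- a) = - de a.
Proof. by apply: (addrI (de a)); rewrite -deD !subrr de0. Qed.
Lemma deB a b : de (a - b) = de a - de b.
Proof. by rewrite deD deN. Qed.
Lemma de_sum (J : Type) (r : seq J) (P : pred J) (F : J -> A) :
  de (\sum_(j <- r | P j) F j) = \sum_(j <- r | P j) de (F j).
Proof. exact: (big_morph de deD de0). Qed.

Variable ga : idx -> idx -> A.

Lemma de_act ga' T w :
  de (act ga' T w)
  = act (fun i p => de (ga' i p)) T w + act ga' (fun v => de (T v)) w.
Proof.
elim: w T => [|i w IH] T /=; first by rewrite de0 addr0.
rewrite deD de_sum IH addrACA; congr (_ + _).
by rewrite -big_split; apply: eq_bigr => p _; rewrite deM.
Qed.

(** Covariant derivative in one direction, for a derivation [de] of the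
    coefficients and the matrix [ga] of the connection in that direction. *)
Definition der (T : tensor) : tensor := fun w => de (T w) - act ga T w.

Lemma der_ext T S w :
  (forall v, size v = size w -> T v = S v) -> der T w = der S w.
Proof. by move=> TS; rewrite /der TS // (act_ext _ TS). Qed.

Variable H : idx -> idx -> A.
Hypothesis H_par : forall p q,
  de (H p q) = - (\sum_r ga r p * H r q) - (\sum_r ga r q * H p r).

(** Contraction with a parallel [H] commutes with covariant differentiation: the
    correction terms at the two contracted slots cancel the derivative of [H]. *)
Lemma der_ctrA F w : der (ctrA H F) w = ctrA H (der F) w.
Proof.
rewrite /der /ctrA.
have -> : act ga (fun v => \sum_p \sum_q H p q * F (v ++ [:: p; q])) w
  = \sum_p \sum_q H p q * act ga (fun v => F (v ++ [:: p; q])) w.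
  rewrite -(@act_ext _ (fun v => \sum_p 1 * \sum_q H p q * F (v ++ [:: p; q]))).
    by rewrite act_sum; apply: eq_bigr => p _; rewrite act_sum mul1r.
  by move=> v _; under eq_bigr do rewrite mul1r.
have -> : de (\sum_p \sum_q H p q * F (w ++ [:: p; q]))
  = \sum_p \sum_q H p q * (de (F (w ++ [:: p; q]))
       - \sum_r ga p r * F (w ++ [:: r; q]) - \sum_r ga q r * F (w ++ [:: p; r])).
  rewrite de_sum; under eq_bigr do rewrite de_sum.
  have E p q : de (H p q * F (w ++ [:: p; q])) = H p q * de (F (w ++ [:: p; q]))
     - \sum_r ga r p * H r q * F (w ++ [:: p; q])
     - \sum_r ga r q * H p r * F (w ++ [:: p; q]).
    by rewrite deM H_par !mulrBl mulNr !mulr_suml addrC addrA.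
  under eq_bigr do under eq_bigr do rewrite E.
  under eq_bigr do rewrite !sumrB.
  rewrite !sumrB.
  have E2 p q : H p q * (de (F (w ++ [:: p; q]))
       - \sum_r ga p r * F (w ++ [:: r; q]) - \sum_r ga q r * F (w ++ [:: p; r]))
    = H p q * de (F (w ++ [:: p; q])) - \sum_r H p q * (ga p r * F (w ++ [:: r; q]))
       - \sum_r H p q * (ga q r * F (w ++ [:: p; r])).
    by rewrite -!mulr_sumr; ring.
  under [RHS]eq_bigr do under eq_bigr do rewrite E2.
  under [RHS]eq_bigr do rewrite !sumrB.
  rewrite !sumrB; congr (_ - _ - _).
    under [RHS]eq_bigr do rewrite exchange_big.
    rewrite [RHS]exchange_big /=; apply: eq_bigr => r _.
    rewrite [RHS]exchange_big /=; apply: eq_bigr => q _.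
    by apply: eq_bigr => p _; ring.
  apply: eq_bigr => p _; rewrite exchange_big; apply: eq_bigr => r _.
  by apply: eq_bigr => q _; ring.
rewrite -sumrB; apply: eq_bigr => p _; rewrite -sumrB; apply: eq_bigr => q _.
rewrite act_cat /= addr0; ring.
Qed.

Lemma der_iter_ctrA m F w : der (iter m (ctrA H) F) w = iter m (ctrA H) (der F) w.
Proof.
elim: m w => [//|m IH] w /=.
by rewrite der_ctrA; apply: ctrA_ext => v _; rewrite IH.
Qed.

End Derivation.
End Tensors.

(** * Symbolic tensor expressions *)

(** The pair [(z, k)] stands for [z / 2 ^ k].  All coefficients in sight are
    dyadic, and integers keep the computations exact inside the logic. *)
Definition dyadic := (int * nat)%type.
Definition dmul (x y : dyadic) : dyadic := (x.1 * y.1, (x.2 + y.2)%N).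
Definition dadd (x y : dyadic) : dyadic :=
  let k := maxn x.2 y.2 in
  (x.1 * (2 ^ (k - x.2))%N%:Z + y.1 * (2 ^ (k - y.2))%N%:Z, k).
Definition dz (x : int) : dyadic := (x, 0%N).

(** The pair [(b, n)] stands for the [n]-th covariant derivative of the base
    tensor number [b]. *)
Definition atom := (nat * nat)%type.
Definition tfactor := (atom * seq nat)%type.

(** A coefficient, a number [m] of contractions and a product of atoms, each with
    the labels of its slots.  In an expression of rank [n] the labels below [n]
    are the free arguments, and [n + 2 * j] and [n + 2 * j + 1] form the [j]-th
    contracted pair. *)
Definition term := (dyadic * nat * seq tfactor)%type.
Definition texp := seq term.

Definition labels (fs : seq tfactor) : seq nat := flatten [seq f.2 | f <- fs].

(** Each label occurs exactly once, which makes the expression multilinear in its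
    free arguments. *)
Definition wf n (t : term) := perm_eq (labels t.2) (iota 0 (n + t.1.2.*2)).

Definition shift_factor (f : tfactor) : tfactor := (f.1, map S f.2).
Definition cov_factor (f : tfactor) : tfactor :=
  ((f.1.1, f.1.2.+1), 0%N :: map S f.2).
Fixpoint leibniz (fs : seq tfactor) : seq (seq tfactor) :=
  if fs is f :: fs' then
    (cov_factor f :: map shift_factor fs')
      :: map (cons (shift_factor f)) (leibniz fs')
  else [::].

(** Base tensor 0 is the metric, whose covariant derivatives vanish. *)
Definition dmetric (f : tfactor) := (f.1.1 == 0%N) && (f.1.2 != 0%N).

(** Covariant derivative of an expression by the Leibniz rule; the new index comes
    first, so it gets label 0 and all other labels move up. *)
Definition cov (e : texp) : texp :=
  flatten [seq [seq (t.1, fs) | fs <- leibniz t.2 & ~~ has dmetric fs] | t <- e].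

(** Labels of free arguments are replaced by the given labels, and the contracted
    labels are moved past the first [N] ones. *)
Definition relabel N (ls : seq nat) (f : tfactor) : tfactor :=
  (f.1, [seq (if (l < size ls)%N then nth 0%N ls l else N + (l - size ls))%N | l <- f.2]).
Fixpoint tprod N (L : seq (texp * seq nat)) : texp :=
  if L is (e, ls) :: L' then
    flatten [seq [seq (dmul t.1.1 u.1.1, (t.1.2 + u.1.2)%N,
                       map (relabel N ls) t.2 ++ u.2)
                 | u <- tprod (N + t.1.2.*2) L'] | t <- e]
  else [:: (dz 1, 0%N, [::])].

(** The product of the expressions in [L], each read at the given labels, with [m]
    contractions and the coefficient [c], as an expression of rank [n]. *)
Definition comb n (c : dyadic) m (L : seq (texp * seq nat)) : texp :=
  [seq (dmul c t.1.1, (m + t.1.2)%N, t.2) | t <- tprod (n + m.*2) L].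

(** Weaker than [wf]: labels may be repeated or missing, which is all that
    substitution requires. *)
Definition fits k (t : term) := all (fun l => l < k + t.1.2.*2)%N (labels t.2).
Definition args_ok N (L : seq (texp * seq nat)) :=
  all (fun p => all (fun l => l < N)%N p.2 && all (fits (size p.2)) p.1) L.

Section Eval.
Variables (A : comNzRingType) (H : idx -> idx -> A) (T : atom -> tensor A).
Variable cf : dyadic -> A.
Hypothesis cfM : forall x y, cf (dmul x y) = cf x * cf y.
Hypothesis cf1 : cf (dz 1) = 1.

Definition pval (fs : seq tfactor) : tensor A := fun w =>
  \prod_(f <- fs) T f.1 [seq nth ord0 w l | l <- f.2].
Definition eval (e : texp) : tensor A := fun w =>
  \sum_(t <- e) cf t.1.1 * iter t.1.2 (ctrA H) (pval t.2) w.

Lemma eval_cat e e' w : eval (e ++ e') w = eval e w + eval e' w.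
Proof. by rewrite /eval big_cat. Qed.

Lemma eval_flatten es w : eval (flatten es) w = \sum_(e <- es) eval e w.
Proof.
elim: es => [|e es IH] /=; first by rewrite /eval !big_nil.
by rewrite eval_cat big_cons IH.
Qed.

Lemma pval_cat fs gs w : pval (fs ++ gs) w = pval fs w * pval gs w.
Proof. by rewrite /pval big_cat. Qed.

(** Contracting only appends indices at the end of a word, so the integrand matters
    only on extensions of it. *)
Lemma iter_ctrA_pre m F F' w :
  (forall v, size v = m.*2 -> F (w ++ v) = F' (w ++ v)) ->
  iter m (ctrA H) F w = iter m (ctrA H) F' w.
Proof.
elim: m w => [|m IH] w FF' /=; first by have := FF' [::] erefl; rewrite cats0.
apply: eq_bigr => p _; apply: eq_bigr => q _; congr (_ * _).
by apply: IH => v sv; rewrite -catA FF' //= sv doubleS.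
Qed.

Lemma iter_ctrA_relabel m fs w ls u :
  all (fun l => l < size w)%N ls ->
  all (fun l => l < size ls + size u + m.*2)%N (labels fs) ->
  iter m (ctrA H) (pval (map (relabel (size w) ls) fs)) (w ++ u)
  = iter m (ctrA H) (pval fs) ([seq nth ord0 w l | l <- ls] ++ u).
Proof.
move=> ok_ls; elim: m u => [|m IH] u ok /=.
  rewrite /pval big_map; apply: eq_big_seq => f f_fs /=; congr (T _ _).
  rewrite -map_comp; apply/eq_in_map => l l_f /=.
  have : (l < size ls + size u)%N.
    rewrite addn0 in ok; apply: (allP ok); apply/flattenP; exists f.2 => //.
    exact: map_f.
  case: (ltnP l (size ls)) => l_ls lu; rewrite !nth_cat size_map.
    rewrite (allP ok_ls) ?mem_nth // l_ls.
    by rewrite (nth_map 0%N).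
  by rewrite ltnNge leq_addr /= addKn ltnNge l_ls.
apply: eq_bigr => p _; apply: eq_bigr => q _; congr (_ * _).
rewrite -!catA IH // size_cat /=.
by apply: sub_all ok => l; rewrite doubleS; lia.
Qed.

Lemma iter_ctrA_mull m F fs w :
  all (fun l => l < size w)%N (labels fs) ->
  iter m (ctrA H) (fun v => pval fs v * F v) w
  = pval fs w * iter m (ctrA H) F w.
Proof.
move=> ok; rewrite -iter_ctrAZ; apply: iter_ctrA_pre => v _; congr (_ * _).
apply: eq_big_seq => f f_fs; congr (T _ _); apply/eq_in_map => l l_f.
rewrite nth_cat (allP ok) //; apply/flattenP; exists f.2 => //; exact: map_f.
Qed.

(** Substitution is sound because contraction is linear and commutes with factors
    that do not read the contracted slots ([iter_ctrA_mull]). *)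
Lemma eval_tprod N L w : (N <= size w)%N -> args_ok N L ->
  eval (tprod (size w) L) w
  = \prod_(p <- L) eval p.1 [seq nth ord0 w l | l <- p.2].
Proof.
elim: L w => [|[e ls] L IH] w Nw /=.
  by rewrite /eval /pval big_seq1 big_nil /= cf1 mul1r big_nil.
case/andP=> /andP[/= ok_ls ok_e] ok_L; rewrite big_cons /=.
rewrite eval_flatten big_map [in RHS]/eval mulr_suml; apply: eq_big_seq => t t_e.
rewrite /eval big_map /=.
under eq_bigr do rewrite cfM iterD -mulrA.
rewrite -mulr_sumr -!mulrA; congr (_ * _).
under [LHS]eq_bigr do rewrite -iter_ctrAZ.
rewrite -iter_ctrA_sum.
have fit_t := allP ok_e _ t_e.
have ok_ls' : all (fun l => l < size w)%N ls by apply: sub_all ok_ls => l; lia.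
transitivity (iter t.1.2 (ctrA H) (fun v => (\prod_(p <- L) eval p.1 [seq nth ord0 w l | l <- p.2]) *
   pval (map (relabel (size w) ls) t.2) v) w); last first.
  rewrite iter_ctrAZ mulrC; congr (_ * _).
  by have := @iter_ctrA_relabel t.1.2 t.2 w ls [::] ok_ls'; rewrite !cats0 addn0; apply.
apply: iter_ctrA_pre => v sv.
have -> : \prod_(p <- L) eval p.1 [seq nth ord0 w l | l <- p.2]
   = \prod_(p <- L) eval p.1 [seq nth ord0 (w ++ v) l | l <- p.2].
  apply: eq_big_seq => p /(allP ok_L) /andP[/allP pN _]; congr (eval _ _).
  by apply/eq_in_map => l /pN lN; rewrite nth_cat (leq_trans lN Nw).
rewrite -IH //; last by rewrite size_cat; lia.
rewrite /eval size_cat sv mulr_suml; apply: eq_bigr => u _.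
rewrite -mulrA; congr (_ * _); rewrite mulrC -iter_ctrA_mull.
  by apply: iter_ctrA_pre => x _; rewrite pval_cat.
rewrite size_cat sv; apply/allP => l /flattenP[_ /mapP[_ /mapP[f f_t ->] ->] /mapP[k k_f ->]].
have kt : (k < size ls + t.1.2.*2)%N.
  by apply: (allP fit_t); apply/flattenP; exists f.2 => //; exact: map_f.
rewrite /=; case: (ltnP k (size ls)) => kls; last by rewrite ltn_add2l ltn_subLR.
by have /= := allP ok_ls' _ (mem_nth 0%N kls); move=> h; apply: leq_trans h (leq_addr _ _).
Qed.

Lemma eval_comb n c m L w : size w = n -> args_ok (n + m.*2) L ->
  eval (comb n c m L) w
  = cf c * iter m (ctrA H)
      (fun v => \prod_(p <- L) eval p.1 [seq nth ord0 v l | l <- p.2]) w.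
Proof.
move=> sw okL; rewrite /eval big_map /=.
under eq_bigr do rewrite cfM -mulrA.
rewrite -mulr_sumr; congr (_ * _).
under eq_bigr do rewrite iterD -iter_ctrAZ.
rewrite -iter_ctrA_sum; apply: iter_ctrA_pre => v sv.
rewrite -(eval_tprod _ okL) ?size_cat ?sw ?sv //.
Qed.

(** When no position is read twice, a correction in the slots of a factor is a
    correction at the positions which it reads. *)
Lemma act_pos ga (S : tensor A) w ls : uniq ls ->
  act ga S [seq nth ord0 w l | l <- ls]
  = \sum_(k <- ls) \sum_p ga (nth ord0 w k) p
       * S [seq nth ord0 (set_nth ord0 w k p) l | l <- ls].
Proof.
elim: ls S => [|k ls IH] S /=; first by rewrite big_nil.
case/andP=> k_ls u_ls; rewrite big_cons; congr (_ + _).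
  apply: eq_bigr => p _; rewrite nth_set_nth /= eqxx; congr (_ * S (_ :: _)).
  apply/eq_in_map => l l_ls; rewrite nth_set_nth /=.
  by case: eqP => // lk; rewrite -lk l_ls in k_ls.
rewrite IH //; apply: eq_big_seq => l l_ls; apply: eq_bigr => p _.
rewrite nth_set_nth /=; case: eqP => // kl; by rewrite kl l_ls in k_ls.
Qed.

Lemma act_pos_iota ga (S : tensor A) w :
  act ga S w = \sum_(k <- iota 0 (size w)) \sum_p ga (nth ord0 w k) p
       * S (set_nth ord0 w k p).
Proof.
have := act_pos ga S w (iota_uniq 0 (size w)).
rewrite -/(mkseq _ _) mkseq_nth => ->; apply: eq_big_seq => k.
rewrite mem_iota /= => kw; apply: eq_bigr => p _; congr (_ * S _).
have {1}-> : size w = size (set_nth ord0 w k p) by rewrite size_set_nth; apply/esym/maxn_idPr.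
exact: mkseq_nth.
Qed.

(** The derivation action on [e] of the endomorphism obtained by raising the first
    slot of [k]; the first [r] labels are the slots of [k] in between. *)
Definition tact r n (k e : texp) : texp :=
  flatten [seq comb (r + n) (dz 1) 1
     [:: (k, (r + n)%N :: iota 0 r ++ [:: (r + j)%N]);
         (e, set_nth 0%N (iota r n) j (r + n).+1)] | j <- iota 0 n].

Lemma eval_tact r n k e pre w : size pre = r -> size w = n ->
  all (fits r.+2) k -> all (fits n) e ->
  eval (tact r n k e) (pre ++ w)
  = act (fun i p => \sum_m H m p * eval k (m :: pre ++ [:: i])) (eval e) w.
Proof.
move=> sp sw fk fe; rewrite act_pos_iota eval_flatten big_map sw.
apply: eq_big_seq => j; rewrite mem_iota /= add0n => jn.
rewrite eval_comb ?size_cat ?sp ?sw //; last first.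
  apply/andP; split; last first.
    rewrite andbT /=; apply/andP; split; last first.
      by rewrite size_set_nth size_iota (maxn_idPr _).
    apply/(all_nthP 0%N) => i; rewrite size_set_nth size_iota (maxn_idPr _) // => ii.
    rewrite nth_set_nth /=; case: eqP => _; last rewrite nth_iota //; lia.
  rewrite /= size_cat size_iota addn1 fk andbT all_cat /= andbT.
  apply/and3P; split; try lia.
  by apply/allP => i; rewrite mem_iota; lia.
rewrite cf1 mul1r /= /ctrA exchange_big /=; apply: eq_bigr => q _.
rewrite mulr_suml; apply: eq_bigr => p _.
rewrite !big_cons big_nil mulr1 /= mulrA; congr (_ * _ * _).
  congr (eval _ (_ :: _)).
    by rewrite nth_cat size_cat sp sw ltnn subnn.
  rewrite map_cat; congr (_ ++ _).
    rewrite -catA; apply: (@eq_from_nth _ ord0); first by rewrite size_map size_iota.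
    rewrite size_map size_iota => i isz; rewrite (nth_map 0%N) ?size_iota //.
    by rewrite nth_iota // add0n nth_cat sp isz.
  rewrite /= -catA nth_cat sp ltnNge leq_addr /= addKn nth_cat sw jn.
  by congr [:: _].
congr (eval e _).
apply: (@eq_from_nth _ ord0).
  by rewrite size_map !size_set_nth size_iota sw.
rewrite size_map size_set_nth size_iota (maxn_idPr _) // => i isz.
rewrite (nth_map 0%N) ?size_set_nth ?size_iota ?(maxn_idPr _) //.
rewrite !nth_set_nth /=; case: eqP => _.
  by rewrite nth_cat size_cat sp sw ltnNge leqnSn /= subSnn.
rewrite nth_iota // nth_cat size_cat sp sw ltn_add2l isz.
by rewrite nth_cat sp ltnNge leq_addr /= addKn.
Qed.

Section Leibniz.
Variable de : A -> A.
Hypothesis deD : forall a b, de (a + b) = de a + de b.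
Hypothesis deM : forall a b, de (a * b) = de a * b + a * de b.
Variable ga : idx -> idx -> A.

(** The Leibniz rule for [der], as a recursion on the list of factors. *)
Fixpoint pvalD (fs : seq tfactor) : tensor A := fun w =>
  if fs is f :: fs' then
    der de ga (T f.1) [seq nth ord0 w l | l <- f.2] * pval fs' w
    + T f.1 [seq nth ord0 w l | l <- f.2] * pvalD fs' w
  else 0.

(** The correction term of a covariant derivative is attached to the slots of the
    whole word; since each slot is read by exactly one factor, it distributes over
    the factors. *)
Lemma der_pval fs w : perm_eq (labels fs) (iota 0 (size w)) ->
  der de ga (pval fs) w = pvalD fs w.
Proof.
move=> pfs.
have ufs : uniq (labels fs) by rewrite (perm_uniq pfs) iota_uniq.
rewrite /der act_pos_iota -(perm_big _ pfs) /=.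
elim: fs {pfs} ufs => [|f fs IH] ufs.
  by rewrite /= big_nil /pval big_nil (de1 deM) subr0.
move: ufs; rewrite [labels _]/= cat_uniq => /and3P[uf /hasPn f_fs ufs].
rewrite big_cat /= -IH //.
have pvalE u : pval (f :: fs) u = T f.1 [seq nth ord0 u l | l <- f.2] * pval fs u.
  by rewrite /pval big_cons.
rewrite pvalE deM.
rewrite [X in _ - (X + _)](_ : _ = act ga (T f.1) [seq nth ord0 w l | l <- f.2] * pval fs w).
  rewrite [X in _ - (_ + X)](_ : _ = T f.1 [seq nth ord0 w l | l <- f.2] *
      \sum_(k <- labels fs) \sum_p ga (nth ord0 w k) p * pval fs (set_nth ord0 w k p)).
    by rewrite /der; ring.
  rewrite mulr_sumr; apply: eq_big_seq => k k_fs.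
  rewrite mulr_sumr; apply: eq_bigr => p _; rewrite pvalE mulrCA; congr (T _ _ * _).
  apply/eq_in_map => l l_f; rewrite nth_set_nth /=; case: eqP => // lk.
  by have := f_fs _ k_fs; rewrite /= -lk l_f.
rewrite act_pos // mulr_suml; apply: eq_big_seq => k k_f.
rewrite mulr_suml; apply: eq_bigr => p _; rewrite pvalE mulrA; congr (_ * _).
apply: eq_big_seq => j j_fs; congr (T _ _); apply/eq_in_map => l l_j.
rewrite nth_set_nth /=; case: eqP => // lk.
suff /f_fs : k \in labels fs by rewrite /= k_f.
by rewrite -lk; apply/flattenP; exists j.2 => //; apply: map_f.
Qed.

End Leibniz.
End Eval.

Section Nabla.
Variables (A : comNzRingType) (H : idx -> idx -> A).
Variables (d : idx -> A -> A) (Gam : idx -> idx -> idx -> A).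
Hypothesis dD : forall l a b, d l (a + b) = d l a + d l b.
Hypothesis dM : forall l a b, d l (a * b) = d l a * b + a * d l b.
Hypothesis H_par : forall l p q,
  d l (H p q) = - (\sum_r Gam p l r * H r q) - (\sum_r Gam q l r * H p r).
Variable cf : dyadic -> A.
Hypothesis d_cf : forall l c, d l (cf c) = 0.

Definition nabla (T : tensor A) : tensor A := fun w =>
  if w is l :: w' then der (d l) (fun i p => Gam p l i) T w' else 0.

(** The iterated covariant derivatives of all the base tensors. *)
Definition jets (base : nat -> tensor A) (a : atom) : tensor A :=
  iter a.2 nabla (base a.1).

Lemma nabla_ext T S w :
  (forall v, (size v).+1 = size w -> T v = S v) -> nabla T w = nabla S w.
Proof.
case: w => [//|l w] TS /=; apply: der_ext => v sv; apply: TS; by rewrite /= sv.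
Qed.

Variable base : nat -> tensor A.
Hypothesis base_par : forall n w, jets base (0%N, n.+1) w = 0.

Lemma pval_leibniz l fs v :
  \sum_(gs <- leibniz fs) pval (jets base) gs (l :: v)
  = pvalD (jets base) (d l) (fun i p => Gam p l i) fs v.
Proof.
have sh f : [seq nth ord0 (l :: v) k | k <- [seq k.+1 | k <- f]] = [seq nth ord0 v k | k <- f].
  by rewrite -map_comp.
elim: fs => [|f fs IH] /=; first by rewrite big_nil.
rewrite big_cons big_map -IH mulr_sumr; congr (_ + _).
  rewrite /pval big_cons big_map /= sh; congr (_ * _).
  by apply: eq_bigr => g _; rewrite sh.
by apply: eq_bigr => g _; rewrite /pval big_cons /= sh.
Qed.

(** Symbolic differentiation is sound as soon as the inverse metric is parallel, so
    that it passes through contractions, and the metric is, so that the terms which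
    [cov] discards are zero. *)
Lemma nabla_eval n e w : all (wf n) e -> size w = n.+1 ->
  nabla (eval H (jets base) cf e) w = eval H (jets base) cf (cov e) w.
Proof.
case: w => [//|l w] we [sw] /=.
rewrite eval_flatten big_map /der (de_sum (dD l)) /eval.
rewrite (@act_sum _ _ _ e (fun t => cf t.1.1) (fun t => iter t.1.2 (ctrA H) (pval (jets base) t.2))) -sumrB.
apply: eq_big_seq => t t_e.
rewrite dM d_cf mul0r add0r -mulrBr big_map big_filter /=.
rewrite -mulr_sumr; congr (_ * _).
rewrite -/(der _ _ _ _) (der_iter_ctrA (dD l) (dM l)) //.
rewrite [RHS]big_mkcond /=.
have dropm fs : (if ~~ has dmetric fs then iter t.1.2 (ctrA H) (pval (jets base) fs) (l :: w) else 0)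
   = iter t.1.2 (ctrA H) (pval (jets base) fs) (l :: w).
  case: ifPn => //; rewrite negbK => /hasP[[[b n'] ls] f_fs /andP[/= /eqP b0 n0]].
  rewrite -[LHS](mul0r (iter t.1.2 (ctrA H) (fun=> 0) (l :: w))) -iter_ctrAZ.
  apply: iter_ctrA_pre => v _; rewrite mul0r /pval (big_rem _ f_fs) /= b0; case: n' n0 {f_fs} => // n' _.
  by rewrite base_par mul0r.
under eq_bigr do rewrite dropm.
rewrite -iter_ctrA_sum.
transitivity (iter t.1.2 (ctrA H) (pvalD (jets base) (d l) (fun i p => Gam p l i) t.2) w).
  apply: iter_ctrA_pre => v sv; apply: der_pval => //.
  by rewrite size_cat sw sv; exact: (allP we).
elim: t.1.2 w {sw dropm} => [|m IH] w /=; first by rewrite pval_leibniz.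
by apply: eq_bigr => p _; apply: eq_bigr => q _; rewrite IH.
Qed.

End Nabla.

(** * Deciding identities in an orthonormal frame *)

(** The variable [[:: b, n & w]] stands for the frame component with indices [w] of
    the [n]-th covariant derivative of the base tensor [b]. *)
Definition var := seq nat.
Definition mono := seq var.
Definition poly := seq (dyadic * mono).

Definition axes : seq nat := [:: 0; 1; 2]%N.

(** In an orthonormal frame a contraction is a sum over equal pairs of indices. *)
Fixpoint frame_ext m (w : seq nat) : seq (seq nat) :=
  if m is m'.+1 then flatten [seq frame_ext m' (w ++ [:: p; p]) | p <- axes] else [:: w].
Definition var_of (w : seq nat) (f : tfactor) : var :=
  [:: f.1.1, f.1.2 & [seq nth 0%N w l | l <- f.2]].

(** In an orthonormal frame the metric has components 0 and 1. *)
Definition is_one (v : var) :=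
  if v is [:: 0; 0; a; b]%N then a == b else false.
Definition is_zero (v : var) :=
  match v with
  | [:: 0; 0; a; b]%N => a != b
  | 0%N :: n.+1 :: _ => true
  | _ => false
  end.
Definition expand_term (t : term) w : poly :=
  [seq (t.1.1, [seq v <- vs | ~~ is_one v])
  | vs <- [seq map (var_of w') t.2 | w' <- frame_ext t.1.2 w] & ~~ has is_zero vs].
Definition expand (e : texp) w : poly := flatten [seq expand_term t w | t <- e].

Fixpoint var_le (s t : var) :=
  match s, t with
  | [::], _ => true
  | _, [::] => false
  | x :: s', y :: t' =>
    if (x < y)%N then true else if (x == y)%N then var_le s' t' else false
  end.
Fixpoint mono_le (s t : mono) :=
  match s, t with
  | [::], _ => true
  | _, [::] => false
  | x :: s', y :: t' => if x == y then mono_le s' t' else var_le x y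
  end.

(** Adds up adjacent equal monomials and drops those whose coefficient is zero; the
    head of the list is carried as an accumulator. *)
Fixpoint merge_equal (c : dyadic) (m : mono) (p : poly) : poly :=
  match p with
  | [::] => if c.1 == 0 then [::] else [:: (c, m)]
  | (c', m') :: p' =>
    if m == m' then merge_equal (dadd c c') m p'
    else if c.1 == 0 then merge_equal c' m' p' else (c, m) :: merge_equal c' m' p'
  end.
Definition collect (p : poly) : poly :=
  match sort (fun x y => mono_le x.2 y.2) [seq (x.1, sort var_le x.2) | x <- p] with
  | [::] => [::]
  | (c, m) :: p' => merge_equal c m p'
  end.

Section Normalize.
Variable rels : seq (nat * texp).
Variable rule : var -> option (dyadic * nat * seq nat).

(** A rule never asserts an equation of its own: it proposes a multiple of an
    instance of one of the relations, and that instance, which is zero, is added to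
    the variable.  When the rule is well chosen the variable itself cancels. *)
Definition rewrite_var (v : var) : poly :=
  (dz 1, [:: v]) ::
  if rule v is Some (c, k, w) then
    let r := nth (0%N, [::]) rels k in
    if (size w == r.1) && all (fun i => i < 3)%N w then
      [seq (dmul c x.1, x.2) | x <- expand r.2 w]
    else [::]
  else [::].
Definition pmul (p q : poly) : poly :=
  flatten [seq [seq (dmul x.1 y.1, x.2 ++ y.2) | y <- q] | x <- p].
Definition rewrite_mono (m : mono) : poly :=
  foldr (fun v p => pmul (collect (rewrite_var v)) p) [:: (dz 1, [::])] m.
Definition rewrite_poly (p : poly) : poly :=
  collect (flatten [seq [seq (dmul x.1 y.1, y.2) | y <- rewrite_mono x.2] | x <- p]).

(** [fuel] is the number of rewriting passes; the value is preserved for any number. *)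
Definition normalize fuel e w : poly :=
  iter fuel rewrite_poly (collect (expand e w)).

Fixpoint frame_tuples n : seq (seq nat) :=
  if n is n'.+1 then flatten [seq [seq a :: w | w <- frame_tuples n'] | a <- axes]
  else [:: [::]].

(** All frame components normalize to the empty polynomial. *)
Definition check_zero fuel n e :=
  all (wf n) e && all (fun w => nilp (normalize fuel e w)) (frame_tuples n).
End Normalize.

Section Frame.
Variable R : numFieldType.
Notation vec := 'rV[R]_3.
Notation rtensor := (seq idx -> R).

Definition dval (c : dyadic) : R := c.1%:~R / 2 ^+ c.2.

Lemma dvalM x y : dval (dmul x y) = dval x * dval y.
Proof. by rewrite /dval /= intrM exprD invfM mulrACA. Qed.
Lemma dval1 : dval (dz 1) = 1.
Proof. by rewrite /dval /= expr0 divr1. Qed.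
Lemma dvalD x y : dval (dadd x y) = dval x + dval y.
Proof.
rewrite /dval /=; set k := maxn _ _.
have two_n0 n : (2 ^+ n : R) != 0 by rewrite expf_neq0 // pnatr_eq0.
rewrite intrD !intrM mulrDl.
have E (z : int) n : (n <= k)%N -> z%:~R * ((2 ^ (k - n))%N%:Z)%:~R / 2 ^+ k = z%:~R / 2 ^+ n :> R.
  move=> nk; rewrite -pmulrn natrX -{2}(subnK nk) exprD invfM mulrA mulfK //.
by rewrite !E // /k (leq_maxl, leq_maxr).
Qed.
Lemma dval_eq0 c : c.1 == 0 -> dval c = 0.
Proof. by move/eqP=> c0; rewrite /dval c0 mul0r. Qed.

(** The multilinear extension of [S], evaluated on vectors; on basis vectors it gives
    back the components ([fr_delta]). *)
Fixpoint fr (S : rtensor) (us : seq vec) : R :=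
  if us is u :: us' then \sum_i u 0 i * fr (fun v => S (i :: v)) us' else S [::].

Lemma fr_ext S S' us : (forall w, size w = size us -> S w = S' w) -> fr S us = fr S' us.
Proof.
elim: us S S' => [|u us IH] S S' SS' /=; first exact: SS'.
apply: eq_bigr => i _; congr (_ * _); apply: IH => w sw; apply: SS'.
by rewrite /= sw.
Qed.

Lemma fr0 us : fr (fun=> 0) us = 0.
Proof. by elim: us => [//|u us IH] /=; rewrite big1 // => i _; rewrite IH mulr0. Qed.

Definition dl (i : idx) : vec := delta_mx 0 i.

Lemma fr_delta S w : fr S (map dl w) = S w.
Proof.
elim: w S => [//|i w IH] S /=; rewrite (bigD1 i) //= IH mxE !eqxx mul1r.
by rewrite big1 ?addr0 // => j ji; rewrite mxE (negPf ji) andbF mul0r.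
Qed.

(** Linearity in each of the first [n] arguments, in the form in which it is used:
    expansion of one argument in a finite family. *)
Definition multilin n (F : seq vec -> R) := forall us k (J : Type) (r : seq J) c (v : J -> vec),
  size us = n -> (k < n)%N ->
  F (set_nth 0 us k (\sum_(a <- r) c a *: v a)) = \sum_(a <- r) c a * F (set_nth 0 us k (v a)).

(** Linearity survives reading the arguments through a list of labels, provided that
    the label in question occurs once. *)
Lemma fr_lin S us k ls (J : Type) (r : seq J) c (v : J -> vec) : uniq ls -> k \in ls ->
  fr S [seq nth 0 (set_nth 0 us k (\sum_(a <- r) c a *: v a)) l | l <- ls]
  = \sum_(a <- r) c a * fr S [seq nth 0 (set_nth 0 us k (v a)) l | l <- ls].
Proof.
elim: ls S => [//|l ls IH] S /= /andP[l_ls u_ls]; rewrite inE => /orP[/eqP kl|k_ls].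
  rewrite -kl in l_ls *.
  have E u : [seq nth 0 (set_nth 0 us k u) l0 | l0 <- ls] = [seq nth 0 us l0 | l0 <- ls].
    apply/eq_in_map => j j_ls; rewrite nth_set_nth /=; case: eqP => // jk.
    by rewrite -jk j_ls in l_ls.
  rewrite E nth_set_nth /= eqxx.
  under [RHS]eq_bigr => a _ do rewrite E nth_set_nth /= eqxx mulr_sumr.
  rewrite exchange_big /=; apply: eq_bigr => i _.
  rewrite summxE mulr_suml; apply: eq_bigr => a _; by rewrite mxE mulrA.
have kl : k == l = false by apply/eqP => kl; rewrite -kl k_ls in l_ls.
under [RHS]eq_bigr => a _ do rewrite mulr_sumr.
rewrite exchange_big /=; apply: eq_bigr => i _; rewrite IH // mulr_sumr.
apply: eq_bigr => a _; rewrite !nth_set_nth /= eq_sym kl; ring.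
Qed.

Lemma fr_nolin S us k ls u : k \notin ls ->
  fr S [seq nth 0 (set_nth 0 us k u) l | l <- ls] = fr S [seq nth 0 us l | l <- ls].
Proof.
move=> k_ls; congr fr; apply/eq_in_map => j j_ls; rewrite nth_set_nth /=; case: eqP => // jk.
by rewrite -jk j_ls in k_ls.
Qed.

Section Eval.
Variable T : atom -> rtensor.

Definition pvalv (fs : seq tfactor) (us : seq vec) : R :=
  \prod_(f <- fs) fr (T f.1) [seq nth 0 us l | l <- f.2].

Lemma pvalv_lin n fs : perm_eq (labels fs) (iota 0 n) -> multilin n (pvalv fs).
Proof.
move=> pfs us k J r c v sus kn.
have k_fs : k \in labels fs by rewrite (perm_mem pfs) mem_iota.
have ufs : uniq (labels fs) by rewrite (perm_uniq pfs) iota_uniq.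
elim: fs k_fs ufs {pfs} => [//|f fs IH].
rewrite /labels /= mem_cat cat_uniq => /orP k_f /and3P[uf /hasPn f_fs ufs].
have cE u : pvalv (f :: fs) u = fr (T f.1) [seq nth 0 u l | l <- f.2] * pvalv fs u.
  by rewrite /pvalv big_cons.
rewrite cE; case: k_f => [k_f|k_fs].
  have E u : pvalv fs (set_nth 0 us k u) = pvalv fs us.
    apply: eq_big_seq => g g_fs; apply: fr_nolin; apply/negP => k_g.
    suff /f_fs : k \in labels fs by rewrite /= k_f.
    by apply/flattenP; exists g.2 => //; apply: map_f.
  rewrite E fr_lin // mulr_suml; apply: eq_bigr => a _; by rewrite cE E mulrA.
have k_f : k \notin f.2 by apply: f_fs.
rewrite fr_nolin // IH // mulr_sumr; apply: eq_bigr => a _.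
by rewrite cE fr_nolin // mulrCA.
Qed.

Variables (H : idx -> idx -> R) (b : nat -> vec).
Hypothesis Hb : forall p q, H p q = \sum_(a <- axes) b a 0 p * b a 0 q.
Hypothesis b_span : forall u : vec, exists c, u = \sum_(a <- axes) c a *: b a.

Definition ctrv (F : seq vec -> R) us := \sum_(a <- axes) F (us ++ [:: b a; b a]).
Definition ctrh (F : seq vec -> R) us := \sum_p \sum_q H p q * F (us ++ [:: dl p; dl q]).

Lemma set_nth_catl (us vs : seq vec) k u : (k < size us)%N ->
  set_nth 0 (us ++ vs) k u = set_nth 0 us k u ++ vs.
Proof.
elim: us k => [//|x us IH] [|k] //= ku; by rewrite IH.
Qed.
Lemma set_nth_catr (us vs : seq vec) k u :
  set_nth 0 (us ++ vs) (size us + k) u = us ++ set_nth 0 vs k u.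
Proof. by elim: us => [//|x us IH] /=; rewrite IH. Qed.

Lemma vec_delta (u : vec) : u = \sum_p u 0 p *: dl p.
Proof. exact: row_sum_delta. Qed.

(** Contraction with [H] does not depend on the basis: it may be computed in the
    coordinate basis or in the orthonormal one. *)
Lemma ctrh_ctrv n F us : multilin n.+2 F -> size us = n -> ctrh F us = ctrv F us.
Proof.
move=> linF sus; subst n; rewrite /ctrh /ctrv.
have set0 x y u : set_nth 0 (us ++ [:: x; y]) (size us) u = us ++ [:: u; y].
  by have := set_nth_catr us [:: x; y] 0 u; rewrite addn0.
have set1 x y u : set_nth 0 (us ++ [:: x; y]) (size us).+1 u = us ++ [:: x; u].
  by have := set_nth_catr us [:: x; y] 1 u; rewrite addn1.
have E a : F (us ++ [:: b a; b a]) = \sum_p \sum_q b a 0 p * b a 0 q * F (us ++ [:: dl p; dl q]).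
  have := linF (us ++ [:: 0; b a]) (size us) _ (index_enum _) (b a 0) dl.
  rewrite -vec_delta size_cat /= addn2 => /(_ erefl (leqnSn _)).
  rewrite set0 => ->; apply: eq_bigr => p _; rewrite set0.
  have := linF (us ++ [:: dl p; 0]) (size us).+1 _ (index_enum _) (b a 0) dl.
  rewrite -vec_delta size_cat /= addn2 => /(_ erefl (leqnn _)).
  rewrite set1 => ->; rewrite mulr_sumr; apply: eq_bigr => q _.
  by rewrite set1 mulrA.
under [RHS]eq_bigr do rewrite E.
rewrite [RHS]exchange_big; apply: eq_bigr => p _.
rewrite [RHS]exchange_big; apply: eq_bigr => q _.
by rewrite Hb mulr_suml.
Qed.

Lemma ctrv_lin n F : multilin n.+2 F -> multilin n (ctrv F).
Proof.
move=> linF us k J r c v sus kn; rewrite /ctrv.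
under [RHS]eq_bigr do rewrite mulr_sumr.
rewrite exchange_big; apply: eq_bigr => a _.
rewrite -set_nth_catl ?sus // linF ?size_cat ?sus ?addn2 //; last exact: ltn_trans kn _.
by apply: eq_bigr => j _; rewrite set_nth_catl ?sus.
Qed.

Lemma iter_ctrv_lin m n F : multilin (n + m.*2) F -> multilin n (iter m ctrv F).
Proof.
elim: m n => [|m IH] n; first by rewrite addn0.
by rewrite doubleS !addnS -!addSn => /IH /ctrv_lin.
Qed.

Lemma iter_ctrh_ctrv m n F us : multilin (n + m.*2) F -> size us = n ->
  iter m ctrh F us = iter m ctrv F us.
Proof.
elim: m n us => [//|m IH] n us.
rewrite doubleS !addnS -!addSn => linF sus /=.
rewrite -(@ctrh_ctrv n) //; last exact: iter_ctrv_lin.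
apply: eq_bigr => p _; apply: eq_bigr => q _.
by rewrite (IH n.+2) // size_cat sus addn2.
Qed.

(** A multilinear function vanishing on a spanning family vanishes. *)
Lemma multilin_zero n F : multilin n F ->
  (forall w, size w = n -> all (fun i => i < 3)%N w -> F (map b w) = 0) ->
  forall us, size us = n -> F us = 0.
Proof.
elim: n F => [|n IH] F linF F0 us; first by case: us => // _; exact: (F0 [::]).
case: us => [//|u us] [sus].
have [c ->] := b_span u.
have /= -> := linF (0 :: us) 0%N nat axes c b.
- rewrite !big_cons big_nil.
  suff E a : (a < 3)%N -> F (b a :: us) = 0 by rewrite !E // !mulr0 !addr0.
  move=> a3; apply: (IH (fun vs => F (b a :: vs))) => //.
    move=> vs k J r e v svs kn.
    by rewrite -[RHS](linF (b a :: vs) k.+1) //= svs.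
  by move=> w sw w3; apply: (F0 (a :: w)); rewrite /= ?sw ?a3.
- by rewrite sus.
- by [].
Qed.

Lemma multilin_delta n F : multilin n F ->
  (forall w : seq idx, size w = n -> F (map dl w) = 0) ->
  forall us, size us = n -> F us = 0.
Proof.
elim: n F => [|n IH] F linF F0 us; first by case: us => // _; exact: (F0 [::]).
case: us => [//|u us] [sus]; rewrite [u]vec_delta.
have /= -> := linF (0 :: us) 0%N _ (index_enum _) (u 0) dl.
- rewrite big1 // => i _.
  suff -> : F (dl i :: us) = 0 by rewrite mulr0.
  apply: (IH (fun vs => F (dl i :: vs))) => //.
    move=> vs k J r e v svs kn.
    by rewrite -[RHS](linF (dl i :: vs) k.+1) //= svs.
  by move=> w sw; apply: (F0 (i :: w)); rewrite /= sw.
- by rewrite sus.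
- by [].
Qed.

(** The value of an expression on vectors instead of indices. *)
Definition evalv (e : texp) us := \sum_(t <- e) dval t.1.1 * iter t.1.2 ctrv (pvalv t.2) us.

Lemma evalv_lin n e : all (wf n) e -> multilin n (evalv e).
Proof.
move=> we us k J r c v sus kn; rewrite /evalv.
under [RHS]eq_bigr do rewrite mulr_sumr.
rewrite exchange_big; apply: eq_big_seq => t t_e.
rewrite (iter_ctrv_lin (pvalv_lin (allP we _ t_e))) // mulr_sumr.
by apply: eq_bigr => a _; rewrite mulrCA.
Qed.

Lemma evalv_delta n e w : all (wf n) e -> size w = n ->
  evalv e (map dl w) = eval H T dval e w.
Proof.
move=> we sw; apply: eq_big_seq => t t_e; congr (_ * _).
rewrite -(iter_ctrh_ctrv (pvalv_lin (allP we _ t_e))) ?size_map //.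
have : all (fun l => l < size w + t.1.2.*2)%N (labels t.2).
  apply/allP => l; rewrite (perm_mem (allP we _ t_e)) mem_iota sw.
  by rewrite add0n.
elim: t.1.2 w {sw} => [|m IH] w ok /=.
  apply: eq_big_seq => f f_t; rewrite -fr_delta -map_comp; congr fr.
  apply/eq_in_map => l l_f /=; rewrite (nth_map ord0) //.
  rewrite addn0 in ok; apply: (allP ok); apply/flattenP; exists f.2 => //; exact: map_f.
apply: eq_bigr => p _; apply: eq_bigr => q _; congr (_ * _).
rewrite -[[:: dl p; dl q]]/(map dl [:: p; q]) -map_cat IH //.
by apply: sub_all ok => l; rewrite size_cat /= doubleS; lia.
Qed.

Hypothesis metric_one : forall a c, (a < 3)%N -> (c < 3)%N ->
  fr (T (0%N, 0%N)) [:: b a; b c] = (a == c)%:R.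
Hypothesis metric_par : forall n w, T (0%N, n.+1) w = 0.

Definition vval (v : var) : R :=
  if v is base :: ord :: w then fr (T (base, ord)) (map b w) else 0.
Definition mval (m : mono) : R := \prod_(v <- m) vval v.
Definition peval (p : poly) : R := \sum_(x <- p) dval x.1 * mval x.2.

Lemma mval_cat m m' : mval (m ++ m') = mval m * mval m'.
Proof. exact: big_cat. Qed.

Lemma is_one_val v : all (fun i => i < 3)%N (drop 2 v) -> is_one v -> vval v = 1.
Proof.
case: v => [|[|?] [|[|?] [|a [|c [|? ?]]]]] //= /and3P[a3 c3 _] /eqP ac.
by have := metric_one a3 c3; rewrite /= ac eqxx.
Qed.

Lemma is_zero_val v : all (fun i => i < 3)%N (drop 2 v) -> is_zero v -> vval v = 0.
Proof.
case: v => [|[|?] [|[|n] w]] //=; last first.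
  move=> _ _; rewrite (@fr_ext _ (fun=> 0)) ?fr0 // => u _; exact: metric_par.
case: w => [|a [|c [|? ?]]] //= /and3P[a3 c3 _] /negPf ac.
by have := metric_one a3 c3; rewrite /= ac.
Qed.

Lemma peval_cat p q : peval (p ++ q) = peval p + peval q.
Proof. by rewrite /peval big_cat. Qed.

Lemma peval_cons x p : peval (x :: p) = dval x.1 * mval x.2 + peval p.
Proof. by rewrite /peval big_cons. Qed.

Lemma peval_flatten ps : peval (flatten ps) = \sum_(p <- ps) peval p.
Proof.
elim: ps => [|p ps IH] /=; first by rewrite /peval !big_nil.
by rewrite peval_cat big_cons IH.
Qed.

Lemma frame_ext_sum m F w :
  iter m ctrv F (map b w) = \sum_(w' <- frame_ext m w) F (map b w').
Proof.
elim: m w => [|m IH] w; first by rewrite big_seq1.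
have -> : frame_ext m.+1 w = flatten [seq frame_ext m (w ++ [:: p; p]) | p <- axes] by [].
rewrite iterS big_flatten big_map; apply: eq_bigr => a _.
by rewrite -IH map_cat.
Qed.

Lemma frame_ext_mem m w w' : w' \in frame_ext m w ->
  size w' = (size w + m.*2)%N /\ (all (fun i => i < 3)%N w -> all (fun i => i < 3)%N w').
Proof.
elim: m w => [|m IH] w; first by rewrite /= inE => /eqP ->; rewrite addn0.
have -> : frame_ext m.+1 w = flatten [seq frame_ext m (w ++ [:: p; p]) | p <- axes] by [].
case/flattenP => s /mapP[a a3 ->] /IH[-> ok]; rewrite size_cat /=; split; first by lia.
move=> w3; apply: ok; rewrite all_cat w3 /= andbT andbb.
by move: a3; rewrite !inE => /or3P[] /eqP ->.
Qed.

(** Expansion in the frame, where contracted pairs run over equal indices, the metric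
    is the identity and its covariant derivatives are zero. *)
Lemma expandP n e w : all (wf n) e -> size w = n -> all (fun i => i < 3)%N w ->
  evalv e (map b w) = peval (expand e w).
Proof.
move=> we sw w3; rewrite /expand peval_flatten big_map; apply: eq_big_seq => t t_e.
rewrite frame_ext_sum /peval big_map big_filter big_map.
rewrite mulr_sumr [RHS]big_mkcond /=; apply: eq_big_seq => w' w'_w.
have [sw' /(_ w3) w3'] := frame_ext_mem w'_w.
have nth3 l : (nth 0 w' l < 3)%N.
  have [lw|lw] := ltnP l (size w'); first exact: (allP w3' _ (mem_nth _ lw)).
  by rewrite nth_default.
have ok (f : tfactor) : all (fun i => i < 3)%N (drop 2 (var_of w' f)).
  by rewrite /= drop0; apply/allP => _ /mapP[l _ ->].
have -> : pvalv t.2 (map b w') = mval (map (var_of w') t.2).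
  rewrite /mval big_map; apply: eq_big_seq => f f_t.
  rewrite [RHS]/= -surjective_pairing -map_comp; congr fr.
  apply/eq_in_map => l l_f /=; rewrite (nth_map 0%N) //.
  rewrite sw' sw; have := perm_mem (allP we _ t_e) l; rewrite mem_iota add0n /= => <-.
  by apply/flattenP; exists f.2 => //; exact: map_f.
case: ifPn => [_|]; last first.
  rewrite negbK => /hasP[v v_t v0]; rewrite /mval (big_rem _ v_t) /= is_zero_val ?mul0r ?mulr0 //.
  by case/mapP: v_t => f _ ->.
congr (_ * _); rewrite /mval big_filter [RHS]big_mkcond /=; apply: eq_big_seq => v v_t.
case: ifP => // /negbFE v1; rewrite is_one_val //; by case/mapP: v_t => f _ ->.
Qed.

Lemma merge_equalP c m p :
  peval (merge_equal c m p) = dval c * mval m + peval p.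
Proof.
elim: p c m => [|[c' m'] p IH] c m /=.
  by case: ifP => [/dval_eq0 ->|_]; rewrite ?peval_cons ?mul0r ?add0r.
rewrite peval_cons /=; case: eqP => [<-|_].
  by rewrite IH dvalD mulrDl addrA.
case: ifP => [/dval_eq0 ->|_]; first by rewrite mul0r add0r IH.
by rewrite peval_cons IH.
Qed.

Lemma collectP p : peval (collect p) = peval p.
Proof.
transitivity (peval (sort (fun x y => mono_le x.2 y.2) [seq (x.1, sort var_le x.2) | x <- p])).
  rewrite /collect; case: (sort _ _) => [//|[c m] q].
  by rewrite merge_equalP peval_cons.
rewrite /peval (perm_big _ (permEl (perm_sort _ _))) big_map /=.
apply: eq_bigr => x _; congr (_ * _).
by rewrite /mval (perm_big _ (permEl (perm_sort _ _))).
Qed.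

Section Rules.
Variable rels : seq (nat * texp).
Variable rule : var -> option (dyadic * nat * seq nat).
Hypothesis rels_wf : all (fun r => all (wf r.1) r.2) rels.
Hypothesis rels0 : forall r, r \in rels -> forall w, size w = r.1 ->
  eval H T dval r.2 w = 0.

(** The relations hold for coordinate components; by multilinearity they hold for
    frame components as well. *)
Lemma rels0_frame k w : let r := nth (0%N, [::]) rels k in
  size w = r.1 -> all (fun i => i < 3)%N w -> peval (expand r.2 w) = 0.
Proof.
move=> r sw w3.
have [kr|kr] := ltnP k (size rels); last first.
  by rewrite /r nth_default // /expand /peval big_nil.
have r_rels : r \in rels by exact: mem_nth.
have wr := allP rels_wf _ r_rels.
rewrite -(expandP wr) //; apply: (multilin_delta (evalv_lin wr)).
  by move=> u su; rewrite (evalv_delta wr) //; exact: rels0.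
by rewrite size_map.
Qed.

Lemma pevalZ c p : peval [seq (dmul c x.1, x.2) | x <- p] = dval c * peval p.
Proof.
rewrite /peval big_map mulr_sumr; apply: eq_bigr => x _.
by rewrite dvalM mulrA.
Qed.

Lemma rewrite_varP v : peval (rewrite_var rels rule v) = vval v.
Proof.
rewrite /rewrite_var /peval big_cons -/(peval _) /= dval1 mul1r /mval big_seq1.
case: (rule v) => [[[c k] w]|]; last by rewrite /peval big_nil addr0.
case: ifP => [/andP[/eqP sw w3]|]; last by rewrite /peval big_nil addr0.
by rewrite pevalZ rels0_frame // mulr0 addr0.
Qed.

Lemma pmulP p q : peval (pmul p q) = peval p * peval q.
Proof.
rewrite /pmul peval_flatten big_map [in RHS]/peval mulr_suml; apply: eq_bigr => x _.
rewrite /peval big_map mulr_sumr; apply: eq_bigr => y _.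
by rewrite dvalM mval_cat mulrACA.
Qed.

Lemma rewrite_monoP m : peval (rewrite_mono rels rule m) = mval m.
Proof.
elim: m => [|v m IH] /=.
  by rewrite /peval big_seq1 /= dval1 mul1r.
by rewrite pmulP collectP rewrite_varP -/(rewrite_mono _ _ m) IH /mval big_cons.
Qed.

Lemma rewrite_polyP p : peval (rewrite_poly rels rule p) = peval p.
Proof.
rewrite collectP peval_flatten big_map; apply: eq_bigr => x _.
by rewrite pevalZ rewrite_monoP.
Qed.

Lemma normalizeP fuel e w :
  peval (normalize rels rule fuel e w) = peval (expand e w).
Proof.
rewrite /normalize; elim: fuel => [|fuel IH] /=; first exact: collectP.
by rewrite rewrite_polyP.
Qed.

Lemma mem_frame_tuples n w : size w = n -> all (fun i => i < 3)%N w -> w \in frame_tuples n.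
Proof.
elim: n w => [|n IH] [|a w] // [sw]; rewrite [all _ _]/= => /andP[a3 w3].
have -> : frame_tuples n.+1 = flatten [seq [seq a :: w | w <- frame_tuples n] | a <- axes] by [].
apply/flattenP; exists [seq a :: w' | w' <- frame_tuples n].
  apply: (map_f (fun a => [seq a :: w' | w' <- frame_tuples n]) (x := a)).
  by case: a a3 => [|[|[|]]].
by apply: map_f; apply: IH.
Qed.

(** Soundness of the decision procedure.  Normal forms preserve values, so all frame
    components of the expression vanish, and multilinearity carries this back to
    the coordinate components. *)
Lemma check_zero_frame fuel n e : check_zero rels rule fuel n e ->
  forall w, size w = n -> eval H T dval e w = 0.
Proof.
case/andP=> we /allP chk w sw; rewrite -(evalv_delta we sw).
apply: (multilin_zero (evalv_lin we)) => [u su u3|]; last by rewrite size_map.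
rewrite (expandP we su u3) -(normalizeP fuel).
by have /nilP -> := chk _ (mem_frame_tuples su u3); rewrite /peval big_nil.
Qed.
End Rules.
End Eval.
End Frame.

(** * Curvature identities and evolution equations as expressions *)

Definition Met : texp := [:: (dz 1, 0%N, [:: ((0, 0), [:: 0; 1])])]%N.
Definition Rc n : texp := [:: (dz 1, 0%N, [:: ((1, n), iota 0 n.+2)])]%N.
Definition Rie : texp := [:: (dz 1, 0%N, [:: ((2, 0), iota 0 4)])]%N.

(** Base tensor 3 is an arbitrary covector, used as a test field. *)
Definition Covec n : texp := [:: (dz 1, 0%N, [:: ((3, n), iota 0 n.+1)])]%N.
Definition Sc : texp := comb 0 (dz 1) 1 [:: (Rc 0, [:: 0; 1]%N)].

(** The Ricci identity for [e], with [k] in the role of the curvature tensor. *)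
Definition ricci_rel n (k e : texp) : texp :=
  cov (cov e) ++ comb n.+2 (dz (-1)) 0 [:: (cov (cov e), [:: 1, 0 & iota 2 n]%N)]
  ++ tact 2 n k e.
Definition alt1 : texp := Rie ++ comb 4 (dz 1) 0 [:: (Rie, [:: 0; 2; 1; 3]%N)].
Definition alt2 : texp := Rie ++ comb 4 (dz 1) 0 [:: (Rie, [:: 3; 1; 2; 0]%N)].
Definition bianchi1 : texp := Rie ++ comb 4 (dz 1) 0 [:: (Rie, [:: 0; 2; 3; 1]%N)]
  ++ comb 4 (dz 1) 0 [:: (Rie, [:: 0; 3; 1; 2]%N)].
Definition ric_trace : texp := Rc 0 ++ comb 2 (dz (-1)) 1 [:: (Rie, [:: 2; 3; 0; 1]%N)].
Definition pair_sym : texp := Rie ++ comb 4 (dz (-1)) 0 [:: (Rie, [:: 1; 0; 3; 2]%N)].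
Definition none_rule : var -> option (dyadic * nat * seq nat) := fun=> None.
Definition alt_rels : seq (nat * texp) := [:: (4, alt1); (4, alt2)]%N.
Definition half : dyadic := (1, 1%N).
Definition mhalf : dyadic := (-1, 1%N).

(** Skew symmetries: exchange the indices into increasing order.  For equal indices
    the relation is twice the variable, hence the factor one half. *)
Definition alt_rule (v : var) : option (dyadic * nat * seq nat) :=
  if v is [:: 2; 0; d; a; b; c]%N then
    if (b <= a)%N then Some (if a == b then mhalf else dz (-1), 0%N, [:: d; a; b; c])
    else if (c <= d)%N then Some (if c == d then mhalf else dz (-1), 1%N, [:: d; a; b; c])
    else None
  else None.

(** The classical octahedron argument: twice the difference of a component and its
    mirror image is a signed sum of four first Bianchi identities, up to the
    skew symmetries. *)
Definition pair_sym_proof : texp :=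
  comb 4 (dz 2) 0 [:: (pair_sym, [:: 0; 1; 2; 3]%N)]
  ++ comb 4 (dz (-1)) 0 [:: (bianchi1, [:: 0; 1; 2; 3]%N)]
  ++ comb 4 (dz (-1)) 0 [:: (bianchi1, [:: 1; 2; 3; 0]%N)]
  ++ comb 4 (dz 1) 0 [:: (bianchi1, [:: 2; 3; 0; 1]%N)]
  ++ comb 4 (dz 1) 0 [:: (bianchi1, [:: 3; 0; 1; 2]%N)].

(** In dimension three the Weyl tensor is zero, so the curvature tensor is this
    combination of the metric, the Ricci tensor and the scalar curvature. *)
Definition Rie_of_Rc : texp :=
  comb 4 (dz 1) 0 [:: (Met, [:: 0; 1]); (Rc 0, [:: 2; 3])]%N
  ++ comb 4 (dz (-1)) 0 [:: (Met, [:: 0; 2]%N); (Rc 0, [:: 1; 3]%N)]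
  ++ comb 4 (dz 1) 0 [:: (Rc 0, [:: 0; 1]%N); (Met, [:: 2; 3]%N)]
  ++ comb 4 (dz (-1)) 0 [:: (Rc 0, [:: 0; 2]%N); (Met, [:: 1; 3]%N)]
  ++ comb 4 mhalf 0 [:: (Sc, [::]); (Met, [:: 0; 1]%N); (Met, [:: 2; 3]%N)]
  ++ comb 4 half 0 [:: (Sc, [::]); (Met, [:: 0; 2]%N); (Met, [:: 1; 3]%N)].

Definition rie_rels := [:: (4, alt1); (4, alt2); (4, pair_sym); (2, ric_trace)]%N.

(** Components of the Ricci tensor are expanded into components of the curvature
    tensor, and the latter are reduced to the few that are independent in dimension
    three. *)
Definition rie_rule (v : var) : option (dyadic * nat * seq nat) :=
  match v with
  | [:: 2; 0; d; a; b; c]%N =>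
    if alt_rule v is Some r then Some r
    else if (a + b < d + c)%N then Some (dz (-1), 2%N, [:: d; a; b; c]) else None
  | [:: 1; 0; b; c]%N => Some (dz (-1), 3%N, [:: b; c])
  | _ => None
  end.
Definition neg n (e : texp) := comb n (dz (-1)) 0 [:: (e, iota 0 n)].
Definition ric_sym : texp := Rc 0 ++ comb 2 (dz (-1)) 0 [:: (Rc 0, [:: 1; 0]%N)].

Definition cyc3 n (c : int) (e : texp) : texp :=
  comb n (dz c) 0 [:: (e, [:: 0, 1, 2 & iota 3 (n-3)]%N)] ++
  comb n (dz c) 0 [:: (e, [:: 1, 2, 0 & iota 3 (n-3)]%N)] ++
  comb n (dz c) 0 [:: (e, [:: 2, 0, 1 & iota 3 (n-3)]%N)].

(** The second Bianchi identity contracted with a test covector.  It is the curvature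
    part of the Jacobi identity for three covariant derivatives of that covector; in
    [jacobi] the second covariant derivatives cancel, and what remains is a sum of
    Ricci identities and a first Bianchi identity. *)
Definition bianchi2_covector : texp := cyc3 4 1 (comb 4 (dz 1) 1 [:: (cov Rie, [:: 0; 4; 1; 2; 3]%N); (Covec 0, [:: 5]%N)]).
Definition jacobi_rest : texp :=
  cyc3 4 (-1) (cov (ricci_rel 1 Rie (Covec 0))) ++ cyc3 4 1 (ricci_rel 2 Rie (Covec 1))
  ++ comb 4 (dz (-1)) 1 [:: (bianchi1, [:: 4; 0; 1; 2]%N); (Covec 1, [:: 5; 3]%N)].
Definition jacobi : texp := bianchi2_covector ++ jacobi_rest.
Definition bianchi2 : texp := cyc3 5 1 (comb 5 (dz 1) 0 [:: (cov Rie_of_Rc, [:: 0; 3; 1; 2; 4]%N)]).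
Definition contracted_bianchi : texp := comb 1 (dz 1) 1 [:: (Rc 1, [:: 1; 2; 0]%N)]
  ++ comb 1 mhalf 1 [:: (Rc 1, [:: 0; 1; 2]%N)].
Definition sym_rels := [:: (2, ric_sym); (3, cov ric_sym)]%N.

(** Sorts the two slots of a derivative of the Ricci tensor. *)
Definition sym_rule (v : var) : option (dyadic * nat * seq nat) :=
  match v with
  | 1%N :: n :: w => if (nth 0 w n.+1 < nth 0 w n)%N then Some (dz (-1), n, w) else None
  | _ => None end.

(** Contracting the second Bianchi identity twice, with the curvature tensor expressed
    by the Ricci tensor. *)
Definition contracted_bianchi_proof := contracted_bianchi ++ comb 1 half 2 [:: (bianchi2, [:: 1; 3; 0; 2; 4]%N)].

Definition order1 (r : nat * texp) := (r.1.+1, cov r.2).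
Definition sym_rel n : nat * texp := iter n order1 (2%N, ric_sym).

(** The [u]-th covariant derivative of the Ricci identity for the [k]-th covariant
    derivative of the Ricci tensor: it exchanges two adjacent derivatives below [u]
    others. *)
Definition swap_rel u k : nat * texp := iter u order1 (k.+4, ricci_rel k.+2 Rie_of_Rc (Rc k)).
Definition contracted_bianchi_rel n : nat * texp := iter n order1 (1%N, contracted_bianchi).

(** Symmetry of the derivatives of the Ricci tensor up to order four, the contracted Bianchi
    identity and its derivative, and exchanges of adjacent derivatives up to order four;
    [jet_rule] refers to positions in this list. *)
Definition jet_rels : seq (nat * texp) :=
  [:: sym_rel 0; sym_rel 1; sym_rel 2; sym_rel 3; sym_rel 4; contracted_bianchi_rel 0; contracted_bianchi_rel 1;
      swap_rel 0 0; swap_rel 0 1; swap_rel 1 0; swap_rel 0 2; swap_rel 1 1; swap_rel 2 0].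

(** Position of the first adjacent pair in decreasing order. *)
Fixpoint descent (s : seq nat) : option nat :=
  match s with
  | a :: ((b :: _) as s') => if (b < a)%N then Some 0%N else omap S (descent s')
  | _ => None
  end.

(** Offsets in [jet_rels] of the relations exchanging derivatives of order [n]; in orders 0
    and 1 there is nothing to exchange. *)
Definition swap_index n u := (nth 0 [:: 0; 0; 7; 8; 10] n + u)%N.

(** Derivatives are sorted first.  Then the contracted Bianchi identity, and for two
    derivatives its covariant derivative, eliminates one component of each
    divergence; the coefficient is -2 when the trace term hits the same component,
    which then occurs with coefficient one half.  Otherwise the two slots of the
    Ricci tensor are sorted, or exchanged to prepare for such an elimination. *)
Definition jet_rule (v : var) : option (dyadic * nat * seq nat) :=
  if v is 1%N :: n :: w then
    let ds := take n w in
    let i := nth 0%N w n in let j := nth 0%N w n.+1 in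
    let l := nth 0%N ds 0 in
    if descent ds is Some u then Some (dz (-1), swap_index n u, w)
    else if [&& n == 1, l == i & l == j]%N then Some (dz (-2), 5%N, [:: l])
    else if [&& n == 2, l == nth 0 ds 1 & l == i]%N then
      Some (if l == j then dz (-2) else dz (-1), 6%N, [:: l; j])
    else if [&& n == 2, l == nth 0 ds 1 & l == j]%N || (j < i)%N then
      Some (dz (-1), n, w)
    else None
  else None.

Lemma pair_sym_check : check_zero alt_rels alt_rule 4 4 pair_sym_proof.
Proof. by vm_compute. Qed.
Lemma Rie_of_Rc_check : check_zero rie_rels rie_rule 4 4 (Rie_of_Rc ++ neg 4 Rie).
Proof. by vm_compute. Qed.
Lemma ric_sym_check : check_zero rie_rels rie_rule 4 2 ric_sym.
Proof. by vm_compute. Qed.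
Lemma jacobi_check : check_zero [::] none_rule 0 4 jacobi.
Proof. by vm_compute. Qed.
Lemma contracted_bianchi_check : check_zero sym_rels sym_rule 2 1 contracted_bianchi_proof.
Proof. by vm_compute. Qed.

(* The checks run these functions by conversion, whereas simplification inside proofs must not
   unfold symbolic expressions. *)
Arguments comb : simpl never.
Arguments cov : simpl never.
Arguments tact : simpl never.
Definition lap n (e : texp) := comb n (dz 1) 1 [:: (cov (cov e), [:: n, n.+1 & iota 0 n])].
Definition norm2 : texp := comb 0 (dz 1) 2 [:: (Rc 0, [:: 0; 2]); (Rc 0, [:: 1; 3])]%N.

(** The variation of the Christoffel symbols under the flow with its first index
    lowered, that is [- nabla_l R_im - nabla_i R_lm + nabla_m R_li]. *)
Definition phi : texp := comb 3 (dz (-1)) 0 [:: (Rc 1, [:: 1; 2; 0]%N)]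
  ++ comb 3 (dz (-1)) 0 [:: (Rc 1, [:: 2; 1; 0]%N)]
  ++ comb 3 (dz 1) 0 [:: (Rc 1, [:: 0; 1; 2]%N)].

(** The variation of the Ricci tensor as the contraction of that of the curvature
    tensor. *)
Definition dt_ric_raw : texp := comb 2 (dz 1) 1 [:: (cov phi, [:: 3; 2; 0; 1]%N)]
  ++ comb 2 (dz (-1)) 1 [:: (cov phi, [:: 0; 2; 3; 1]%N)].

(** Hamilton's evolution equation for the Ricci tensor in dimension three. *)
Definition dt_ric : texp := lap 2 (Rc 0)
  ++ comb 2 (dz 3) 0 [:: (Sc, [::]); (Rc 0, [:: 0; 1]%N)]
  ++ comb 2 (dz (-6)) 1 [:: (Rc 0, [:: 0; 2]%N); (Rc 0, [:: 1; 3]%N)]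
  ++ comb 2 (dz 2) 0 [:: (norm2, [::]); (Met, [:: 0; 1]%N)]
  ++ comb 2 (dz (-1)) 0 [:: (Sc, [::]); (Sc, [::]); (Met, [:: 0; 1]%N)].
Definition raise1 : texp := comb 3 (dz 1) 1 [:: (cov phi, [:: 0; 3; 1; 2]%N); (Covec 0, [:: 4]%N)].

(** Minus the time derivative of the second covariant derivative of a covector whose
    components do not depend on time. *)
Definition dt_hess : texp := cov (tact 1 1 phi (Covec 0)) ++ tact 1 2 phi (Covec 1).
Definition dt_riem_goal : texp :=
  dt_hess ++ comb 3 (dz (-1)) 0 [:: (dt_hess, [:: 1; 0; 2]%N)]
  ++ comb 3 (dz (-1)) 0 [:: (raise1, [:: 0; 1; 2]%N)]
  ++ comb 3 (dz 1) 0 [:: (raise1, [:: 1; 0; 2]%N)].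
Lemma dt_riem_check : check_zero sym_rels sym_rule 2 3 dt_riem_goal.
Proof. by vm_compute. Qed.
Lemma dt_ric_check : check_zero jet_rels jet_rule 8 2 (dt_ric_raw ++ neg 2 dt_ric).
Proof. by vm_compute. Qed.

Definition quarter : dyadic := (1, 2%N).
Definition mquarter : dyadic := (-1, 2%N).
Definition dS : texp := cov Sc.
Definition ddS : texp := cov dS.
Definition LS : texp := lap 0 Sc.
Definition Cotton : texp := comb 3 (dz 1) 0 [:: (Rc 1, [:: 2; 0; 1]%N)]
  ++ comb 3 (dz (-1)) 0 [:: (Rc 1, [:: 1; 0; 2]%N)]
  ++ comb 3 mquarter 0 [:: (dS, [:: 2]%N); (Met, [:: 0; 1]%N)]
  ++ comb 3 quarter 0 [:: (dS, [:: 1]%N); (Met, [:: 0; 2]%N)].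
Definition Bach : texp := comb 2 (dz 1) 1 [:: (cov Cotton, [:: 3; 0; 2; 1]%N)].

(** The first summand comes from the inverse metric, whose time derivative is twice the
    Ricci tensor with raised indices. *)
Definition dt_S : texp := comb 0 (dz 2) 2 [:: (Rc 0, [:: 0; 2]%N); (Rc 0, [:: 1; 3]%N)]
  ++ comb 0 (dz 1) 1 [:: (dt_ric, [:: 0; 1]%N)].
Definition dt_dric : texp := cov dt_ric ++ neg 3 (tact 1 2 phi (Rc 0)).
Definition dt_C : texp := comb 3 (dz 1) 0 [:: (dt_dric, [:: 2; 0; 1]%N)]
  ++ comb 3 (dz (-1)) 0 [:: (dt_dric, [:: 1; 0; 2]%N)]
  ++ comb 3 mquarter 0 [:: (cov dt_S, [:: 2]%N); (Met, [:: 0; 1]%N)]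
  ++ comb 3 half 0 [:: (dS, [:: 2]%N); (Rc 0, [:: 0; 1]%N)]
  ++ comb 3 quarter 0 [:: (cov dt_S, [:: 1]%N); (Met, [:: 0; 2]%N)]
  ++ comb 3 mhalf 0 [:: (dS, [:: 1]%N); (Rc 0, [:: 0; 2]%N)].
Definition dt_dC : texp := cov dt_C ++ neg 4 (tact 1 3 phi Cotton).
Definition dt_B : texp :=
  comb 2 (dz 2) 2 [:: (Rc 0, [:: 2; 4]%N); (cov Cotton, [:: 5; 0; 3; 1]%N)]
  ++ comb 2 (dz 1) 1 [:: (dt_dC, [:: 3; 0; 2; 1]%N)].

Definition flow_rhs : texp := flatten [::
  comb 2 (dz 3) 1 [:: (dS, [:: 2]); (Cotton, [:: 0; 3; 1])]%N;
  comb 2 (dz 1) 1 [:: (dS, [:: 2]%N); (Cotton, [:: 3; 1; 0]%N)];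
  comb 2 (dz (-1)) 1 [:: (dS, [:: 2]%N); (Rc 1, [:: 1; 0; 3]%N)];
  comb 2 (dz (-2)) 2 [:: (Rc 0, [:: 2; 4]%N); (cov Cotton, [:: 3; 0; 1; 5]%N)];
  comb 2 (dz (-3)) 1 [:: (Rc 0, [:: 2; 1]%N); (Bach, [:: 3; 0]%N)];
  comb 2 (dz (-5)) 1 [:: (Rc 0, [:: 2; 0]%N); (Bach, [:: 3; 1]%N)];
  comb 2 (dz 2) 1 [:: (lap 2 (Rc 0), [:: 0; 2]%N); (Rc 0, [:: 1; 3]%N)];
  comb 2 (dz (-2)) 2 [:: (Rc 2, [:: 4; 1; 2; 0]%N); (Rc 0, [:: 3; 5]%N)];
  comb 2 (dz 1) 1 [:: (ddS, [:: 2; 1]%N); (Rc 0, [:: 3; 0]%N)];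
  comb 2 (dz (-1)) 0 [:: (LS, [::]); (Rc 0, [:: 0; 1]%N)];
  comb 2 (dz (-2)) 2 [:: (Rc 1, [:: 2; 1; 4]%N); (Cotton, [:: 5; 3; 0]%N)];
  comb 2 (dz (-2)) 2 [:: (Rc 1, [:: 2; 1; 4]%N); (Cotton, [:: 0; 5; 3]%N)];
  comb 2 (dz (-4)) 2 [:: (Rc 1, [:: 2; 0; 4]%N); (Cotton, [:: 5; 3; 1]%N)];
  comb 2 (dz (-2)) 2 [:: (Rc 1, [:: 0; 2; 4]%N); (Cotton, [:: 3; 1; 5]%N)];
  comb 2 (dz 3) 0 [:: (Sc, [::]); (Bach, [:: 0; 1]%N)];
  comb 2 (dz 2) 0 [:: (comb 0 (dz 1) 3 [:: (Rc 1, [:: 0; 2; 4]); (Cotton, [:: 3; 1; 5])]%N,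
                          [::]); (Met, [:: 0; 1]%N)];
  comb 2 (dz 2) 0 [:: (comb 0 (dz 1) 2 [:: (Rc 0, [:: 0; 2]); (Bach, [:: 1; 3])]%N,
                          [::]); (Met, [:: 0; 1]%N)];
  comb 2 half 0 [:: (comb 0 (dz 1) 1 [:: (dS, [:: 0]); (dS, [:: 1])]%N, [::]);
                        (Met, [:: 0; 1]%N)];
  comb 2 half 0 [:: (Sc, [::]); (LS, [::]); (Met, [:: 0; 1]%N)];
  comb 2 mhalf 0 [:: (lap 0 norm2, [::]); (Met, [:: 0; 1]%N)];
  comb 2 mhalf 0 [:: (Sc, [::]); (ddS, [:: 0; 1]%N)];
  comb 2 half 0 [:: (cov (cov norm2), [:: 0; 1]%N)];
  comb 2 (dz 2) 2 [:: (Rc 1, [:: 2; 0; 4]%N); (Rc 1, [:: 3; 1; 5]%N)];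
  comb 2 (dz (-1)) 1 [:: (dS, [:: 2]%N); (Rc 1, [:: 3; 0; 1]%N)]].
Lemma flow_check :
  check_zero jet_rels jet_rule 10 2 (dt_B ++ neg 2 (lap 2 Bach ++ flow_rhs)).
Proof. by vm_compute. Qed.

(** * Riemannian geometry and the Ricci flow in a differential ring *)

Section Geometry.
Variables (R : numFieldType) (A : comNzRingType) (X : Type).
Variable ev : X -> {rmorphism A -> R}.
Hypothesis ev_inj : forall a b, (forall x, ev x a = ev x b) -> a = b.
Variable cst : R -> A.
Hypothesis ev_cst : forall x r, ev x (cst r) = r.
Variable d : idx -> A -> A.
Hypothesis dD : forall l a b, d l (a + b) = d l a + d l b.
Hypothesis dM : forall l a b, d l (a * b) = d l a * b + a * d l b.
Hypothesis d_cst : forall l r, d l (cst r) = 0.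
Hypothesis dC : forall l m a, d l (d m a) = d m (d l a).
Variables G H : idx -> idx -> A.
Hypothesis Gsym : forall i j, G i j = G j i.
Hypothesis GH : forall i j, \sum_k G i k * H k j = (i == j)%:R.
(* The points of X separate the elements of the ring, and each of them carries an orthonormal
   frame; the frames at different points are unrelated. *)
Hypothesis frame : forall x, exists b : nat -> 'rV[R]_3,
  [/\ forall p q, ev x (H p q) = \sum_(a <- axes) b a 0 p * b a 0 q,
      forall u : 'rV[R]_3, exists c, u = \sum_(a <- axes) c a *: b a &
      forall a c, (a < 3)%N -> (c < 3)%N ->
        \sum_i \sum_j b a 0 i * b c 0 j * ev x (G i j) = (a == c)%:R].

Lemma HG i j : \sum_k H i k * G k j = (i == j)%:R.
Proof.
have := @mulmx1C A 3 (\matrix_(i, j) G i j) (\matrix_(i, j) H i j).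
have -> : (\matrix_(i, j) G i j) *m (\matrix_(i, j) H i j) = 1%:M.
  by apply/matrixP => k l; rewrite !mxE -GH; apply: eq_bigr => m _; rewrite !mxE.
move=> /(_ erefl) /matrixP /(_ i j); rewrite !mxE => <-.
by apply: eq_bigr => m _; rewrite !mxE.
Qed.

Lemma sum_delta (F : idx -> A) i : \sum_k (i == k)%:R * F k = F i.
Proof.
rewrite (bigD1 i) //= eqxx mul1r big1 ?addr0 // => j /negPf ji.
by rewrite eq_sym ji mul0r.
Qed.

(** The metric is invertible, so an index may be lowered before comparing. *)
Lemma lowering_inj (F F' : idx -> A) :
  (forall m, \sum_k G m k * F k = \sum_k G m k * F' k) -> F =1 F'.
Proof.
move=> FF' i; rewrite -[F i]sum_delta -[F' i]sum_delta.
under eq_bigr do rewrite -HG mulr_suml.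
under [RHS]eq_bigr do rewrite -HG mulr_suml.
rewrite exchange_big [RHS]exchange_big; apply: eq_bigr => m _.
under eq_bigr do rewrite -mulrA.
under [RHS]eq_bigr do rewrite -mulrA.
by rewrite -!mulr_sumr FF'.
Qed.

Lemma raiseK (F : idx -> A) i : \sum_k H i k * (\sum_l G k l * F l) = F i.
Proof.
rewrite -[RHS]sum_delta; under eq_bigr do rewrite mulr_sumr.
rewrite exchange_big; apply: eq_bigr => l _; rewrite -HG mulr_suml.
by apply: eq_bigr => k _; rewrite mulrA.
Qed.

Lemma Hsym i j : H i j = H j i.
Proof.
apply: (lowering_inj (F := fun i => H i j) (F' := H j)) => m.
rewrite GH eq_sym -HG; apply: eq_bigr => k _; by rewrite Gsym mulrC.
Qed.

Let d0 l := de0 (dD l).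
Let dN l := deN (dD l).
Let dB l := deB (dD l).
Let dsum l := de_sum (dD l).

(** Christoffel symbols; [Gam k i j] is [Gamma^k_ij]. *)
Definition Gam k i j : A :=
  cst 2^-1 * \sum_l H k l * (d i (G j l) + d j (G i l) - d l (G i j)).

Lemma Gam_sym k i j : Gam k i j = Gam k j i.
Proof.
congr (_ * _); apply: eq_bigr => l _; rewrite (Gsym i j); ring.
Qed.

Lemma cst_half : cst 2^-1 + cst 2^-1 = 1.
Proof.
apply: ev_inj => x; by rewrite rmorphD rmorph1 ev_cst [RHS]splitr !mul1r.
Qed.

Lemma Gam_low m i j : \sum_k G m k * Gam k i j
  = cst 2^-1 * (d i (G j m) + d j (G i m) - d m (G i j)).
Proof.
under eq_bigr do rewrite mulrCA mulr_sumr.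
rewrite -mulr_sumr exchange_big; congr (_ * _).
under eq_bigr => l _ do under eq_bigr do rewrite mulrA.
under eq_bigr do rewrite -mulr_suml GH.
by rewrite sum_delta.
Qed.

(** The defining property of the Levi-Civita connection, here a computation from
    [Gam_low]. *)
Lemma metric_compat l i j : d l (G i j)
  = \sum_p Gam p l i * G p j + \sum_p Gam p l j * G i p.
Proof.
have E k m : \sum_p Gam p l k * G p m = cst 2^-1 * (d l (G k m) + d k (G l m) - d m (G l k)).
  by rewrite -Gam_low; apply: eq_bigr => p _; rewrite mulrC Gsym.
under [X in _ + X]eq_bigr do rewrite Gsym.
rewrite !E (Gsym j i) -[LHS]mul1r -cst_half; ring.
Qed.

Lemma H_par l p q :
  d l (H p q) = - (\sum_r Gam p l r * H r q) - (\sum_r Gam q l r * H p r).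
Proof.
apply: (lowering_inj (F := fun p => d l (H p q))
  (F' := fun p => - (\sum_r Gam p l r * H r q) - (\sum_r Gam q l r * H p r))) => {p} m.
have : d l (\sum_k G m k * H k q) = 0.
  rewrite GH; case: (m == q); last exact: d0.
  exact: (de1 (dM l)).
rewrite dsum; under eq_bigr do rewrite dM.
rewrite big_split /= addrC => /eqP; rewrite addr_eq0 => /eqP ->.
under eq_bigr do rewrite metric_compat mulrDl.
rewrite big_split /= opprD.
under [RHS]eq_bigr do rewrite mulrDr !mulrN.
rewrite big_split /= !sumrN [LHS]addrC; congr (- _ - _).
  under eq_bigr do rewrite mulr_suml.
  rewrite exchange_big; apply: eq_bigr => k _; rewrite mulr_sumr.
  by apply: eq_bigr => r _; rewrite mulrAC mulrC.
transitivity (Gam q l m).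
  under eq_bigr do rewrite mulr_suml.
  rewrite exchange_big -[RHS](sum_delta (fun r => Gam r l m)).
  apply: eq_bigr => r _; under eq_bigr do rewrite -mulrA.
  by rewrite -mulr_sumr GH mulrC eq_sym.
under eq_bigr do rewrite mulr_sumr.
rewrite exchange_big -[LHS](sum_delta (fun r => Gam q l r)).
apply: eq_bigr => r _; under [RHS]eq_bigr do rewrite mulrCA.
by rewrite -mulr_sumr GH mulrC.
Qed.

Definition riem l i j k : A :=
  d i (Gam l j k) - d j (Gam l i k)
  + \sum_p (Gam p j k * Gam l i p - Gam p i k * Gam l j p).
Definition ricA j k : A := \sum_i riem i i j k.

Definition metT : tensor A := fun w => if w is [:: i; j] then G i j else 0.
Definition ricT : tensor A := fun w => if w is [:: i; j] then ricA i j else 0.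

(** The curvature tensor with all indices lowered, the lowered one in front. *)
Definition rieT : tensor A := fun w =>
  if w is [:: e; a; b; c] then \sum_l G e l * riem l a b c else 0.

Notation nab := (nabla d Gam).
Notation J U := (jets d Gam U).
Definition cf (c : dyadic) : A := cst (dval R c).

Lemma cfM x y : cf (dmul x y) = cf x * cf y.
Proof. by apply: ev_inj => p; rewrite rmorphM !ev_cst dvalM. Qed.
Lemma cf1 : cf (dz 1) = 1.
Proof. by apply: ev_inj => p; rewrite rmorph1 ev_cst dval1. Qed.
Lemma cfN1 : cf (dz (-1)) = -1.
Proof.
by apply: ev_inj => p; rewrite rmorphN rmorph1 ev_cst /dval /= expr0 divr1 intrN.
Qed.

(** The numbering of base tensors used in symbolic expressions: metric, Ricci tensor,
    curvature tensor, and arbitrary test tensors [U]. *)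
Definition bases (U : nat -> tensor A) (b : nat) : tensor A :=
  match b with 0 => metT | 1 => ricT | 2 => rieT | n.+3 => U n end%N.

Lemma nabla_metT w : nab metT w = 0.
Proof.
case: w => [//|l w] /=; rewrite /der.
case: w => [|i [|j [|k w]]] /=; rewrite ?d0 ?sub0r ?addr0.
- by rewrite oppr0.
- by rewrite big1 ?oppr0 // => p _; rewrite mulr0.
- rewrite metric_compat; apply/eqP; rewrite subr_eq0; apply/eqP.
  by [].
- rewrite !big1 ?add0r ?addr0 //.
  rewrite act0 ?oppr0 //.
- move=> p _; by rewrite mulr0.
- by move=> p _; rewrite mulr0.
- by move=> p _; rewrite mulr0.
Qed.

Lemma nabla0 w : nab (fun=> 0) w = 0.
Proof. by case: w => [//|l w] /=; rewrite /der d0 act0 subr0. Qed.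

Lemma bases_par U n w : J (bases U) (0%N, n.+1) w = 0.
Proof.
rewrite /jets /=; elim: n w => [|n IH] w; first exact: nabla_metT.
rewrite iterS -[RHS](nabla0 w); apply: nabla_ext => v _; exact: IH.
Qed.

(** The commutator of two covariant derivatives is the derivation action of the
    curvature: the second derivatives cancel since [d] commutes, the terms with the
    differentiated tensor cancel since [Gam] is symmetric, and [act_comm] yields the
    quadratic terms. *)
Lemma ricci_identity (T : tensor A) a b w :
  nab (nab T) [:: a, b & w] - nab (nab T) [:: b, a & w]
  = - act (fun c p => riem p a b c) T w.
Proof.
rewrite /= /der /= !dB !(de_act (dD _) (dM _)).
have nabE l v : nab T (l :: v) = der (d l) (fun i p => Gam p l i) T v by [].
rewrite -[act _ (fun v => der (d b) _ T v) w]/(act (fun i p => Gam p a i)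
   (fun v => d b (T v) - act (fun i p => Gam p b i) T v) w).
rewrite -[act _ (fun v => der (d a) _ T v) w]/(act (fun i p => Gam p b i)
   (fun v => d a (T v) - act (fun i p => Gam p a i) T v) w).
rewrite !actD !actN dC.
have -> : \sum_p Gam p b a * der (d p) (fun i q => Gam q p i) T w
  = \sum_p Gam p a b * der (d p) (fun i q => Gam q p i) T w.
  by apply: eq_bigr => p _; rewrite Gam_sym.
have -> : act (fun c p => riem p a b c) T w
  = act (fun i p => d a (Gam p b i)) T w - act (fun i p => d b (Gam p a i)) T w
    - (act (fun i p => Gam p a i) (act (fun i p => Gam p b i) T) w
       - act (fun i p => Gam p b i) (act (fun i p => Gam p a i) T) w).
  rewrite act_comm.
  pose g1 i p := d a (Gam p b i); pose g2 i p := d b (Gam p a i).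
  pose g3 i q := \sum_p Gam p a i * Gam q b p - \sum_p Gam p b i * Gam q a p.
  have := act_lin2 g1 g2 1 (-1) T w; rewrite !mul1r mulN1r => <-.
  have := act_lin2 (fun i p => 1 * g1 i p + -1 * g2 i p) g3 1 (-1) T w.
  rewrite !mul1r mulN1r => <-.
  congr act; apply/funext => c; apply/funext => p; rewrite /g1 /g2 /g3 /riem.
  by rewrite sumrB !mul1r !mulN1r opprB.
ring.
Qed.

Definition evA U (e : texp) : tensor A := eval H (J (bases U)) cf e.

Lemma evA_cov U n e w : all (wf n) e -> size w = n.+1 ->
  evA U (cov e) w = nab (evA U e) w.
Proof.
move=> we sw; rewrite /evA -(nabla_eval dD dM H_par _ (bases_par U) we sw) //.
by move=> l c; apply: d_cst.
Qed.

Lemma evA_comb U n c m L w : size w = n -> args_ok (n + m.*2) L ->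
  evA U (comb n c m L) w
  = cf c * iter m (ctrA H)
      (fun v => \prod_(p <- L) evA U p.1 [seq nth ord0 v l | l <- p.2]) w.
Proof. exact: (eval_comb _ _ cfM cf1). Qed.

Lemma evA_cat U e e' w : evA U (e ++ e') w = evA U e w + evA U e' w.
Proof. exact: eval_cat. Qed.

Lemma evA_atom U a n w : size w = n ->
  evA U [:: (dz 1, 0%N, [:: (a, iota 0 n)])] w = J (bases U) a w.
Proof.
move=> sw; rewrite /evA /eval big_seq1 /= cf1 mul1r /pval big_seq1 /=.
by rewrite -sw -/(mkseq _ _) mkseq_nth.
Qed.

Lemma evA_perm U n c s e w : size w = n ->
  all (fun l => l < n + 0)%N s && all (fits (size s)) e ->
  evA U (comb n c 0 [:: (e, s)]) w = cf c * evA U e [seq nth ord0 w l | l <- s].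
Proof.
move=> sw ok; rewrite evA_comb //=; first by rewrite big_seq1.
by rewrite /args_ok /= ok.
Qed.

Lemma evA_morph U x e w :
  ev x (evA U e w)
  = eval (fun p q => ev x (H p q)) (fun a v => ev x (J (bases U) a v)) (dval R) e w.
Proof.
rewrite /evA /eval rmorph_sum; apply: eq_bigr => t _.
rewrite rmorphM ev_cst; congr (_ * _).
elim: t.1.2 w => [|m IH] w /=; first by rewrite /pval rmorph_prod.
rewrite /ctrA rmorph_sum; apply: eq_bigr => p _; rewrite rmorph_sum.
by apply: eq_bigr => q _; rewrite rmorphM IH.
Qed.

Definition vanish U n e := forall w, size w = n -> evA U e w = 0.

(** The ring is separated by its evaluations at points, and at each point there is an
    orthonormal frame; so the decision procedure applies pointwise and concludes in
    the ring, where the result may be differentiated. *)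
Lemma decide U rels rule fuel n e :
  all (fun r => all (wf r.1) r.2) rels ->
  (forall r, r \in rels -> vanish U r.1 r.2) ->
  check_zero rels rule fuel n e -> vanish U n e.
Proof.
move=> wr r0 chk w sw; apply: ev_inj => x; rewrite rmorph0 evA_morph.
have [b [Hb b_span b_one]] := frame x.
apply: (check_zero_frame Hb b_span _ _ wr _ chk) => //.
- move=> a c a3 c3; rewrite -b_one //=; apply: eq_bigr => i _.
  by rewrite mulr_sumr; apply: eq_bigr => j _; rewrite mulrA.
- by move=> k v; rewrite bases_par rmorph0.
- by move=> r r_in v sv; rewrite -evA_morph r0 // rmorph0.
Qed.

Lemma vanish_cov U n e : all (wf n) e -> vanish U n e -> vanish U n.+1 (cov e).
Proof.
move=> we e0 w sw; rewrite (evA_cov _ we) // -[RHS](nabla0 w).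
by apply: nabla_ext => v; rewrite sw => -[sv]; exact: e0.
Qed.

Lemma vanish_cat U n e e' : vanish U n e -> vanish U n e' -> vanish U n (e ++ e').
Proof. by move=> e0 e'0 w sw; rewrite evA_cat e0 // e'0 // addr0. Qed.

Lemma vanish_perm U n k c s e : vanish U k e -> size s = k ->
  all (fun l => l < n + 0)%N s && all (fits (size s)) e ->
  vanish U n (comb n c 0 [:: (e, s)]).
Proof.
by move=> e0 ss ok w sw; rewrite evA_perm // e0 ?mulr0 // size_map.
Qed.

Lemma iter_ctrA0 m F (w : seq idx) :
  (forall v, size v = (size w + m.*2)%N -> F v = 0) -> iter m (ctrA H) F w = 0.
Proof.
move=> F0; rewrite -[RHS](mul0r (iter m (ctrA H) F w)) -iter_ctrAZ.
by apply: iter_ctrA_ext => v sv; rewrite F0 // mul0r.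
Qed.

Lemma vanish_comb U n k c m s e L : vanish U k e -> size s = k ->
  args_ok (n + m.*2) ((e, s) :: L) ->
  vanish U n (comb n c m ((e, s) :: L)).
Proof.
move=> e0 ss ok w sw; rewrite evA_comb // iter_ctrA0 ?mulr0 // => v sv.
by rewrite big_cons e0 ?mul0r // size_map.
Qed.

Lemma evA_tact U r n k e pre w : size pre = r -> size w = n ->
  all (fits r.+2) k -> all (fits n) e ->
  evA U (tact r n k e) (pre ++ w)
  = act (fun i p => \sum_m H m p * evA U k (m :: pre ++ [:: i])) (evA U e) w.
Proof. exact: (eval_tact _ _ cfM cf1). Qed.

Lemma lower_raise (F : idx -> A) p : \sum_m H m p * (\sum_l G m l * F l) = F p.
Proof. by under eq_bigr do rewrite Hsym; exact: raiseK. Qed.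

(** The Ricci identity in symbolic form, for any expression [k] of the curvature
    tensor: either the base tensor itself or its formula in dimension three. *)
Lemma ricci_rel0 U n k e : all (wf n) e -> all (wf n.+1) (cov e) ->
  all (fits 4) k -> all (fits n) e -> all (fits n.+2) (cov (cov e)) ->
  (forall a b c m, evA U k [:: m; a; b; c] = rieT [:: m; a; b; c]) ->
  vanish U n.+2 (ricci_rel n k e).
Proof.
move=> we wce fk fe fcce kE [|a [|b w]] // [sw].
have ndd v : size v = n.+2 -> evA U (cov (cov e)) v = nab (nab (evA U e)) v.
  move=> sv; rewrite (evA_cov _ wce) //; apply: nabla_ext => u; rewrite sv => -[su].
  exact: evA_cov we _.
rewrite /ricci_rel !evA_cat ndd /= ?sw // evA_perm /= ?sw //; last first.
  rewrite size_iota fcce andbT /=; apply/allP => l.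
  by rewrite mem_iota; lia.
rewrite ndd /=; last by rewrite size_map size_iota.
have -> : [seq nth ord0 [:: a, b & w] l | l <- iota 2 n] = w.
  apply: (@eq_from_nth _ ord0); rewrite size_map size_iota // => i isz.
  by rewrite (nth_map 0%N) ?size_iota // nth_iota.
have := @evA_tact U 2 n k e [:: a; b] w erefl sw fk fe; rewrite /= => ->.
have -> : act (fun i p => \sum_m H m p * evA U k [:: m; a; b; i]) (evA U e) w
  = act (fun i p => riem p a b i) (evA U e) w.
  congr act; apply/funext => i; apply/funext => p.
  by under eq_bigr do rewrite kE /=; rewrite lower_raise.
rewrite cfN1 mulN1r; apply/eqP; rewrite addrA addr_eq0; apply/eqP.
exact: ricci_identity.
Qed.

Lemma evA_Rie U a b c e : evA U Rie [:: e; a; b; c] = rieT [:: e; a; b; c].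
Proof. exact: (@evA_atom U (2%N, 0%N) 4). Qed.
Lemma evA_Rc U n w : size w = n.+2 -> evA U (Rc n) w = iter n nab ricT w.
Proof. exact: evA_atom. Qed.
Lemma evA_Met U i j : evA U Met [:: i; j] = G i j.
Proof. exact: (@evA_atom U (0%N, 0%N) 2). Qed.

Lemma riem_alt l a b c : riem l a b c = - riem l b a c.
Proof.
rewrite /riem opprD opprB -sumrN; congr (_ + _).
by apply: eq_bigr => p _; rewrite opprB.
Qed.

Lemma alt1_0 U : vanish U 4 alt1.
Proof.
move=> [|e [|a [|b [|c [|? ?]]]]] // _.
rewrite evA_cat evA_perm // cf1 mul1r /= !evA_Rie /= -big_split big1 // => l _ /=.
by rewrite -mulrDr riem_alt addNr mulr0.
Qed.

(** The Ricci identity for the metric, whose covariant derivatives vanish. *)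
Lemma alt2_0 U : vanish U 4 alt2.
Proof.
move=> [|e [|a [|b [|c [|? ?]]]]] // _.
rewrite evA_cat evA_perm // cf1 mul1r /= !evA_Rie /=.
have nn w : nab (nab metT) w = 0.
  by rewrite -(nabla0 w); apply: nabla_ext => v _; exact: nabla_metT.
have := ricci_identity metT a b [:: c; e].
rewrite !nn subr0 => /esym/eqP; rewrite oppr_eq0 => /eqP E; rewrite -[RHS]E /= addr0.
by congr (_ + _); apply: eq_bigr => p _; rewrite mulrC // Gsym.
Qed.

(** The symmetry of the Christoffel symbols in their lower indices. *)
Lemma bianchi1_0 U : vanish U 4 bianchi1.
Proof.
move=> [|e [|a [|b [|c [|? ?]]]]] // _.
rewrite !evA_cat !evA_perm // cf1 !mul1r /= !evA_Rie /= -!big_split big1 // => l _ /=.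
rewrite -!mulrDr (_ : riem l a b c + _ = 0) ?mulr0 // /riem.
rewrite (Gam_sym l c a) (Gam_sym l b a) (Gam_sym l c b) !sumrB.
have E u v t : \sum_i Gam i u v * Gam l t i = \sum_i Gam i v u * Gam l t i.
  by apply: eq_bigr => i _; rewrite Gam_sym.
rewrite (E c b a) (E b a c) (E c a b) ; ring.
Qed.

Lemma ric_trace0 U : vanish U 2 ric_trace.
Proof.
move=> [|b [|c [|? ?]]] // _.
rewrite evA_cat evA_comb // cfN1 mulN1r (evA_Rc _ (n := 0)) //=.
apply/eqP; rewrite subr_eq0; apply/eqP; rewrite /ctrA exchange_big /=.
apply: eq_bigr => q _; rewrite -[LHS](lower_raise (fun l => riem l q b c)).
by apply: eq_bigr => p _; rewrite big_seq1 /= evA_Rie.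
Qed.

Lemma alt_vanish U r : r \in alt_rels -> vanish U r.1 r.2.
Proof.
by rewrite !inE => /orP[] /eqP -> /=; [exact: alt1_0 | exact: alt2_0].
Qed.

Lemma pair_sym0 U : vanish U 4 pair_sym.
Proof.
have /(decide _ (@alt_vanish U)) : check_zero alt_rels alt_rule 4 4 pair_sym_proof.
  exact: pair_sym_check.
move=> /(_ erefl) pf [|e [|a [|b [|c [|? ?]]]]] // sw; have := pf _ sw.
have b1 := @bianchi1_0 U.
rewrite /pair_sym_proof !evA_cat.
do 4 rewrite (@vanish_perm U 4 4 _ _ bianchi1) ?addr0 //.
rewrite evA_perm //= => /(congr1 ( *%R (cst 2^-1))); rewrite mulrA mulr0.
suff -> : cst 2^-1 * cf (dz 2) = 1 by rewrite mul1r -evA_cat.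
apply: ev_inj => x; rewrite rmorphM !ev_cst rmorph1 /dval /= expr0 divr1.
by rewrite mulVf // pnatr_eq0.
Qed.

Lemma rie_vanish U r : r \in rie_rels -> vanish U r.1 r.2.
Proof.
rewrite !inE => /or4P[] /eqP -> /=;
  [exact: alt1_0|exact: alt2_0|exact: pair_sym0|exact: ric_trace0].
Qed.

Lemma evA_Rie_of_Rc U a b c e : evA U Rie_of_Rc [:: e; a; b; c] = rieT [:: e; a; b; c].
Proof.
have /(decide _ (@rie_vanish U)) : check_zero rie_rels rie_rule 4 4 (Rie_of_Rc ++ neg 4 Rie).
  exact: Rie_of_Rc_check.
move=> /(_ erefl [:: e; a; b; c] erefl); rewrite evA_cat evA_perm // cfN1 mulN1r.
by rewrite /= evA_Rie => /eqP; rewrite subr_eq0 => /eqP.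
Qed.

Lemma ric_sym0 U : vanish U 2 ric_sym.
Proof. by apply: (decide _ (@rie_vanish U)) ric_sym_check. Qed.

Lemma ricA_sym i j : ricA i j = ricA j i.
Proof.
have := @ric_sym0 (fun=> fun=> 0) [:: i; j] erefl.
rewrite evA_cat evA_perm // cfN1 mulN1r /= !evA_Rc //=.
by move/eqP; rewrite subr_eq0 => /eqP.
Qed.

Lemma vanish_cyc3 U n c e : vanish U n e -> (2 < n)%N ->
  all (fits n) e -> vanish U n (cyc3 n c e).
Proof.
move=> e0 n2 fe; rewrite /cyc3.
have ok s : all (fun i => i < 3)%N s -> size s = 3%N ->
    vanish U n (comb n (dz c) 0 [:: (e, s ++ iota 3 (n - 3))]).
  move=> s3 ss; have sz : size (s ++ iota 3 (n - 3)) = n.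
    by rewrite size_cat size_iota ss subnKC.
  apply: (@vanish_perm U n n _ _ e e0 sz); rewrite sz fe andbT all_cat; apply/andP; split.
    by apply: sub_all s3 => i; lia.
  by apply/allP => i; rewrite mem_iota; lia.
by apply: vanish_cat; [|apply: vanish_cat]; apply: (ok [:: _; _; _]).
Qed.

Lemma cancel_vanish U n e e' : vanish U n (e ++ e') -> vanish U n e' -> vanish U n e.
Proof.
by move=> ee' e'0 w sw; have := ee' _ sw; rewrite evA_cat e'0 // addr0.
Qed.

Lemma bianchi2_covector0 U : vanish U 4 bianchi2_covector.
Proof.
apply: (@cancel_vanish U 4 bianchi2_covector jacobi_rest).
  by apply: (decide _ _ jacobi_check).
apply: vanish_cat; last apply: vanish_cat.
- apply: vanish_cyc3 => //; apply: vanish_cov => //.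
  by apply: ricci_rel0 => // *; exact: evA_Rie.
- apply: vanish_cyc3 => //.
  by apply: ricci_rel0 => // *; exact: evA_Rie.
- by apply: (@vanish_comb U 4 4 _ 1 [:: 4; 0; 1; 2]%N bianchi1
    [:: (Covec 1, [:: 5; 3]%N)] (@bianchi1_0 U)).
Qed.

Lemma evA_cyc3 U n e x y z w : size w = n -> all (fits n.+3) e ->
  evA U (cyc3 n.+3 1 e) [:: x, y, z & w]
  = evA U e [:: x, y, z & w] + evA U e [:: y, z, x & w] + evA U e [:: z, x, y & w].
Proof.
move=> sw fe; have E : [seq nth ord0 [:: x, y, z & w] l | l <- iota 3 n] = w.
  apply: (@eq_from_nth _ ord0); rewrite size_map size_iota // => i isz.
  by rewrite (nth_map 0%N) ?size_iota // nth_iota.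
have ok s : all (fun i => i < 3)%N s -> size s = 3%N ->
    all (fun l => l < n.+3 + 0)%N (s ++ iota 3 n) && all (fits (size (s ++ iota 3 n))) e.
  move=> s3 ss; rewrite size_cat ss size_iota fe andbT all_cat; apply/andP; split.
    by apply: sub_all s3 => i; lia.
  by apply/allP => i; rewrite mem_iota; lia.
rewrite /cyc3 !evA_cat -[n.+3]addn3 addnK addn3.
rewrite !evA_perm /= ?sw //;
  try exact: (ok [:: 0; 1; 2]%N); try exact: (ok [:: 1; 2; 0]%N); try exact: (ok [:: 2; 0; 1]%N).
by rewrite E cf1 !mul1r addrA.
Qed.

Lemma nab_rieT U m e a b c (k : texp) : all (wf 4) k ->
  (forall a b c e, evA U k [:: e; a; b; c] = rieT [:: e; a; b; c]) ->
  evA U (cov k) [:: m; e; a; b; c] = nab rieT [:: m; e; a; b; c].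
Proof.
move=> wk kE; rewrite (evA_cov _ wk) //; apply: nabla_ext.
by move=> [|? [|? [|? [|? [|? ?]]]]].
Qed.

(** The test covector is the one dual to a coordinate vector, with lowered components
    [G q e]; contracting it with [H] selects the index [e]. *)
Lemma bianchi2_0 U : vanish U 5 bianchi2.
Proof.
move=> [|m [|a [|b [|e [|c [|? ?]]]]]] // _.
rewrite (@evA_cyc3 U 2) // !evA_perm //= cf1 !mul1r !(nab_rieT _ _ _ _ _ _ (@evA_Rie_of_Rc U)) //.
pose V (n : nat) : tensor A := fun v => if v is [:: q] then G q e else 0.
have VE m' a' b' : evA V (comb 4 (dz 1) 1 [:: (cov Rie, [:: 0; 4; 1; 2; 3]%N); (Covec 0, [:: 5]%N)])
    [:: m'; a'; b'; c] = nab rieT [:: m'; e; a'; b'; c].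
  rewrite evA_comb // cf1 mul1r /= /ctrA -[RHS](sum_delta (fun p => nab rieT [:: m'; p; a'; b'; c])).
  apply: eq_bigr => p _; rewrite eq_sym -HG mulr_suml; apply: eq_bigr => q _.
  rewrite !big_cons big_nil mulr1 /= (nab_rieT _ _ _ _ _ _ (@evA_Rie V)) //.
  by rewrite (@evA_atom V (3%N, 0%N) 1) // mulrCA mulrC mulrAC.
have := @bianchi2_covector0 V [:: m; a; b; c] erefl.
by rewrite (@evA_cyc3 V 1) // !VE.
Qed.

Lemma contracted_bianchi0 U : vanish U 1 contracted_bianchi.
Proof.
apply: (@cancel_vanish U 1 contracted_bianchi (comb 1 half 2 [:: (bianchi2, [:: 1; 3; 0; 2; 4]%N)])).
  have sr r : r \in sym_rels -> vanish U r.1 r.2.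
    rewrite !inE => /orP[] /eqP -> /=; first exact: ric_sym0.
    by apply: vanish_cov => //; exact: ric_sym0.
  exact: (decide _ sr contracted_bianchi_check).
exact: (@vanish_comb U 1 5 _ 2 [:: 1; 3; 0; 2; 4]%N bianchi2 [::] (@bianchi2_0 U)).
Qed.

(** Relations may be differentiated covariantly. *)
Lemma vanish_iter U r u : all (fun v => all (wf (iter v order1 r).1) (iter v order1 r).2) (iota 0 u) ->
  vanish U r.1 r.2 -> vanish U (iter u order1 r).1 (iter u order1 r).2.
Proof.
elim: u => [//|u IH]; rewrite -addn1 iotaD all_cat => /andP[w0 /=]; rewrite andbT => w1 r0.
by rewrite addn1 iterS; apply: vanish_cov => //; exact: IH.
Qed.

Lemma swap_rel0 U k : all (wf k.+2) (Rc k) -> all (wf k.+3) (cov (Rc k)) ->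
  all (fits k.+2) (Rc k) -> all (fits k.+4) (cov (cov (Rc k))) ->
  vanish U k.+4 (ricci_rel k.+2 Rie_of_Rc (Rc k)).
Proof.
by move=> w1 w2 f1 f2; apply: ricci_rel0 => // *; exact: evA_Rie_of_Rc.
Qed.

Lemma jet_vanish U r : r \in jet_rels -> vanish U r.1 r.2.
Proof.
have sy u : all (fun v => all (wf (sym_rel v).1) (sym_rel v).2) (iota 0 u) ->
    vanish U (sym_rel u).1 (sym_rel u).2.
  by move=> ok; apply: vanish_iter ok _; exact: ric_sym0.
have bi u : all (fun v => all (wf (contracted_bianchi_rel v).1) (contracted_bianchi_rel v).2) (iota 0 u) ->
    vanish U (contracted_bianchi_rel u).1 (contracted_bianchi_rel u).2.
  by move=> ok; apply: vanish_iter ok _; exact: contracted_bianchi0.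
have sw u k : all (fun v => all (wf (swap_rel v k).1) (swap_rel v k).2) (iota 0 u) ->
   [&& all (wf k.+2) (Rc k), all (wf k.+3) (cov (Rc k)),
    all (fits k.+2) (Rc k) & all (fits k.+4) (cov (cov (Rc k)))] ->
    vanish U (swap_rel u k).1 (swap_rel u k).2.
  by move=> ok /and4P[*]; apply: vanish_iter ok _; exact: swap_rel0.
rewrite !inE => /orP[/eqP ->|]; first exact: sy.
case/orP=> [/eqP ->|]; first by apply: sy; vm_compute.
case/orP=> [/eqP ->|]; first by apply: sy; vm_compute.
case/orP=> [/eqP ->|]; first by apply: sy; vm_compute.
case/orP=> [/eqP ->|]; first by apply: sy; vm_compute.
case/orP=> [/eqP ->|]; first by apply: bi; vm_compute.
case/orP=> [/eqP ->|]; first by apply: bi; vm_compute.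
case/orP=> [/eqP ->|]; first by apply: sw; vm_compute.
case/orP=> [/eqP ->|]; first by apply: sw; vm_compute.
case/orP=> [/eqP ->|]; first by apply: sw; vm_compute.
case/orP=> [/eqP ->|]; first by apply: sw; vm_compute.
case/orP=> [/eqP ->|]; first by apply: sw; vm_compute.
by move/eqP => ->; apply: sw; vm_compute.
Qed.

Lemma jet_rels_wf : all (fun r => all (wf r.1) r.2) jet_rels.
Proof. by vm_compute. Qed.

Lemma jet_decide U fuel n e : check_zero jet_rels jet_rule fuel n e -> vanish U n e.
Proof. exact: (decide jet_rels_wf (@jet_vanish U)). Qed.

Variable dt : A -> A.
Hypothesis dtD : forall a b, dt (a + b) = dt a + dt b.
Hypothesis dtM : forall a b, dt (a * b) = dt a * b + a * dt b.
Hypothesis dt_cst : forall r, dt (cst r) = 0.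
Hypothesis dt_d : forall l a, dt (d l a) = d l (dt a).
Hypothesis flow : forall i j, dt (G i j) = cf (dz (-2)) * ricA i j.

Let dt0 := de0 dtD.
Let dtN := deN dtD.
Let dtB := deB dtD.
Let dtsum := de_sum dtD.

Lemma cf_intr (z : int) : cf (dz z) = z%:~R.
Proof.
by apply: ev_inj => x; rewrite rmorph_int ev_cst /dval /= expr0 divr1.
Qed.

(** Differentiating the equation that the inverse metric satisfies. *)
Lemma dt_H p q : dt (H p q) = 2 * \sum_r H p r * \sum_s H q s * ricA r s.
Proof.
apply: (lowering_inj (F := fun p => dt (H p q))
  (F' := fun p => 2 * \sum_r H p r * \sum_s H q s * ricA r s)) => {p} m.
have : dt (\sum_k G m k * H k q) = 0.
  by rewrite GH; case: (m == q); [exact: (de1 dtM) | exact: dt0].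
rewrite dtsum; under eq_bigr do rewrite dtM.
rewrite big_split /= addrC => /eqP; rewrite addr_eq0 => /eqP ->.
transitivity (2 * \sum_s H q s * ricA m s).
  under eq_bigr do rewrite flow cf_intr -mulrA.
  rewrite -mulr_sumr -mulNr; congr (_ * _); first by rewrite intrN opprK.
  by apply: eq_bigr => k _; rewrite mulrC Hsym.
rewrite -(sum_delta (fun m => \sum_s H q s * ricA m s)).
under [in LHS]eq_bigr do rewrite -GH mulr_suml.
rewrite exchange_big mulr_sumr; apply: eq_bigr => k _.
rewrite mulrCA; congr (_ * _); rewrite !mulr_sumr; apply: eq_bigr => r _.
by rewrite mulrA.
Qed.

(** The inverse metric contributes a contraction with the Ricci tensor. *)
Lemma dt_ctr (F : tensor A) w : dt (ctrA H F w)
  = 2 * \sum_p \sum_q H p q * \sum_r \sum_s H r s * (ricA p r * F (w ++ [:: q; s]))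
    + ctrA H (fun v => dt (F v)) w.
Proof.
rewrite /ctrA dtsum.
have -> : \sum_p \sum_q H p q * \sum_r \sum_s H r s * (ricA p r * F (w ++ [:: q; s]))
  = \sum_p \sum_q (\sum_r H p r * \sum_s H q s * ricA r s) * F (w ++ [:: p; q]).
  rewrite exchange_big; apply: eq_bigr => p _.
  under [RHS]eq_bigr do rewrite mulr_suml.
  rewrite [RHS]exchange_big; apply: eq_bigr => r _.
  under [RHS]eq_bigr do rewrite -mulrA mulr_suml.
  rewrite -mulr_sumr Hsym exchange_big; congr (_ * _); rewrite [RHS]exchange_big /=.
  rewrite exchange_big; apply: eq_bigr => s _; apply: eq_bigr => q _.
  by rewrite Hsym mulrA.
rewrite mulr_sumr -big_split; apply: eq_bigr => p _.
rewrite dtsum mulr_sumr -big_split; apply: eq_bigr => q _.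
by rewrite dtM dt_H mulrA.
Qed.

Lemma nab_ric l i j : nab ricT [:: l; i; j]
  = d l (ricA i j) - \sum_p Gam p l i * ricA p j - \sum_p Gam p l j * ricA i p.
Proof. by rewrite /= /der /= addr0 opprD addrA. Qed.

Lemma evA_phi U m l i : evA U phi [:: m; l; i]
  = nab ricT [:: m; l; i] - nab ricT [:: l; i; m] - nab ricT [:: i; l; m].
Proof.
rewrite !evA_cat !evA_perm // cfN1 cf1 mul1r !mulN1r !evA_Rc //= -[LHS]addrC.
ring.
Qed.

(** Differentiating the formula for the lowered symbols in time: the derivatives of the
    metric become derivatives of the Ricci tensor, and the terms with undifferentiated
    Ricci tensor complete them to covariant derivatives. *)
Lemma dt_Gam U p l i : dt (Gam p l i) = \sum_m H p m * evA U phi [:: m; l; i].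
Proof.
apply: (lowering_inj (F := fun p => dt (Gam p l i))
  (F' := fun p => \sum_m H p m * evA U phi [:: m; l; i])) => {p} m.
transitivity (evA U phi [:: m; l; i]); last first.
  rewrite -[LHS](sum_delta (fun m => evA U phi [:: m; l; i])).
  under eq_bigr do rewrite -GH mulr_suml.
  rewrite exchange_big; apply: eq_bigr => k _; rewrite mulr_sumr.
  by apply: eq_bigr => n _; rewrite mulrA.
have := congr1 dt (Gam_low m l i).
rewrite dtsum; under eq_bigr do rewrite dtM.
rewrite big_split /= => /eqP; rewrite addrC eq_sym -subr_eq => /eqP <-.
rewrite dtM dt_cst mul0r add0r dtB dtD !dt_d !flow !dM.
rewrite cf_intr.
have d_int k (z : int) : d k z%:~R = 0 by rewrite -cf_intr d_cst.
rewrite !d_int !mul0r !add0r.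
under eq_bigr do rewrite flow cf_intr -mulrA.
rewrite -mulr_sumr evA_phi !nab_ric.
have E a b c : \sum_q Gam q a b * ricA c q = \sum_q Gam q a b * ricA q c.
  by apply: eq_bigr => q _; rewrite ricA_sym.
have E2 a b c : \sum_q Gam q a b * ricA q c = \sum_q Gam q b a * ricA q c.
  by apply: eq_bigr => q _; rewrite Gam_sym.
have -> : \sum_k ricA m k * Gam k l i = \sum_q Gam q l i * ricA q m.
  by apply: eq_bigr => q _; rewrite ricA_sym mulrC.
rewrite !E (E2 m l) (E2 m i) (E2 i l) !intrN.
have h : cst 2^-1 * 2%:~R = 1.
  rewrite -cf_intr; apply: ev_inj => x; rewrite rmorphM !ev_cst rmorph1 /dval /= expr0 divr1.
  by rewrite mulVf // pnatr_eq0.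
have -> : cst 2^-1 * (- 2%:~R * d l (ricA i m) + - 2%:~R * d i (ricA l m) - - 2%:~R * d m (ricA l i))
  = (cst 2^-1 * 2%:~R) * (d m (ricA l i) - d l (ricA i m) - d i (ricA l m)) by ring.
rewrite h mul1r; ring.
Qed.

(** Time and space derivatives commute, hence only the variation of the connection
    remains. *)
Lemma dt_nab U (T : tensor A) l w : dt (nab T (l :: w))
  = nab (fun v => dt (T v)) (l :: w)
    - act (fun i p => \sum_m H m p * evA U phi [:: m; l; i]) T w.
Proof.
rewrite /= /der dtB dt_d (de_act dtD dtM) opprD [- _ - _]addrC addrA.
congr (_ - _ - _); congr act; apply/funext => i; apply/funext => p.
by rewrite (dt_Gam U); apply: eq_bigr => m _; rewrite Hsym.
Qed.

Lemma dt_cov U n e l w : all (wf n) e -> all (fits n) e -> size w = n ->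
  dt (evA U (cov e) (l :: w)) = nab (fun v => dt (evA U e v)) (l :: w)
    - evA U (tact 1 n phi e) (l :: w).
Proof.
move=> we fe sw; rewrite (evA_cov _ we); last by rewrite /= sw.
rewrite (dt_nab U); congr (_ - _).
by have := @evA_tact U 1 n phi e [:: l] w erefl sw; rewrite /= => ->.
Qed.

Lemma nab_eqs n T S w : (forall v, size v = n -> T v = S v) -> size w = n.+1 -> nab T w = nab S w.
Proof. by move=> TS sw; apply: nabla_ext => v; rewrite sw => -[sv]; exact: TS. Qed.

Lemma nabN T w : nab (fun v => - T v) w = - nab T w.
Proof.
case: w => [|l w] /=; first by rewrite oppr0.
by rewrite /der dN actN opprB opprK addrC.
Qed.

Definition phiT : tensor A := evA (fun=> fun=> 0) phi.

Lemma evA_phiT U w : size w = 3%N -> evA U phi w = phiT w.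
Proof. by case: w => [|m [|l [|i [|? ?]]]] // _; rewrite /phiT !evA_phi. Qed.

Lemma evA_cov_phi U w : size w = 4%N -> evA U (cov phi) w = nab phiT w.
Proof.
move=> sw; rewrite (@evA_cov U 3 phi) //; apply: (@nab_eqs 3) => // v sv.
exact: evA_phiT.
Qed.

Lemma sym_vanish U r : r \in sym_rels -> vanish U r.1 r.2.
Proof.
rewrite !inE => /orP[] /eqP -> /=; first exact: ric_sym0.
by apply: vanish_cov => //; exact: ric_sym0.
Qed.

(** The Ricci identity for the coordinate covector with components [(q == l)], which
    do not depend on time: its left hand side changes through the Christoffel symbols
    only, its right hand side is a component of the curvature. *)
Lemma dt_riem l a b c : dt (riem l a b c)
  = \sum_p H p l * (nab phiT [:: a; p; b; c] - nab phiT [:: b; p; a; c]).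
Proof.
pose V (n : nat) : tensor A := fun v => if v is [:: q] then (q == l)%:R else 0.
have dtV v : dt (V 0%N v) = 0.
  case: v => [|q [|? ?]] /=; rewrite ?dt0 //; case: (q == l); last exact: dt0.
  exact: (de1 dtM).
have dt1 v : size v = 2%N -> dt (evA V (Covec 1) v) = - evA V (tact 1 1 phi (Covec 0)) v.
  case: v => [//|k v] [sv]; rewrite (@dt_cov V 1 (Covec 0)) //.
  rewrite (@nab_eqs 1 _ (fun=> 0)) /= ?sv //; last first.
    by move=> u su; rewrite (@evA_atom V (3%N, 0%N) 1) //; exact: dtV.
  by have := nabla0 (k :: v); rewrite /= => ->; rewrite sub0r.
have dt2 x y z : dt (nab (nab (V 0%N)) [:: x; y; z]) = - evA V dt_hess [:: x; y; z].
  have -> : nab (nab (V 0%N)) [:: x; y; z] = evA V (cov (Covec 1)) [:: x; y; z].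
    by rewrite (@evA_atom V (3%N, 2%N) 3).
  rewrite (@dt_cov V 2) // [evA V dt_hess _]evA_cat opprD; congr (_ - _).
  rewrite (@evA_cov V 2) // -nabN; exact: (@nab_eqs 2).
have raiseE x y z : evA V raise1 [:: x; y; z] = \sum_p H p l * nab phiT [:: x; p; y; z].
  rewrite evA_comb // cf1 mul1r /= /ctrA; apply: eq_bigr => p _.
  under eq_bigr => q _ do rewrite !big_cons big_nil mulr1 evA_cov_phi //
    (@evA_atom V (3%N, 0%N) 1) //.
  have JV q : J (bases V) (3%N, 0%N) [:: q] = (q == l)%:R by [].
  rewrite (bigD1 l) //= JV eqxx mulr1 big1 ?addr0 // => q /negPf ql.
  by rewrite JV ql !mulr0.
have := ricci_identity (V 0%N) a b [:: c].
move/(congr1 dt); rewrite dtB dtN !dt2 /= addr0.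
under eq_bigr do rewrite mulrC.
rewrite (bigD1 l) //= eqxx mul1r big1 ?addr0; last by move=> q /negPf ->; rewrite mul0r.
move=> E.
have /(_ [:: a; b; c] erefl) : vanish V 3 dt_riem_goal.
  by apply: (decide _ (@sym_vanish V) dt_riem_check).
rewrite /dt_riem_goal evA_cat.
rewrite evA_cat evA_perm // [evA V (_ ++ _) _]evA_cat !evA_perm // cf1 cfN1 mul1r !mulN1r /= !raiseE => E2.
have -> : dt (riem l a b c) = evA V dt_hess [:: a; b; c] - evA V dt_hess [:: b; a; c].
  by apply: oppr_inj; rewrite -E; ring.
under eq_bigr do rewrite mulrBr.
by rewrite sumrB; apply/eqP; rewrite -subr_eq0; apply/eqP; apply: etrans E2; rewrite /=; ring.
Qed.

Lemma dt_ricA U b c : dt (ricA b c) = evA U dt_ric [:: b; c].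
Proof.
have raw : dt (ricA b c) = evA U dt_ric_raw [:: b; c].
  rewrite /ricA dtsum; under eq_bigr do rewrite dt_riem.
  rewrite evA_cat !evA_comb // cf1 cfN1 mul1r mulN1r /= /ctrA -sumrB exchange_big.
  apply: eq_bigr => p _; rewrite -sumrB; apply: eq_bigr => a _.
  by rewrite !big_seq1 !evA_cov_phi // -mulrBr Hsym.
have := jet_decide U dt_ric_check (erefl : size [:: b; c] = 2%N).
by rewrite evA_cat evA_perm // cfN1 mulN1r /= -raw => /eqP; rewrite subr_eq0 => /eqP.
Qed.

Lemma dt_Rc U w : size w = 2%N -> dt (evA U (Rc 0) w) = evA U dt_ric w.
Proof.
by case: w => [|b [|c [|? ?]]] // _; rewrite evA_Rc // /ricT /= (dt_ricA U).
Qed.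

Lemma dt_ctr_comb U n e s w : size w = n ->
  args_ok (n + 1.*2) [:: (e, s)] ->
  dt (evA U (comb n (dz 1) 1 [:: (e, s)]) w)
  = 2 * \sum_p \sum_q H p q * \sum_r \sum_t H r t * (ricA p r
         * evA U e [seq nth ord0 (w ++ [:: q; t]) l | l <- s])
    + ctrA H (fun v => dt (evA U e [seq nth ord0 v l | l <- s])) w.
Proof.
move=> sw ok; rewrite evA_comb // cf1 mul1r /= dt_ctr.
congr (2 * _ + _).
  apply: eq_bigr => p _; apply: eq_bigr => q _; congr (_ * _).
  by apply: eq_bigr => r _; apply: eq_bigr => t _; rewrite big_seq1.
by apply: ctrA_ext => v _; rewrite big_seq1.
Qed.

Lemma dt_Sc U : dt (evA U Sc [::]) = evA U dt_S [::].
Proof.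
rewrite dt_ctr_comb // evA_cat !evA_comb //; congr (_ + _).
  rewrite cf_intr; congr (_ * _) => /=; apply: eq_bigr => p _; apply: eq_bigr => q _.
  congr (_ * _); apply: eq_bigr => r _; apply: eq_bigr => t _.
  by rewrite !big_cons big_nil mulr1 !evA_Rc.
rewrite cf1 mul1r /=; apply: ctrA_ext => v sv; rewrite big_seq1 /= (dt_Rc U) //.
Qed.

Lemma dt_dSc U l : dt (evA U dS [:: l]) = evA U (cov dt_S) [:: l].
Proof.
rewrite (@dt_cov U 0 Sc) // (@evA_cov U 0 dt_S) // [X in _ - X](_ : _ = 0) ?subr0.
  by apply: (@nab_eqs 0) => // -[|? ?] // _; exact: dt_Sc.
by rewrite /evA /eval /tact big_nil.
Qed.

Lemma evA_neg U n e w : size w = n -> all (fits n) e -> evA U (neg n e) w = - evA U e w.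
Proof.
move=> sw fe; rewrite evA_perm // ?size_iota ?fe ?andbT; last first.
  by apply/allP => l; rewrite mem_iota; lia.
by rewrite cfN1 mulN1r -sw -/(mkseq _ _) mkseq_nth.
Qed.

Lemma dt_dRc U l i j : dt (evA U (Rc 1) [:: l; i; j]) = evA U dt_dric [:: l; i; j].
Proof.
rewrite evA_cat evA_neg // (@dt_cov U 2 (Rc 0)) // (@evA_cov U 2 dt_ric) //.
by congr (_ - _); apply: (@nab_eqs 2) => // v sv; exact: dt_Rc.
Qed.

Lemma evA_mul U n c e1 s1 e2 s2 w : size w = n ->
  args_ok (n + 0) [:: (e1, s1); (e2, s2)] ->
  evA U (comb n c 0 [:: (e1, s1); (e2, s2)]) w
  = cf c * (evA U e1 [seq nth ord0 w l | l <- s1] * evA U e2 [seq nth ord0 w l | l <- s2]).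
Proof. by move=> sw ok; rewrite evA_comb //= !big_cons big_nil mulr1. Qed.

Lemma evA_Cotton U i j k : evA U Cotton [:: i; j; k]
  = evA U (Rc 1) [:: k; i; j] - evA U (Rc 1) [:: j; i; k]
    - cf quarter * (evA U dS [:: k] * G i j - evA U dS [:: j] * G i k).
Proof.
have mq : cf mquarter = - cf quarter.
  by apply: ev_inj => x; rewrite rmorphN !ev_cst /dval /= intrN mulNr.
rewrite [LHS]evA_cat mulrBr opprB -addrA; congr (_ + _).
  by rewrite evA_perm // cf1 mul1r.
rewrite [LHS]evA_cat; congr (_ + _).
  by rewrite evA_perm // cfN1 mulN1r.
rewrite [LHS]evA_cat addrC; congr (_ + _).
  by rewrite evA_mul // evA_Met.
by rewrite evA_mul // evA_Met mq mulNr.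
Qed.

Lemma evA_dt_C U i j k : evA U dt_C [:: i; j; k]
  = evA U dt_dric [:: k; i; j] - evA U dt_dric [:: j; i; k]
    - cf quarter * (evA U (cov dt_S) [:: k] * G i j - evA U (cov dt_S) [:: j] * G i k)
    + cf half * (evA U dS [:: k] * ricA i j - evA U dS [:: j] * ricA i k).
Proof.
have mq : cf mquarter = - cf quarter.
  by apply: ev_inj => x; rewrite rmorphN !ev_cst /dval /= intrN mulNr.
have mh : cf mhalf = - cf half.
  by apply: ev_inj => x; rewrite rmorphN !ev_cst /dval /= intrN mulNr.
transitivity (evA U dt_dric [:: k; i; j] + (- evA U dt_dric [:: j; i; k]
  + (- (cf quarter * (evA U (cov dt_S) [:: k] * G i j))
  + (cf half * (evA U dS [:: k] * ricA i j)
  + (cf quarter * (evA U (cov dt_S) [:: j] * G i k)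
     - cf half * (evA U dS [:: j] * ricA i k)))))); last by ring.
rewrite [LHS]evA_cat; congr (_ + _); first by rewrite evA_perm // cf1 mul1r.
rewrite [LHS]evA_cat; congr (_ + _); first by rewrite evA_perm // cfN1 mulN1r.
rewrite [LHS]evA_cat; congr (_ + _); first by rewrite evA_mul // evA_Met mq mulNr.
rewrite [LHS]evA_cat; congr (_ + _); first by rewrite evA_mul // evA_Rc.
rewrite [LHS]evA_cat; congr (_ + _); first by rewrite evA_mul // evA_Met.
by rewrite evA_mul // evA_Rc // mh mulNr.
Qed.

Lemma dt_Cotton U w : size w = 3%N -> dt (evA U Cotton w) = evA U dt_C w.
Proof.
case: w => [|i [|j [|k [|? ?]]]] // _.
rewrite evA_Cotton evA_dt_C !dtB !dt_dRc dtM dtB dt_cst mul0r add0r.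
rewrite !dtM !dt_dSc !flow !cf_intr.
have -> : cf half = cf quarter * 2.
  apply: ev_inj => x; rewrite rmorphM rmorph_nat !ev_cst /dval /= expr1 expr2 invfM mulrA.
  by rewrite mulfVK // pnatr_eq0.
by rewrite intrN; ring.
Qed.

Lemma dt_dCotton U w : size w = 4%N -> dt (evA U (cov Cotton) w) = evA U dt_dC w.
Proof.
case: w => [//|l w] sw; have [sw'] := sw.
rewrite [RHS]evA_cat evA_neg // (@dt_cov U 3 Cotton) // (@evA_cov U 3 dt_C) //.
by congr (_ - _); apply: (@nab_eqs 3 _ _ (l :: w)) => // v sv; exact: dt_Cotton.
Qed.

Lemma dt_Bach U i k : dt (evA U Bach [:: i; k]) = evA U dt_B [:: i; k].
Proof.
rewrite dt_ctr_comb // evA_cat !evA_comb //; congr (_ + _).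
  rewrite cf_intr; congr (_ * _) => /=; apply: eq_bigr => p _; apply: eq_bigr => q _.
  congr (_ * _); apply: eq_bigr => r _; apply: eq_bigr => t _.
  by rewrite !big_cons big_nil mulr1 !evA_Rc.
rewrite cf1 mul1r; apply: ctrA_ext => v sv; rewrite big_seq1 dt_dCotton // size_map //.
Qed.

(** The evolution equation in the ring, an identity between jets of the Ricci tensor that
    the decision procedure settles. *)
Theorem bach_evolution U i k :
  dt (evA U Bach [:: i; k]) - evA U (lap 2 Bach) [:: i; k] = evA U flow_rhs [:: i; k].
Proof.
have := jet_decide U flow_check (erefl : size [:: i; k] = 2%N).
rewrite evA_cat evA_neg // evA_cat -dt_Bach => /eqP.
by rewrite subr_eq0 => /eqP ->; rewrite addrC addKr.
Qed.

End Geometry.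

(** * Smooth families and the symmetry of mixed derivatives *)

Local Open Scope classical_set_scope.
Local Open Scope ring_scope.

Section SmoothFamilies.
Variables (R : realType) (I : set R) (U : set 'rV[R]_3).
Notation pt := 'rV[R]_3.
Notation family := (R -> pt -> R).
Hypothesis I_itv : is_interval I.
Hypothesis I_nd : exists s t : R, [/\ I s, I t & s < t].
Hypothesis U_open : open U.

(** Points of a nondegenerate interval are not isolated in it, so limits along the
    interval are unique. *)
Lemma I_accu t : I t -> forall e : R, 0 < e ->
  exists h : R, [/\ h != 0, `|h| < e & I (t + h)].
Proof.
move=> It e e0.
have [s Is st] : exists2 s, I s & s != t.
  have [s [s' [Is Is' ss']]] := I_nd.
  have [st|st] := eqVneq s t; last by exists s.
  by exists s' => //; rewrite -st gt_eqF.
have st0 : s - t != 0 by rewrite subr_eq0.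
have n0 : 0 < `|s - t| by rewrite normr_gt0.
pose a := Num.min (1 / 2) (e / (2 * `|s - t|)).
have a0 : 0 < a by rewrite lt_min divr_gt0 //= divr_gt0 // mulr_gt0.
have a1 : a < 1 by rewrite gt_min; apply/orP; left; lra.
have ae : a * `|s - t| < e.
  have : a <= e / (2 * `|s - t|) by rewrite ge_min lexx orbT.
  rewrite -(ler_pM2r n0) => /le_lt_trans; apply.
  rewrite invfM mulrA mulfVK ?normr_eq0 //; lra.
exists (a * (s - t)); split.
- by rewrite mulf_neq0 // gt_eqF.
- by rewrite normrM (gtr0_norm a0).
- have [h|h] : s < t \/ t < s by apply/orP; rewrite -neq_lt.
  + by apply: (@I_itv s t) => //; apply/andP; split; nra.
  + by apply: (@I_itv t s) => //; apply/andP; split; nra.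
Qed.

(** Approach to [t] along the time interval. *)
Definition tnear t := within I t^'.

Global Instance tnear_filter t : Filter (tnear t).
Proof. exact: within_filter. Qed.

Lemma tnear_proper t : I t -> ProperFilter (tnear t).
Proof.
move=> It; apply: Build_ProperFilter_ex => P [e /= e0 eP].
have [h [h0 he Ith]] := I_accu It e0.
exists (t + h); apply: eP => //=.
- by rewrite opprD addNKr normrN.
- by rewrite -subr_eq0 addrAC subrr add0r.
Qed.

Definition on_eq (f g : family) := forall t x, I t -> U x -> f t x = g t x.

Lemma tnearW (P : R -> Prop) t : (forall s, I s -> P s) -> \forall s \near tnear t, P s.
Proof. by move=> IP; rewrite /tnear near_withinE; apply: nearW. Qed.

Lemma tnear_eq (f g : R -> R) t : (forall s, I s -> f s = g s) ->
  {near tnear t, f =1 g}.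
Proof. by move=> fg; apply: tnearW. Qed.

Lemma dq_eq (f g : R -> R) t : (forall s, I s -> f s = g s) -> I t ->
  (diff_quot f t @ tnear t) = (diff_quot g t @ tnear t).
Proof.
move=> fg It; rewrite eqEsubset; split; apply: near_eq_cvg; apply: tnear_eq => s Is;
  by rewrite /diff_quot !fg.
Qed.

Lemma deriv_in_eq (f g : R -> R) t : (forall s, I s -> f s = g s) -> I t ->
  deriv_in I f t = deriv_in I g t.
Proof. by move=> fg It; rewrite /deriv_in -/(tnear t) (dq_eq fg It). Qed.

Lemma derivable_in_eq (f g : R -> R) t : (forall s, I s -> f s = g s) -> I t ->
  derivable_in I f t -> derivable_in I g t.
Proof. by move=> fg It; rewrite /derivable_in -/(tnear t) (dq_eq fg It). Qed.

Definition is_deriv_in (f : R -> R) (t l : R) := diff_quot f t @ tnear t --> l.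

Lemma is_deriv_in_val (f : R -> R) t l : I t -> is_deriv_in f t l ->
  derivable_in I f t /\ deriv_in I f t = l.
Proof.
move=> It fl; have PF := tnear_proper It; split.
  by apply/cvg_ex; exists l.
exact: cvg_lim fl.
Qed.

Lemma is_deriv_in_cts (f : R -> R) t l : is_deriv_in f t l -> f s @[s --> tnear t] --> f t.
Proof.
move=> fl; have ts : s @[s --> tnear t] --> t.
  by move=> P tP; rewrite /tnear /= /within /=; apply: filterS tP => s Ps _ _.
have : f t + (s - t) * diff_quot f t s @[s --> tnear t] --> f t + (t - t) * l.
  apply: cvgD; first exact: cvg_cst.
  apply: cvgM => //; apply: cvgB => //; exact: cvg_cst.
rewrite subrr mul0r addr0; apply: cvg_trans; apply: near_eq_cvg.
have : \forall s \near tnear t, s != t.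
  by rewrite /tnear near_withinE /dnbhs near_withinE; apply: nearW.
apply: filterS => s st; rewrite /diff_quot mulrA mulfV ?subr_eq0 // mul1r.
by rewrite addrCA subrr addr0.
Qed.

Lemma is_deriv_inD (f g : R -> R) t l m : is_deriv_in f t l -> is_deriv_in g t m ->
  is_deriv_in (fun s => f s + g s) t (l + m).
Proof.
move=> fl gm.
have : diff_quot f t s + diff_quot g t s @[s --> tnear t] --> l + m by exact: cvgD.
apply: cvg_trans; apply: near_eq_cvg.
by apply: nearW => s /=; rewrite /diff_quot; ring.
Qed.

Lemma is_deriv_inM (f g : R -> R) t l m : is_deriv_in f t l -> is_deriv_in g t m ->
  is_deriv_in (fun s => f s * g s) t (l * g t + f t * m).
Proof.
move=> fl gm.
have : diff_quot f t s * g s + f t * diff_quot g t s @[s --> tnear t] --> l * g t + f t * m.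
  apply: cvgD; apply: cvgM => //; [exact: is_deriv_in_cts gm | exact: cvg_cst].
apply: cvg_trans; apply: near_eq_cvg.
by apply: nearW => s /=; rewrite /diff_quot; ring.
Qed.

Lemma is_deriv_in_cst c t : is_deriv_in (fun=> c) t 0.
Proof.
apply: (@cvg_trans _ ((fun=> 0) @ tnear t)); last exact: cvg_cst.
by apply: near_eq_cvg; apply: nearW => s /=; rewrite /diff_quot subrr mulr0.
Qed.

Lemma is_deriv_inV (f : R -> R) t l : f t != 0 -> is_deriv_in f t l ->
  is_deriv_in (fun s => (f s)^-1) t (- l * (f t)^-1 * (f t)^-1).
Proof.
move=> ft0 fl; have fc := is_deriv_in_cts fl.
have : - diff_quot f t s * (f s)^-1 * (f t)^-1 @[s --> tnear t] --> - l * (f t)^-1 * (f t)^-1.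
  apply: cvgM; last exact: cvg_cst.
  by apply: cvgM; [exact: cvgN | exact: cvgV].
apply: cvg_trans; apply: near_eq_cvg.
have : \forall s \near tnear t, f s != 0 by exact: cvgr_neq0 fc ft0.
apply: filterS => s fs0 /=; rewrite /diff_quot; move: ((s - t)^-1) => u.
by field; rewrite fs0 ft0.
Qed.

Notation dir := (option 'I_3).
Notation e_ i := (delta_mx 0 i : pt).

(** Joint continuity in time and space. *)
Definition cts (f : family) :=
  {within I `*` U, continuous (fun p : R * pt => f p.1 p.2)}.
Definition drv (f : family) := forall t x, I t -> U x ->
  (forall i, derivable (f t) x (e_ i)) /\ derivable_in I (fun s => f s x) t.

Lemma cts_eq f g : on_eq f g -> cts f -> cts g.
Proof.
move=> fg; apply: subspace_eq_continuous => -[t x]; rewrite inE => -[/= It Ux].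
exact: fg.
Qed.

Lemma near_eq_space (f g : pt -> R) x : (forall y, U y -> f y = g y) -> U x ->
  \forall y \near x, f y = g y.
Proof.
move=> fg Ux; have : \forall y \near x, U y by exact: open_nbhs_nbhs.
by apply: filterS => y; exact: fg.
Qed.

Lemma drv_eq f g : on_eq f g -> drv f -> drv g.
Proof.
move=> fg df t x It Ux; have [dfi dft] := df t x It Ux; split.
  move=> i; apply: near_eq_derivable (dfi i).
  by apply: near_eq_space => // y; exact: fg.
by apply: derivable_in_eq dft => // s Is; exact: fg.
Qed.

Lemma partial_st_eq f g d : on_eq f g -> on_eq (partial_st I d f) (partial_st I d g).
Proof.
move=> fg t x It Ux; case: d => [i|] /=.
  by apply: near_eq_derive; apply: near_eq_space => // y; exact: fg.
by apply: deriv_in_eq => // s Is; exact: fg.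
Qed.

(** One predicate for space and time derivatives, so that the rules of calculus are
    proved once for both. *)
Definition is_partial d (f : family) t x (l : R) :=
  if d is Some i then is_derive x (e_ i) (f t) l else is_deriv_in (fun s => f s x) t l.

Lemma drv_is_partial d f t x : drv f -> I t -> U x -> is_partial d f t x (partial_st I d f t x).
Proof.
move=> df It Ux; have [dfi dft] := df t x It Ux.
by case: d => [i|] //=; exact: derivableP.
Qed.

Lemma is_partial_val d f t x l : I t -> is_partial d f t x l -> partial_st I d f t x = l.
Proof.
move=> It; case: d => [i|] /= h; first by case: h.
by have [] := is_deriv_in_val It h.
Qed.

Lemma is_partial_drv f : (forall d t x, I t -> U x -> exists l, is_partial d f t x l) -> drv f.
Proof.
move=> h t x It Ux; split=> [i|].
  by have [l []] := h (Some i) t x It Ux.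
by have [l hl] := h None t x It Ux; have [] := is_deriv_in_val It hl.
Qed.

Lemma is_partialD d f g t x l m : is_partial d f t x l -> is_partial d g t x m ->
  is_partial d (fun t x => f t x + g t x) t x (l + m).
Proof. by case: d => [i|] /=; [exact: is_deriveD | exact: is_deriv_inD]. Qed.

Lemma is_partialM d f g t x l m : is_partial d f t x l -> is_partial d g t x m ->
  is_partial d (fun t x => f t x * g t x) t x (l * g t x + f t x * m).
Proof.
case: d => [i|] /= fl gm; last exact: is_deriv_inM.
apply: (is_derive_eq (is_deriveM fl gm)).
by rewrite addrC /GRing.scale /= mulrC.
Qed.

Lemma is_partial_cst d c t x : is_partial d (fun _ _ => c) t x 0.
Proof. by case: d => [i|] /=; [exact: is_derive_cst | exact: is_deriv_in_cst]. Qed.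

Lemma is_partialV d f t x l : f t x != 0 -> is_partial d f t x l ->
  is_partial d (fun t x => (f t x)^-1) t x (- l * (f t x)^-1 * (f t x)^-1).
Proof.
case: d => [i|] /= f0 fl; last exact: is_deriv_inV.
have [df fE] := fl; apply: DeriveDef; first exact: derivableV.
rewrite deriveV // fE /GRing.scale /=; field; exact: f0.
Qed.

(** The closure of the smooth families under the field operations.  It is stable under
    derivatives by the rules of calculus, and its members are continuous and
    differentiable; hence its members are smooth ([rational_smooth_on]), without
    induction on the order of differentiation for sums, products and inverses
    separately. *)
Inductive rational : family -> Prop :=
| rational_smooth f : smooth_family_on I U f -> rational f
| rational_cst c : rational (fun _ _ => c)
| rational_add f g : rational f -> rational g -> rational (fun t x => f t x + g t x)
| rational_mul f g : rational f -> rational g -> rational (fun t x => f t x * g t x)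
| rational_inv f : rational f -> (forall t x, I t -> U x -> f t x != 0) ->
    rational (fun t x => (f t x)^-1).

Lemma smooth_partial f d : smooth_family_on I U f -> smooth_family_on I U (partial_st I d f).
Proof.
move=> sf w; have := sf (rcons w d).
by rewrite /iter_partial_st foldr_rcons.
Qed.

Lemma smooth_cts f : smooth_family_on I U f -> cts f.
Proof. by move=> /(_ [::]) []. Qed.
Lemma smooth_drv f : smooth_family_on I U f -> drv f.
Proof. by move=> /(_ [::]) []. Qed.

Lemma rational_props f : rational f ->
  [/\ cts f, drv f & forall d, exists2 g, rational g & on_eq (partial_st I d f) g].
Proof.
elim=> {f}.
- move=> f sf; split; [exact: smooth_cts | exact: smooth_drv |].
  by move=> d; exists (partial_st I d f) => //; apply: rational_smooth; exact: smooth_partial.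
- move=> c; split.
  + by move=> p; exact: cvg_cst.
  + by apply: is_partial_drv => d t x It Ux; exists 0; exact: is_partial_cst.
  + move=> d; exists (fun _ _ => 0); first exact: rational_cst.
    move=> t x It Ux; apply: is_partial_val => //; exact: is_partial_cst.
- move=> f g rf [cf df pf] rg [cg dg pg].
  have ip d t x : I t -> U x -> is_partial d (fun t x => f t x + g t x) t x
      (partial_st I d f t x + partial_st I d g t x).
    by move=> It Ux; apply: is_partialD; exact: drv_is_partial.
  split.
  + by move=> p; apply: cvgD; [exact: cf | exact: cg].
  + by apply: is_partial_drv => d t x It Ux; eexists; exact: ip.
  + move=> d; have [f' rf' ff'] := pf d; have [g' rg' gg'] := pg d.
    exists (fun t x => f' t x + g' t x); first exact: rational_add.
    by move=> t x It Ux; rewrite -ff' // -gg' //; apply: is_partial_val => //; exact: ip.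
- move=> f g rf [cf df pf] rg [cg dg pg].
  have ip d t x : I t -> U x -> is_partial d (fun t x => f t x * g t x) t x
      (partial_st I d f t x * g t x + f t x * partial_st I d g t x).
    by move=> It Ux; apply: is_partialM; exact: drv_is_partial.
  split.
  + by move=> p; apply: cvgM; [exact: cf | exact: cg].
  + by apply: is_partial_drv => d t x It Ux; eexists; exact: ip.
  + move=> d; have [f' rf' ff'] := pf d; have [g' rg' gg'] := pg d.
    exists (fun t x => f' t x * g t x + f t x * g' t x).
      by apply: rational_add; exact: rational_mul.
    by move=> t x It Ux; rewrite -ff' // -gg' //; apply: is_partial_val => //; exact: ip.
- move=> f rf [cf df pf] f0.
  have ip d t x : I t -> U x -> is_partial d (fun t x => (f t x)^-1) t x
      (- partial_st I d f t x * (f t x)^-1 * (f t x)^-1).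
    by move=> It Ux; apply: is_partialV; [exact: f0 | exact: drv_is_partial].
  split.
  + rewrite /cts; apply/subspace_continuousP => -[t x] [/= It Ux].
    apply: cvgV; first exact: f0.
    by move/subspace_continuousP: cf => /(_ (t, x)); apply.
  + by apply: is_partial_drv => d t x It Ux; eexists; exact: ip.
  + move=> d; have [f' rf' ff'] := pf d.
    exists (fun t x => -1 * f' t x * (f t x)^-1 * (f t x)^-1).
      do 2 (apply: rational_mul; last exact: rational_inv).
      by apply: rational_mul => //; exact: rational_cst.
    move=> t x It Ux; rewrite -ff' // mulN1r; apply: is_partial_val => //; exact: ip.
Qed.

Lemma on_eq_trans f g h : on_eq f g -> on_eq g h -> on_eq f h.
Proof. by move=> fg gh t x It Ux; rewrite fg // gh. Qed.
Lemma on_eq_sym f g : on_eq f g -> on_eq g f.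
Proof. by move=> fg t x It Ux; rewrite fg. Qed.

Lemma rational_smooth_on f g : rational f -> on_eq g f -> smooth_family_on I U g.
Proof.
move=> rf gf w.
have [h rh gh] : exists2 h, rational h & on_eq (iter_partial_st I w g) h.
  elim: w => [|d w [h rh gh]]; first by exists f.
  have [_ _ /(_ d) [h' rh' hh']] := rational_props rh.
  exists h' => //; apply: on_eq_trans hh'; exact: partial_st_eq.
have [ch dh _] := rational_props rh.
split; first by apply: cts_eq ch; exact: on_eq_sym.
by apply: drv_eq dh; exact: on_eq_sym.
Qed.

(** A direction in space-time as a displacement in time and one in space. *)
Definition tv (d : dir) : R := if d is None then 1 else 0.
Definition xv (d : dir) : pt := if d is Some i then e_ i else 0.

Lemma is_derive_quot (psi : R -> R) s l :
  (k^-1 * (psi (k + s) - psi s) @[k --> 0^']) --> l -> is_derive s 1 psi l.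
Proof.
move=> h; have E : (fun k : R => k^-1 *: ((psi \o shift s) (k *: (1 : R)) - psi s))
   = (fun k => k^-1 * (psi (k + s) - psi s)).
  by apply/funext => k; rewrite /= /GRing.scale /= mulr1.
apply: DeriveDef; first by apply/cvg_ex; exists l; rewrite E.
by rewrite /derive E; exact: cvg_lim h.
Qed.

(** Along a segment in the direction [d], inside the domain, the one-sided time
    derivative is an ordinary derivative, since interior points of the segment have a
    neighbourhood in the time interval. *)
Lemma line_derive d f t0 x0 h s : drv f -> s \in `]0, h[%R ->
  (forall a, 0 <= a <= h -> I (t0 + a * tv d) /\ U (x0 + a *: xv d)) ->
  is_derive s 1 (fun a => f (t0 + a * tv d) (x0 + a *: xv d))
    (partial_st I d f (t0 + s * tv d) (x0 + s *: xv d)).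
Proof.
move=> df; rewrite in_itv /= => /andP[s0 sh] seg.
have [Is Us] := seg s (introT andP (conj (ltW s0) (ltW sh))).
have := @drv_is_partial d f _ _ df Is Us.
move: (partial_st _ _ _ _ _) => l.
case: d seg Is Us => [i|] /= seg Is Us.
  move=> [df' dE]; apply: is_derive_quot; rewrite -dE.
  have := df'; rewrite /derivable /derive.
  set F := (fun h => h^-1 *: _); set F' := (fun k => k^-1 * _).
  suff -> : F = F' by [].
  rewrite /F /F'; apply/funext => k.
  rewrite -[LHS]/(k^-1 * (f (t0 + s * 0) (k *: e_ i + (x0 + s *: e_ i))
                          - f (t0 + s * 0) (x0 + s *: e_ i))).
  congr (_ * (f _ _ - _)).
    by rewrite !mulr0.
  by rewrite scalerDl addrCA.
rewrite scaler0 addr0 mulr1 => fl; apply: is_derive_quot.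
have : diff_quot (fun r => f r x0) (t0 + s) (t0 + s + k) @[k --> 0^'] --> l.
  apply: cvg_comp fl => P [e /= e0 eP].
  exists (Num.min e (Num.min s (h - s))) => /=; first by rewrite !lt_min e0 s0 subr_gt0.
  move=> k; rewrite /= sub0r normrN !lt_min => /and3P[ke ks kh] k0.
  apply: eP => /=.
  - by rewrite opprD addNKr normrN.
  - by rewrite -subr_eq0 addrAC subrr add0r.
  - have [] // := seg (s + k); last by rewrite mulr1 addrA.
    by move: ks kh; rewrite !ltr_norml => /andP[? ?] /andP[? ?]; apply/andP; split; lra.
apply: cvg_trans; apply: near_eq_cvg; apply: nearW => k.
rewrite /diff_quot /= !scaler0 !addr0 !mulr1 addrAC subrr add0r.
by congr (_ * (f _ _ - _)); rewrite addrAC addrA.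
Qed.

Lemma line_cts d f t0 x0 h : cts f ->
  (forall a, 0 <= a <= h -> I (t0 + a * tv d) /\ U (x0 + a *: xv d)) ->
  {within `[0, h], continuous (fun a => f (t0 + a * tv d) (x0 + a *: xv d))}.
Proof.
move=> /subspace_continuousP cf seg; apply/subspace_continuousP => s /= s_h.
have sIU : (I `*` U) (t0 + s * tv d, x0 + s *: xv d).
  by apply: seg; move: s_h; rewrite in_itv.
apply: (@cvg_comp _ _ _ (fun a => (t0 + a * tv d, x0 + a *: xv d))
  (fun p : R * pt => f p.1 p.2) _ _ _ _ (cf _ sIU)) => P /=.
rewrite /within /= => nP.
have ct : (t0 + a * tv d) @[a --> s] --> t0 + s * tv d.
  apply: cvgD; first exact: cvg_cst.
  by apply: cvgM; [exact: cvg_id | exact: cvg_cst].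
have cx : (x0 + a *: xv d) @[a --> s] --> x0 + s *: xv d.
  apply: cvgD; first exact: cvg_cst.
  by apply: cvgZr_tmp; exact: cvg_id.
have nQ : nbhs s (fun a => (I `*` U) (t0 + a * tv d, x0 + a *: xv d) ->
    P (t0 + a * tv d, x0 + a *: xv d)).
  exact: (cvg_pair ct cx nP).
suff : nbhs s (fun a => `[0, h]%classic a -> P (t0 + a * tv d, x0 + a *: xv d)) by [].
apply: filterS nQ => a aP a_h; apply: aP.
by apply: seg; move: a_h; rewrite /= in_itv.
Qed.

Lemma line_MVT d f t0 x0 h : cts f -> drv f -> 0 < h ->
  (forall a, 0 <= a <= h -> I (t0 + a * tv d) /\ U (x0 + a *: xv d)) ->
  exists2 c, 0 <= c <= h &
    f (t0 + h * tv d) (x0 + h *: xv d) - f t0 x0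
    = h * partial_st I d f (t0 + c * tv d) (x0 + c *: xv d).
Proof.
move=> cf df h0 seg.
have [c ch E] := MVT h0 (fun s => line_derive df ^~ seg) (line_cts cf seg).
move: ch; rewrite in_itv /= => /andP[/ltW c0 /ltW ch]; exists c; first by rewrite c0.
by move: E => /=; rewrite mul0r scale0r !addr0 subr0 => ->; rewrite mulrC.
Qed.

(** Two applications of the mean value theorem express the second difference over a
    small box by a mixed derivative at some point of the box. *)
Lemma box_MVT d e f t0 x0 h : smooth_family_on I U f -> 0 < h ->
  (forall a b, 0 <= a <= h -> 0 <= b <= h ->
     I (t0 + a * tv d + b * tv e) /\ U (x0 + a *: xv d + b *: xv e)) ->
  exists a b, [/\ 0 <= a <= h, 0 <= b <= h &
    f (t0 + h * tv d + h * tv e) (x0 + h *: xv d + h *: xv e)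
    - f (t0 + h * tv d) (x0 + h *: xv d)
    - f (t0 + h * tv e) (x0 + h *: xv e) + f t0 x0
    = h * h * partial_st I d (partial_st I e f)
                (t0 + a * tv d + b * tv e) (x0 + a *: xv d + b *: xv e)].
Proof.
move=> sf h0 box; have h00 : 0 <= (0 : R) <= h by apply/andP; split=> //; exact: ltW.
have hh : 0 <= h <= h by apply/andP; split=> //; exact: ltW.
have df := smooth_drv sf; have cf := smooth_cts sf.
have seg1 b : 0 <= b <= h -> I (t0 + h * tv d + b * tv e) /\ U (x0 + h *: xv d + b *: xv e).
  exact: box.
have seg0 b : 0 <= b <= h -> I (t0 + b * tv e) /\ U (x0 + b *: xv e).
  by move=> hb; have := box 0 b h00 hb; rewrite mul0r scale0r !addr0.
pose phi b := f (t0 + h * tv d + b * tv e) (x0 + h *: xv d + b *: xv e)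
              - f (t0 + b * tv e) (x0 + b *: xv e).
pose dphi b := partial_st I e f (t0 + h * tv d + b * tv e) (x0 + h *: xv d + b *: xv e)
              - partial_st I e f (t0 + b * tv e) (x0 + b *: xv e).
have phi' b : b \in `]0, h[%R -> is_derive b 1 phi (dphi b).
  by move=> bh; apply: is_deriveB;
    [exact: (line_derive df bh seg1) | exact: (line_derive df bh seg0)].
have phic : {within `[0, h], continuous phi}.
  by move=> b; apply: cvgB; [exact: (line_cts cf seg1) | exact: (line_cts cf seg0)].
have [b bh E] := MVT h0 phi' phic.
have {}bh : 0 <= b <= h by move: bh; rewrite in_itv /= => /andP[/ltW -> /ltW ->].
have sef := smooth_partial e sf.
have [|a ah E2] := @line_MVT d (partial_st I e f) (t0 + b * tv e) (x0 + b *: xv e) h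
    (smooth_cts sef) (smooth_drv sef) h0.
  by move=> a ah; rewrite addrAC [x0 + _ + _]addrAC; exact: box.
exists a, b; split; [exact: ah | exact: bh |].
move: E E2; rewrite /phi /dphi mul0r scale0r !addr0 subr0.
rewrite (addrAC t0 (b * tv e) (h * tv d)) (addrAC x0 (b *: xv e) (h *: xv d)).
rewrite (addrAC t0 (b * tv e) (a * tv d)) (addrAC x0 (b *: xv e) (a *: xv d)) => E E2.
have key (a1 a2 a3 a4 z y : R) :
    a1 - a3 - (a2 - a4) = y * h -> y = h * z -> a1 - a2 - a3 + a4 = h * h * z.
  move=> Ey yz; rewrite yz in Ey.
  by transitivity (h * z * h); [rewrite -Ey; ring | ring].
exact: key E E2.
Qed.

(** Small boxes with a corner at the given point are available inside the domain; at
    a right end of the time interval the box extends into the past. *)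
Lemma corner t x (V : set (R * pt)) d e : d != e -> I t -> U x -> nbhs (t, x) V ->
  exists t0 h, 0 < h /\ (forall a b, 0 <= a <= h -> 0 <= b <= h ->
    [/\ I (t0 + a * tv d + b * tv e), U (x + a *: xv d + b *: xv e) &
        V (t0 + a * tv d + b * tv e, x + a *: xv d + b *: xv e)]).
Proof.
move=> de It Ux [[V1 V2] /= [nV1 nV2] V12].
have [r1 /= r10 V1r] := nV1.
have /nbhs_ballP[r2 /= r20 V2r] : nbhs x (U `&` V2).
  by apply: filterI => //; exact: open_nbhs_nbhs.
pose K := 1 + `|xv d| + `|xv e|.
have K0 : 0 < K by rewrite /K -addrA ltr_wpDr // addr_ge0.
have m0 : 0 < Num.min r1 (r2 / K) by rewrite lt_min r10 divr_gt0.
have [h' [h'0 h'm Ith]] := I_accu It m0.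
move: h'm; rewrite lt_min => /andP[h'1 h'2].
(* Both directions of the box are nonnegative multiples of unit vectors, so in time it has to
   start at the smaller of t and t + h'. *)
exists (if (d == None) || (e == None) then Num.min t (t + h') else t), `|h'|.
split; first by rewrite normr_gt0.
move=> a b /andP[a0 ah] /andP[b0 bh].
have /V2r [Uy V2y] : ball x r2 (x + a *: xv d + b *: xv e).
  rewrite -ball_normE /= -addrA opprD addNKr normrN.
  apply: le_lt_trans (ler_normD _ _) _; rewrite !normrZ !ger0_norm //.
  rewrite ltr_pdivlMr // in h'2; apply: le_lt_trans h'2.
  rewrite /K !mulrDr mulr1 -addrA ler_wpDl //.
  by apply: lerD; apply: ler_wpM2r.
have time c : 0 <= c <= `|h'| -> I (Num.min t (t + h') + c) /\ V1 (Num.min t (t + h') + c).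
  move=> /andP[c0 ch].
  have [hp|hn] := leP 0 h'.
    have tm : Num.min t (t + h') = t by apply/min_idPl; rewrite lerDl.
    rewrite ger0_norm // in ch h'1; rewrite tm; split.
      by apply: (@I_itv t (t + h')) => //; apply/andP; split; lra.
    by apply: V1r; rewrite /= opprD addNKr normrN ger0_norm //; lra.
  have tm : Num.min t (t + h') = t + h' by apply/min_idPr; lra.
  rewrite ltr0_norm // in ch h'1; rewrite tm; split.
    by apply: (@I_itv (t + h') t) => //; apply/andP; split; lra.
  by apply: V1r => /=; rewrite ltr_norml; apply/andP; split; lra.
have V1t : V1 t by apply: V1r; rewrite /= subrr normr0.
have [Iy V1y] : I ((if (d == None) || (e == None) then Num.min t (t + h') else t)
      + a * tv d + b * tv e) /\
   V1 ((if (d == None) || (e == None) then Num.min t (t + h') else t)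
      + a * tv d + b * tv e).
  case: d e de {Uy V2y K K0 m0 h'2 h'1} => [i|] [j|] //= _;
    rewrite ?mulr0 ?mulr1 ?addr0 //; apply: time; exact/andP.
by split => //; apply: V12.
Qed.

Lemma dist_half (u v y : R) :
  `|u - y| < `|u - v| / 2 -> `|v - y| < `|u - v| / 2 -> False.
Proof.
move=> uy vy; have := ltrD uy vy; rewrite -splitr ltNge => /negP; apply.
have -> : u - v = (u - y) - (v - y) by ring.
exact: ler_normB.
Qed.

(** The second difference over a box does not depend on the order of the two
    directions, so both mixed derivatives take a common value at two nearby points;
    both are continuous. *)
Lemma partial_comm f d e t x : smooth_family_on I U f -> I t -> U x ->
  partial_st I d (partial_st I e f) t x = partial_st I e (partial_st I d f) t x.
Proof.
move=> sf It Ux; have [->//|de] := eqVneq d e.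
apply/eqP/negPn/negP => ne.
set u := partial_st _ _ _ _ _ in ne; set v := partial_st _ _ _ _ _ in ne.
pose ep := `|u - v| / 2.
have ep0 : 0 < ep by rewrite divr_gt0 // normr_gt0 subr_eq0.
have IUp : (I `*` U) (t, x) by [].
have c1 := smooth_cts (smooth_partial d (smooth_partial e sf)).
have c2 := smooth_cts (smooth_partial e (smooth_partial d sf)).
move: c1 c2 => /subspace_continuousP /(_ _ IUp) c1 /subspace_continuousP /(_ _ IUp) c2.
have n1 : nbhs (t, x) (fun q => (I `*` U) q -> `|u - partial_st I d (partial_st I e f) q.1 q.2| < ep).
  by move/cvgrPdist_lt : c1 => /(_ _ ep0).
have n2 : nbhs (t, x) (fun q => (I `*` U) q -> `|v - partial_st I e (partial_st I d f) q.1 q.2| < ep).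
  by move/cvgrPdist_lt : c2 => /(_ _ ep0).
have [t0 [h [h0 box]]] := corner de It Ux (filterI n1 n2).
have [|a [b [ah bh E1]]] := @box_MVT d e f t0 x h sf h0.
  by move=> a b ah bh; have [] := box a b ah bh.
have [|b' [a' [b'h a'h E2]]] := @box_MVT e d f t0 x h sf h0.
  move=> p q hp hq; have [? ? _] := box q p hq hp.
  by rewrite (addrAC t0 (p * tv e)) (addrAC x (p *: xv e)).
have hh : h * h != 0 by rewrite mulf_neq0 // gt_eqF.
have E : partial_st I d (partial_st I e f) (t0 + a * tv d + b * tv e) (x + a *: xv d + b *: xv e)
  = partial_st I e (partial_st I d f) (t0 + a' * tv d + b' * tv e) (x + a' *: xv d + b' *: xv e).
  apply: (mulfI hh); rewrite -E1.
  rewrite (addrAC t0 (a' * tv d) (b' * tv e)) (addrAC x (a' *: xv d) (b' *: xv e)) -E2.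
  by rewrite (addrAC t0 (h * tv e)) (addrAC x (h *: xv e)); ring.
have [Ia Ua [+ _]] := box a b ah bh => /(_ (conj Ia Ua)) /= d1.
have [Ia' Ua' [_ +]] := box a' b' a'h b'h => /(_ (conj Ia' Ua')) /= d2.
move: d1 d2; rewrite E; set y := partial_st _ _ _ _ _ => d1 d2.
exact: dist_half d1 d2.
Qed.

End SmoothFamilies.

(** * The ring of smooth families over a chart *)

(** Gram-Schmidt, or the Cholesky factorization: completing the square splits off the
    first variable, and the Schur complement is again symmetric and positive definite. *)
Lemma posdef_frame (R : rcfType) n (M : 'M[R]_n) : M^T = M ->
  (forall v : 'rV[R]_n, v != 0 -> 0 < (v *m M *m v^T) 0 0) ->
  exists E : 'M[R]_n, E *m M *m E^T = 1%:M.
Proof.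
elim: n M => [|n IH] M symM posM.
  by exists 1%:M; rewrite [LHS]flatmx0 [RHS]flatmx0.
pose N : 'M[R]_(1 + n) := M.
have {}symM : N^T = N by [].
have {}posM : forall v : 'rV[R]_(1 + n), v != 0 -> 0 < (v *m N *m v^T) 0 0 by [].
suff : exists E : 'M[R]_(1 + n), E *m N *m E^T = 1%:M by [].
move: N symM posM => {M} N symN posN.
pose a : R := ulsubmx N 0 0; pose b := ursubmx N; pose D := drsubmx N.
have aE : ulsubmx N = a%:M by rewrite [LHS]mx11_scalar.
have bE : dlsubmx N = b^T by rewrite /b -{1}symN trmx_ursub.
have DT : D^T = D by rewrite /D -{2}symN trmx_drsub.
have NE : N = block_mx a%:M b b^T D by rewrite -[LHS]submxK aE bE.
have a0 : 0 < a.
  have := posN (row_mx 1%:M 0); rewrite NE mul_row_block tr_row_mx mul_row_col.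
  rewrite !mul1mx !mul0mx !addr0 trmx1 mulmx1 trmx0 mulmx0 addr0 mxE eqxx mulr1n; apply.
  apply/eqP => /(congr1 (@lsubmx _ _ _ _)); rewrite row_mxKl => /matrixP /(_ 0 0).
  by rewrite !mxE /= => /eqP; rewrite oner_eq0.
pose s := Num.sqrt a.
have s0 : s != 0 by rewrite sqrtr_eq0 -ltNge.
have s2 : s * s = a by rewrite -expr2 sqr_sqrtr // ltW.
pose E1 : 'M[R]_(1 + n) := block_mx (s^-1)%:M 0 (- a^-1 *: b^T) 1%:M.
(* The Schur complement of the upper left entry. *)
pose D' := D - a^-1 *: (b^T *m b).
have a00 : a != 0 by rewrite gt_eqF.
have E1E : E1 *m N *m E1^T = block_mx 1%:M 0 0 D'.
  have -> : E1 *m N = block_mx (s^-1 * a)%:M (s^-1 *: b) 0 D'.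
    rewrite NE /E1 mulmx_block !mul0mx !addr0 !mul1mx -scalar_mxM mul_scalar_mx.
    rewrite mul_mx_scalar scalerA mulrN divff // scaleN1r addNr.
    by rewrite -scalemxAl addrC scaleNr.
  have -> : E1^T = block_mx (s^-1)%:M (- a^-1 *: b) 0 1%:M.
    by rewrite /E1 tr_block_mx !tr_scalar_mx trmx0 linearZ /= trmxK.
  rewrite mulmx_block !mul0mx !mulmx0 !addr0 !add0r !mulmx1 -scalar_mxM mul_scalar_mx.
  have -> : (s^-1 * a) *: (- a^-1 *: b) + s^-1 *: b = 0.
    by rewrite scalerA -scalerDl (_ : _ + _ = 0) ?scale0r //; field; rewrite a00 s0.
  by congr (block_mx _%:M _ _ _); rewrite -s2; field.
have posD' (w : 'rV[R]_n) : w != 0 -> 0 < (w *m D' *m w^T) 0 0.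
  move=> w0; have v0 : row_mx 0 w *m E1 != 0.
    rewrite mul_row_block !mul0mx !add0r mulmx1; apply/eqP => /(congr1 (@rsubmx _ _ _ _)).
    by rewrite row_mxKr linear0 => /eqP; rewrite (negPf w0).
  have := posN _ v0; rewrite trmx_mul -!mulmxA [E1 *m (N *m _)]mulmxA [E1 *m N *m _]mulmxA E1E.
  by rewrite tr_row_mx trmx0 mul_block_col !mulmx0 !mul0mx !add0r mul_row_col mul0mx add0r mulmxA.
have symD' : D'^T = D' by rewrite /D' linearB /= linearZ /= trmx_mul trmxK DT.
have [E' E'E] := IH D' symD' posD'.
exists (block_mx 1%:M 0 0 E' *m E1).
rewrite trmx_mul !mulmxA -[_ *m E1 *m N]mulmxA -[_ *m (E1 *m N) *m _]mulmxA E1E.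
rewrite tr_block_mx !mulmx_block !trmx0 trmx1 !mul0mx !mulmx0 !addr0 !add0r !mul1mx !mulmx1 E'E.
by rewrite mul0mx -scalar_mx_block.
Qed.

(** The right-hand side of the evolution equation, flattened into a right-nested sum with
    one coefficient for each summand. *)
Fact regroup (A : comNzRingType) (h a1 a2 a3 a4 a5 a6 a7 a8 a9 a10 a11 a12 a13 a14 s b a16 a17 a18 l n he hn a23 a24 m : A) :
  3 * a1 + (1 * a2 + (-1 * a3 + (-2 * a4 + (-3 * a5 + (-5 * a6 + (2 * a7 + (-2 * a8 +
  (1 * a9 + (-1 * a10 + (-2 * a11 + (-2 * a12 + (-4 * a13 + (-2 * a14 + (3 * (s * b)
  + (2 * (a16 * m) + (2 * (a17 * m) + (h * (a18 * m) + (h * (s * l * m) + (-h * (n * m)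
  + (-h * (s * he) + (h * hn + (2 * a23 + -1 * a24))))))))))))))))))))))
  = (3 * a1 + a2 - a3) + (-2 * a4 - 3 * a5 - 5 * a6 + 2 * a7 - 2 * a8 + a9 - a10)
    + (-2 * a11 - 2 * a12 - 4 * a13 - 2 * a14)
    + (3 * s * b + 2 * a16 * m + 2 * a17 * m + h * (a18 + s * l - n) * m
       - h * (s * he - hn) + 2 * a23 - a24).
Proof. ring. Qed.

Lemma ctr0 (R : realType) (G : 'rV[R]_3 -> 'M[R]_3) x F :
  (forall p q, F p q = 0) -> ctr G x F = 0.
Proof. by move=> F0; apply: big1 => p _; apply: big1 => q _; rewrite F0 mulr0. Qed.

Fact regroup_flat (A : comNzRingType) (h a1 a2 a3 a4 a5 a6 a7 a8 a9 a10 a11 a12 a13 a14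
    s b a16 a17 a18 l n he hn a23 a24 m : A) :
  b = 0 -> a5 = 0 -> a6 = 0 -> a17 = 0 ->
  (3 * a1 + a2 - a3) + (-2 * a4 - 3 * a5 - 5 * a6 + 2 * a7 - 2 * a8 + a9 - a10)
    + (-2 * a11 - 2 * a12 - 4 * a13 - 2 * a14)
    + (3 * s * b + 2 * a16 * m + 2 * a17 * m + h * (a18 + s * l - n) * m
       - h * (s * he - hn) + 2 * a23 - a24)
  = 3 * a1 + a2 - a3 - 2 * a4 + 2 * a7 - 2 * a8 + a9 - a10
    - 2 * a11 - 2 * a12 - 4 * a13 - 2 * a14
    + 2 * a16 * m + h * (a18 + s * l - n) * m
       - h * (s * he - hn) + 2 * a23 - a24.
Proof. by move=> -> -> -> ->; ring. Qed.

Lemma flow_rhs_flat (R : realType) (G : 'rV[R]_3 -> 'M[R]_3) i k x :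
  (forall a b, bach G a b x = 0) -> bach_flow_rhs G i k x = bach_flat_rhs G i k x.
Proof.
move=> B0; apply: regroup_flat => //.
- by apply: ctr0 => p q; rewrite B0 mulr0.
- by apply: ctr0 => p q; rewrite B0 mulr0.
- by do 2 (apply: ctr0 => ? ?); rewrite B0 mulr0.
Qed.

Section Ring.
Variables (R : realType) (I : set R) (U : set 'rV[R]_3).
Notation pt := 'rV[R]_3.
Notation family := (R -> pt -> R).
Hypothesis I_itv : is_interval I.
Hypothesis I_nd : exists s t : R, [/\ I s, I t & s < t].
Hypothesis U_open : open U.

(** Points of space-time at which all families are considered. *)
Definition dom := {p : R * pt | I p.1 /\ U p.2}.
Definition mk t x (It : I t) (Ux : U x) : dom := exist _ (t, x) (conj It Ux).

(** Families are functions on all of space-time, but only their values on the domain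
    matter.  Restriction to the domain makes equality of families extensional, which
    a ring structure needs; extension by zero goes back. *)
Definition ext (f : dom -> R) : family := fun t x =>
  if pselect (I t /\ U x) is left h then f (exist _ (t, x) h) else 0.
Definition restr (F : family) : dom -> R := fun p => F (sval p).1 (sval p).2.

Lemma ext_at f t x (h : I t /\ U x) : ext f t x = f (exist _ (t, x) h).
Proof.
by rewrite /ext; case: pselect => // h'; congr (f (exist _ _ _)); exact: Prop_irrelevance.
Qed.

Lemma ext_restr F : on_eq I U (ext (restr F)) F.
Proof. by move=> t x It Ux; rewrite (ext_at _ (conj It Ux)). Qed.

Definition smooth_fun : {pred dom -> R} := fun f => `[< smooth_family_on I U (ext f) >].

Lemma smooth_funP f F : rational I U F -> on_eq I U (ext f) F -> f \in smooth_fun.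
Proof.
by move=> rF fF; rewrite unfold_in; apply/asboolP; exact: rational_smooth_on rF fF.
Qed.

Lemma smooth_fun_rational f : f \in smooth_fun -> rational I U (ext f).
Proof. by rewrite unfold_in => /asboolP; exact: rational_smooth. Qed.

Fact smooth_fun_subring : GRing.subring_closed smooth_fun.
Proof.
split.
- apply: (@smooth_funP _ (fun _ _ => 1)); first exact: rational_cst.
  by move=> t x It Ux; rewrite (ext_at _ (conj It Ux)).
- move=> f g sf sg; apply: (@smooth_funP _ (fun t x => ext f t x + (-1) * ext g t x)).
    apply: rational_add; first exact: smooth_fun_rational.
    by apply: rational_mul; [exact: rational_cst | exact: smooth_fun_rational].
  by move=> t x It Ux; rewrite !(ext_at _ (conj It Ux)) mulN1r.
- move=> f g sf sg; apply: (@smooth_funP _ (fun t x => ext f t x * ext g t x)).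
    by apply: rational_mul; exact: smooth_fun_rational.
  by move=> t x It Ux; rewrite !(ext_at _ (conj It Ux)).
Qed.

(** The ring of smooth families, as a subring of all functions on the domain. *)
Record sfam := SFam { sfval : dom -> R; sfamP : sfval \in smooth_fun }.
HB.instance Definition _ := [isSub for sfval].
HB.instance Definition _ := [Choice of sfam by <:].
HB.instance Definition _ :=
  GRing.SubChoice_isSubComPzRing.Build (dom -> R) smooth_fun sfam smooth_fun_subring.

Variable p0 : dom.
Fact sfam1_neq0 : (1 : sfam) != 0.
Proof.
by apply/eqP => /(congr1 (fun f => sfval f p0)) /eqP; rewrite /= oner_eq0.
Qed.
HB.instance Definition _ := GRing.PzSemiRing_isNonZero.Build sfam sfam1_neq0.

Definition ev (p : dom) (f : sfam) : R := sfval f p.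
Arguments ev : simpl never.
Fact ev_zmod p : zmod_morphism (ev p). Proof. by []. Qed.
Fact ev_monoid p : monoid_morphism (ev p). Proof. by []. Qed.
HB.instance Definition _ p := GRing.isZmodMorphism.Build sfam R (ev p) (ev_zmod p).
HB.instance Definition _ p := GRing.isMonoidMorphism.Build sfam R (ev p) (ev_monoid p).

Lemma evD p f g : ev p (f + g) = ev p f + ev p g. Proof. exact: rmorphD. Qed.
Lemma evB p f g : ev p (f - g) = ev p f - ev p g. Proof. exact: rmorphB. Qed.
Lemma evM p f g : ev p (f * g) = ev p f * ev p g. Proof. exact: rmorphM. Qed.
Lemma ev_sum p (J : Type) (r : seq J) (F : J -> sfam) :
  ev p (\sum_(j <- r) F j) = \sum_(j <- r) ev p (F j).
Proof. exact: rmorph_sum. Qed.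

Lemma ev_inj f g : (forall p, ev p f = ev p g) -> f = g.
Proof. by move=> fg; apply: val_inj; apply/funext => p; exact: fg. Qed.

Fact cstf_smooth c : (fun=> c) \in smooth_fun.
Proof.
apply: (@smooth_funP _ (fun _ _ => c)); first exact: rational_cst.
by move=> t x It Ux; rewrite (ext_at _ (conj It Ux)).
Qed.
Definition cstf c : sfam := SFam (cstf_smooth c).

Fact restr_smooth F : smooth_family_on I U F -> restr F \in smooth_fun.
Proof.
by move=> sF; apply: (@smooth_funP _ F); [exact: rational_smooth | exact: ext_restr].
Qed.
Definition sf_of F (sF : smooth_family_on I U F) : sfam := SFam (restr_smooth sF).

Lemma sfam_smooth (f : sfam) : smooth_family_on I U (ext (sfval f)).
Proof. by case: f => f /=; rewrite unfold_in => /asboolP. Qed.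

(** The partial derivatives as operations of the ring. *)
Definition pd (d : option 'I_3) (f : sfam) : sfam := sf_of (smooth_partial d (sfam_smooth f)).

Lemma pd_at d f F t x (It : I t) (Ux : U x) : on_eq I U F (ext (sfval f)) ->
  partial_st I d F t x = ev (mk It Ux) (pd d f).
Proof. by move=> /(partial_st_eq U_open d) /(_ t x It Ux). Qed.

Lemma pd_partial d f t x : I t -> U x ->
  is_partial I d (ext (sfval f)) t x (partial_st I d (ext (sfval f)) t x).
Proof. by move=> It Ux; exact: (drv_is_partial d (smooth_drv (sfam_smooth f)) It Ux). Qed.

Lemma pdD d f g : pd d (f + g) = pd d f + pd d g.
Proof.
apply: ev_inj => -[[t x] [It Ux]].
rewrite -[LHS](@pd_at d _ (fun t x => ext (sfval f) t x + ext (sfval g) t x) t x It Ux); last first.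
  by move=> s y Is Uy; rewrite !(ext_at _ (conj Is Uy)).
apply: (is_partial_val I_itv I_nd It); apply: is_partialD; exact: pd_partial.
Qed.

Lemma pdM d f g : pd d (f * g) = pd d f * g + f * pd d g.
Proof.
apply: ev_inj => -[[t x] [It Ux]].
rewrite -[LHS](@pd_at d _ (fun t x => ext (sfval f) t x * ext (sfval g) t x) t x It Ux); last first.
  by move=> s y Is Uy; rewrite !(ext_at _ (conj Is Uy)).
apply: (is_partial_val I_itv I_nd It).
have := is_partialM (pd_partial d f It Ux) (pd_partial d g It Ux).
by rewrite !(ext_at _ (conj It Ux)).
Qed.

Lemma pd_cst d c : pd d (cstf c) = 0.
Proof.
apply: ev_inj => -[[t x] [It Ux]].
rewrite -[LHS](@pd_at d _ (fun _ _ => c) t x It Ux); last first.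
  by move=> s y Is Uy; rewrite !(ext_at _ (conj Is Uy)).
by apply: (is_partial_val I_itv I_nd It); exact: is_partial_cst.
Qed.

Lemma pdC d e f : pd d (pd e f) = pd e (pd d f).
Proof.
apply: ev_inj => -[[t x] [It Ux]].
rewrite -[LHS](@pd_at d _ (partial_st I e (ext (sfval f))) t x It Ux); last first.
  by move=> s y Is Uy; rewrite ext_restr.
rewrite -[RHS](@pd_at e _ (partial_st I d (ext (sfval f))) t x It Ux); last first.
  by move=> s y Is Uy; rewrite ext_restr.
by apply: (partial_comm I_itv I_nd U_open) => //; exact: sfam_smooth.
Qed.

Fact inv_smooth (f : sfam) : (forall p, ev p f != 0) -> (fun p => (ev p f)^-1) \in smooth_fun.
Proof.
move=> f0; apply: (@smooth_funP _ (fun t x => (ext (sfval f) t x)^-1)).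
  apply: rational_inv; first exact: rational_smooth (sfam_smooth f).
  by move=> t x It Ux; rewrite (ext_at _ (conj It Ux)); exact: f0.
by move=> t x It Ux; rewrite !(ext_at _ (conj It Ux)).
Qed.

(** Inverse of a family without zeros.  It is needed for the determinant of the metric
    only, so the inverse metric is written with the adjugate matrix. *)
Definition invf (f : sfam) (f0 : forall p, ev p f != 0) : sfam := SFam (inv_smooth f0).

Variable G : R -> pt -> 'M[R]_3.
Hypothesis G_smooth : forall i j, smooth_family_on I U (fun t x => G t x i j).
Hypothesis G_sym : forall t x, I t -> U x -> (G t x)^T = G t x.
Hypothesis G_pos : forall t x, I t -> U x ->
  forall v : 'rV[R]_3, v != 0 -> 0 < (v *m G t x *m v^T) 0 0.
Hypothesis G_flow : forall t x, I t -> U x -> forall i j : 'I_3,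
  derivable_in I (fun s => G s x i j) t /\
  deriv_in I (fun s => G s x i j) t = - 2 * ricci (G t) i j x.

Notation Gp p := (G (sval (p : dom)).1 (sval (p : dom)).2).

Definition gA i j : sfam := sf_of (G_smooth i j).
Definition gM : 'M[sfam]_3 := \matrix_(i, j) gA i j.

Lemma ev_gM p : map_mx (ev p) gM = Gp p.
Proof. by apply/matrixP => i j; rewrite !mxE. Qed.

Lemma frame_at p : exists E : 'M[R]_3, E *m Gp p *m E^T = 1%:M.
Proof. by case: p => -[t x] [It Ux] /=; apply: posdef_frame; [exact: G_sym | exact: G_pos]. Qed.

Lemma G_unit p : Gp p \in unitmx.
Proof.
have [E EE] := frame_at p; have : \det (E *m Gp p *m E^T) = 1 by rewrite EE det1.
rewrite !det_mulmx => h; rewrite unitmxE unitfE; apply/eqP => G0.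
by move/eqP: h; rewrite G0 mulr0 mul0r eq_sym oner_eq0.
Qed.

Lemma det_neq0 p : ev p (\det gM) != 0.
Proof. by rewrite -det_map_mx ev_gM -unitfE -unitmxE; exact: G_unit. Qed.

Definition hA i j : sfam := invf det_neq0 * (\adj gM) i j.

Lemma ev_hA p i j : ev p (hA i j) = invmx (Gp p) i j.
Proof.
have -> : ev p (hA i j) = ev p (invf det_neq0) * ev p ((\adj gM) i j) by exact: evM.
have -> : ev p (invf det_neq0) = (ev p (\det gM))^-1 by [].
rewrite /invmx G_unit [RHS]mxE -det_map_mx ev_gM; congr (_ * _).
by rewrite -[in RHS]ev_gM -map_mx_adj [RHS]mxE.
Qed.

Lemma gA_sym i j : gA i j = gA j i.
Proof.
apply: ev_inj => -[[t x] [It Ux]]; rewrite /ev /= /restr /=.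
by have /matrixP /(_ i j) := G_sym It Ux; rewrite mxE.
Qed.

Lemma gA_hA i j : \sum_k gA i k * hA k j = (i == j)%:R.
Proof.
apply: ev_inj => p; rewrite ev_sum rmorph_nat.
under eq_bigr do rewrite evM ev_hA.
have := mulmxV (G_unit p) => /matrixP /(_ i j); rewrite !mxE => <-.
by [].
Qed.

(** Rows of a matrix that brings the metric at [p] to the identity by congruence. *)
Lemma frameA p : exists b : nat -> 'rV[R]_3,
  [/\ forall k l, ev p (hA k l) = \sum_(a <- axes) b a 0 k * b a 0 l,
      forall u : 'rV[R]_3, exists c, u = \sum_(a <- axes) c a *: b a &
      forall a c, (a < 3)%N -> (c < 3)%N ->
        \sum_i \sum_j b a 0 i * b c 0 j * ev p (gA i j) = (a == c)%:R].
Proof.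
have [E EE] := frame_at p; exists (fun a => row (inord a) E).
have axesE (V : zmodType) (F : 'I_3 -> V) : \sum_(a <- axes) F (inord a) = \sum_a F a.
  rewrite !big_cons big_nil !big_ord_recl big_ord0.
  by congr (F _ + (F _ + (F _ + _))); apply: val_inj; rewrite /= inordK.
have EU : E \in unitmx by case/mulmx1_unit: (etrans (mulmxA _ _ _) EE).
have HE : invmx (Gp p) = E^T *m E.
  have GE : Gp p *m (E^T *m E) = 1%:M.
    by rewrite mulmxA; apply: mulmx1C; rewrite mulmxA.
  by rewrite -[LHS]mulmx1 -GE mulKmx // G_unit.
split.
- move=> k l; rewrite ev_hA HE mxE.
  rewrite (axesE _ (fun a => row a E 0 k * row a E 0 l)).
  by apply: eq_bigr => a _; rewrite !mxE.
- move=> u; exists (fun a => (u *m invmx E) 0 (inord a)).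
  rewrite (axesE _ (fun a => (u *m invmx E) 0 a *: row a E)) -mulmx_sum_row.
  by rewrite mulmxKV.
- move=> a c a3 c3.
  have := EE => /matrixP /(_ (inord a) (inord c)); rewrite [RHS]mxE -val_eqE /= !inordK // => <-.
  rewrite mxE exchange_big; apply: eq_bigr => j _.
  rewrite !mxE mulr_suml; apply: eq_bigr => i _.
  by rewrite !mxE mulrAC.
Qed.

Notation dA := (fun l => pd (Some l)).
Notation GamA := (Gam cstf dA gA hA).
Notation riemA := (riem cstf dA gA hA).
Notation ricAA := (ricA cstf dA gA hA).
Notation evE := (evA cstf dA gA hA (fun=> fun=> 0)).
Notation nabA := (nabla dA GamA).

Section AtTime.
Variables (t : R) (It : I t).
Notation at_ Uy a := (ev (mk It Uy) a).

Lemma link_partial (f : pt -> R) (a : sfam) i x (Ux : U x) :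
  (forall y (Uy : U y), f y = at_ Uy a) -> partial i f x = at_ Ux (dA i a).
Proof.
move=> fa; rewrite -(@pd_at (Some i) a (ext (sfval a)) t x It Ux) //.
apply: near_eq_derive; apply: (near_eq_space U_open) Ux => y Uy.
by rewrite (fa _ Uy) (ext_at _ (conj It Uy)).
Qed.

Lemma link_inv x (Ux : U x) i j : invmx (G t x) i j = at_ Ux (hA i j).
Proof. by rewrite ev_hA. Qed.

Lemma link_chr k i j x (Ux : U x) : christoffel (G t) k i j x = at_ Ux (GamA k i j).
Proof.
rewrite /christoffel /Gam evM ev_sum; congr (_ * _); apply: eq_bigr => l _.
rewrite evM link_inv evB evD; congr (_ * (_ + _ - _));
  by apply: link_partial => y Uy.
Qed.

Lemma link_riem l i j k x (Ux : U x) : riemann (G t) l i j k x = at_ Ux (riemA l i j k).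
Proof.
rewrite /riemann /riem evD evB ev_sum.
rewrite -(link_partial i Ux (link_chr l j k)) -(link_partial j Ux (link_chr l i k)).
congr (_ + _); apply: eq_bigr => p _.
by rewrite !(link_chr _ _ _ Ux) -!evM -evB.
Qed.

Lemma link_ric j k x (Ux : U x) : ricci (G t) j k x = at_ Ux (ricAA j k).
Proof.
by rewrite /ricci /ricA ev_sum; apply: eq_bigr => i _; exact: link_riem.
Qed.

(** The value at a point of a covariant derivative computed in the ring; the four
    lemmas below specialize it to the ranks for which covariant derivatives are
    defined by explicit formulas. *)
Lemma link_nab (T : seq 'I_3 -> pt -> R) (TA : tensor sfam) l w x (Ux : U x) :
  (forall v y (Uy : U y), size v = size w -> T v y = at_ Uy (TA v)) ->
  at_ Ux (nabA TA (l :: w))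
  = partial l (T w) x - at_ Ux (act (fun i p => GamA p l i) TA w).
Proof.
move=> TT; rewrite -[nabA TA (l :: w)]/(der (dA l) (fun i p => GamA p l i) TA w) /der evB.
by congr (_ - _); apply/esym/link_partial => y Uy; exact: TT.
Qed.

Lemma link_cov0 (T : pt -> R) (TA : tensor sfam) :
  (forall y (Uy : U y), T y = at_ Uy (TA [::])) ->
  forall l y (Uy : U y), cov0 T l y = at_ Uy (nabA TA [:: l]).
Proof.
move=> TT l y Uy; rewrite (@link_nab (fun=> T)) /= ?rmorph0 ?subr0 //.
by move=> [|? ?] // z Uz _; exact: TT.
Qed.

Lemma link_cov1 (T : 'I_3 -> pt -> R) (TA : tensor sfam) :
  (forall i y (Uy : U y), T i y = at_ Uy (TA [:: i])) ->
  forall l i y (Uy : U y), cov1 (G t) T l i y = at_ Uy (nabA TA [:: l; i]).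
Proof.
move=> TT l i y Uy; rewrite (@link_nab (fun v => T (head ord0 v))) /=; last first.
  by move=> [|a [|? ?]] // z Uz _; exact: TT.
rewrite addr0 ev_sum; congr (_ - _).
by apply: eq_bigr => p _; rewrite evM (link_chr _ _ _ Uy) (TT _ _ Uy).
Qed.

Lemma link_cov2 (T : 'I_3 -> 'I_3 -> pt -> R) (TA : tensor sfam) :
  (forall i j y (Uy : U y), T i j y = at_ Uy (TA [:: i; j])) ->
  forall l i j y (Uy : U y), cov2 (G t) T l i j y = at_ Uy (nabA TA [:: l; i; j]).
Proof.
move=> TT l i j y Uy.
rewrite (@link_nab (fun v => T (nth ord0 v 0) (nth ord0 v 1))) /=; last first.
  by move=> [|a [|b [|? ?]]] // z Uz _; exact: TT.
rewrite addr0 evD !ev_sum opprD addrA; congr (_ - _ - _);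
  by apply: eq_bigr => p _; rewrite evM (link_chr _ _ _ Uy) (TT _ _ _ Uy).
Qed.

Lemma link_cov3 (T : 'I_3 -> 'I_3 -> 'I_3 -> pt -> R) (TA : tensor sfam) :
  (forall i j k y (Uy : U y), T i j k y = at_ Uy (TA [:: i; j; k])) ->
  forall l i j k y (Uy : U y), cov3 (G t) T l i j k y = at_ Uy (nabA TA [:: l; i; j; k]).
Proof.
move=> TT l i j k y Uy.
rewrite (@link_nab (fun v => T (nth ord0 v 0) (nth ord0 v 1) (nth ord0 v 2))) /=; last first.
  by move=> [|a [|b [|c [|? ?]]]] // z Uz _; exact: TT.
rewrite addr0 !evD !ev_sum !opprD !addrA; congr (_ - _ - _ - _);
  by apply: eq_bigr => p _; rewrite evM (link_chr _ _ _ Uy) (TT _ _ _ _ Uy).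
Qed.

Definition evm p : {rmorphism sfam -> R} := ev p.
Lemma evm_inj f g : (forall p, evm p f = evm p g) -> f = g. Proof. exact: ev_inj. Qed.
Lemma evm_cst p c : evm p (cstf c) = c. Proof. by []. Qed.
Let dA_D l := pdD (Some l).
Let dA_M l := pdM (Some l).
Let dA_cst l := pd_cst (Some l).

Lemma evE_cov n e w : all (wf n) e -> size w = n.+1 -> evE (cov e) w = nabA (evE e) w.
Proof. exact: (evA_cov evm_inj evm_cst dA_D dA_M dA_cst gA_sym gA_hA). Qed.

Lemma evE_comb n c m L w : size w = n -> args_ok (n + m.*2) L ->
  evE (comb n c m L) w = cf cstf c * iter m (ctrA hA)
      (fun v => \prod_(q <- L) evE q.1 [seq nth ord0 v l | l <- q.2]) w.
Proof. exact: (evA_comb evm_inj evm_cst). Qed.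

Section AtPoint.
Variables (x : pt) (Ux : U x).
Notation E e w := (at_ Ux (evE e w)).

(** Contraction of the last two slots in the real-valued setting. *)
Definition ctrF (F : seq 'I_3 -> R) (w : seq 'I_3) : R :=
  ctr (G t) x (fun p q => F (w ++ [:: p; q])).

Lemma eq_ctr F F' : (forall p q, F p q = F' p q) -> ctr (G t) x F = ctr (G t) x F'.
Proof. by move=> FF; apply: eq_bigr => p _; apply: eq_bigr => q _; rewrite FF. Qed.

(** The value at a point of a symbolic contraction, as a nested sum over indices. *)
Lemma link_comb n c m L w : size w = n -> args_ok (n + m.*2) L ->
  E (comb n c m L) w = dval R c * iter m ctrF
      (fun v => \prod_(q <- L) E q.1 [seq nth ord0 v l | l <- q.2]) w.
Proof.
move=> sw ok; rewrite evE_comb // evM; congr (_ * _).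
elim: m w {sw ok} => [|m IH] w /=; first by rewrite [LHS]rmorph_prod.
rewrite /ctrA ev_sum; apply: eq_bigr => p _; rewrite ev_sum; apply: eq_bigr => q _.
by rewrite evM IH -link_inv.
Qed.

Lemma iter_ctrF_ext m F F' w : (forall v, F v = F' v) -> iter m ctrF F w = iter m ctrF F' w.
Proof. by move=> /funext ->. Qed.

Lemma link1 n c m e s w : size w = n -> args_ok (n + m.*2) [:: (e, s)] ->
  E (comb n c m [:: (e, s)]) w
  = dval R c * iter m ctrF (fun v => E e [seq nth ord0 v l | l <- s]) w.
Proof.
move=> sw ok; rewrite link_comb //; congr (_ * _); apply: iter_ctrF_ext => v.
by rewrite big_seq1.
Qed.
Lemma link2 n c m e1 s1 e2 s2 w : size w = n ->
  args_ok (n + m.*2) [:: (e1, s1); (e2, s2)] ->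
  E (comb n c m [:: (e1, s1); (e2, s2)]) w
  = dval R c * iter m ctrF (fun v => E e1 [seq nth ord0 v l | l <- s1]
                                     * E e2 [seq nth ord0 v l | l <- s2]) w.
Proof.
move=> sw ok; rewrite link_comb //; congr (_ * _); apply: iter_ctrF_ext => v.
by rewrite !big_cons big_nil mulr1.
Qed.
Lemma link3 n c m e1 s1 e2 s2 e3 s3 w : size w = n ->
  args_ok (n + m.*2) [:: (e1, s1); (e2, s2); (e3, s3)] ->
  E (comb n c m [:: (e1, s1); (e2, s2); (e3, s3)]) w
  = dval R c * iter m ctrF (fun v => E e1 [seq nth ord0 v l | l <- s1]
                                     * E e2 [seq nth ord0 v l | l <- s2]
                                     * E e3 [seq nth ord0 v l | l <- s3]) w.
Proof.
move=> sw ok; rewrite link_comb //; congr (_ * _); apply: iter_ctrF_ext => v.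
by rewrite !big_cons big_nil mulr1 mulrA.
Qed.

Lemma dval_dz (z : int) : dval R (dz z) = z%:~R.
Proof. by rewrite /dval /= expr0 divr1. Qed.
Lemma dval_half : dval R half = 2^-1. Proof. by rewrite /dval /= expr1 mul1r. Qed.
Lemma dval_mhalf : dval R mhalf = - 2^-1.
Proof. by rewrite /dval /= expr1 intrN mulN1r. Qed.
Lemma dval_quarter : dval R quarter = 4^-1.
Proof. by rewrite /dval /= mul1r -natrX. Qed.
End AtPoint.

Notation E Ux e w := (at_ Ux (evE e w)).

Lemma link_Met x (Ux : U x) i j : E Ux Met [:: i; j] = G t x i j.
Proof. by rewrite (evA_Met evm_inj evm_cst). Qed.
Lemma link_Rc0 i j x (Ux : U x) : ricci (G t) i j x = E Ux (Rc 0) [:: i; j].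
Proof. by rewrite (evA_Rc evm_inj evm_cst) //=; exact: link_ric. Qed.
Lemma link_Rc1 l i j x (Ux : U x) : cov2 (G t) (ricci (G t)) l i j x = E Ux (Rc 1) [:: l; i; j].
Proof.
rewrite (evA_Rc evm_inj evm_cst) //; apply: link_cov2 => a b y Uy.
exact: link_ric.
Qed.
Lemma link_Rc2 k l i j x (Ux : U x) :
  cov22 (G t) (ricci (G t)) k l i j x = E Ux (Rc 2) [:: k; l; i; j].
Proof.
rewrite (evA_Rc evm_inj evm_cst) //; apply: link_cov3 => a b c y Uy.
by apply: link_cov2 => a' b' z Uz; exact: link_ric.
Qed.

Lemma link_Sc x (Ux : U x) : scal (G t) x = E Ux Sc [::].
Proof.
rewrite link1 // dval_dz mul1r /=; apply: eq_ctr => p q.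
exact: link_Rc0.
Qed.
Lemma link_dS l x (Ux : U x) : cov0 (scal (G t)) l x = E Ux dS [:: l].
Proof. by rewrite (@evE_cov 0 Sc) //; apply: link_cov0 => y Uy; exact: link_Sc. Qed.
Lemma link_ddS k l x (Ux : U x) : hess (G t) (scal (G t)) k l x = E Ux ddS [:: k; l].
Proof. by rewrite (@evE_cov 1 dS) //; apply: link_cov1 => i y Uy; exact: link_dS. Qed.
Lemma link_LS x (Ux : U x) : lap0 (G t) (scal (G t)) x = E Ux LS [::].
Proof.
rewrite link1 // dval_dz mul1r /=; apply: eq_ctr => p q; exact: link_ddS.
Qed.
Lemma link_norm2 x (Ux : U x) : ricci_norm2 (G t) x = E Ux norm2 [::].
Proof.
rewrite link2 // dval_dz mul1r /=; apply: eq_ctr => p q; apply: eq_ctr => r s.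
by rewrite -!link_Rc0.
Qed.
Lemma link_dnorm2 l x (Ux : U x) : cov0 (ricci_norm2 (G t)) l x = E Ux (cov norm2) [:: l].
Proof. by rewrite (@evE_cov 0 norm2) //; apply: link_cov0 => y Uy; exact: link_norm2. Qed.
Lemma link_ddnorm2 k l x (Ux : U x) :
  hess (G t) (ricci_norm2 (G t)) k l x = E Ux (cov (cov norm2)) [:: k; l].
Proof. by rewrite (@evE_cov 1 (cov norm2)) //; apply: link_cov1 => i y Uy; exact: link_dnorm2. Qed.
Lemma link_lapnorm2 x (Ux : U x) : lap0 (G t) (ricci_norm2 (G t)) x = E Ux (lap 0 norm2) [::].
Proof.
rewrite link1 // dval_dz mul1r /=; apply: eq_ctr => p q; exact: link_ddnorm2.
Qed.
Lemma link_lapRc i j x (Ux : U x) : lap2 (G t) (ricci (G t)) i j x = E Ux (lap 2 (Rc 0)) [:: i; j].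
Proof.
rewrite link1 // dval_dz mul1r /=; apply: eq_ctr => p q; exact: link_Rc2.
Qed.
Lemma link_Cotton i j k x (Ux : U x) : cotton (G t) i j k x = E Ux Cotton [:: i; j; k].
Proof.
rewrite (evA_Cotton evm_inj evm_cst) !evB evM !(evB, evM) -!link_Rc1 -!link_dS.
have -> : at_ Ux (cf cstf quarter) = 4^-1 by rewrite -dval_quarter.
by [].
Qed.
Lemma link_dCotton l i j k x (Ux : U x) : cov3 (G t) (cotton (G t)) l i j k x = E Ux (cov Cotton) [:: l; i; j; k].
Proof. by rewrite (@evE_cov 3 Cotton) //; apply: link_cov3 => a b c y Uy; exact: link_Cotton. Qed.
Lemma link_Bach i k x (Ux : U x) : bach (G t) i k x = E Ux Bach [:: i; k].
Proof.
rewrite link1 // dval_dz mul1r /=; apply: eq_ctr => p q; exact: link_dCotton.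
Qed.
Lemma link_lapBach i j x (Ux : U x) : lap2 (G t) (bach (G t)) i j x = E Ux (lap 2 Bach) [:: i; j].
Proof.
rewrite link1 // dval_dz mul1r /=; apply: eq_ctr => p q.
rewrite (@evE_cov 3 (cov Bach)) //; apply: link_cov3 => a b c y Uy.
rewrite (@evE_cov 2 Bach) //; apply: link_cov2 => a' b' z Uz; exact: link_Bach.
Qed.

Ltac links := rewrite -?link_Rc0 -?link_Rc1 -?link_Rc2 -?link_Sc -?link_dS -?link_ddS -?link_LS
  -?link_ddnorm2 -?link_lapnorm2 -?link_lapRc -?link_Cotton -?link_dCotton -?link_Bach ?link_Met.
Fact mul_congr (a b c d : R) : a = c -> b = d -> a * b = c * d.
Proof. by move=> -> ->. Qed.
Ltac link_coef := by rewrite ?dval_half ?dval_mhalf // dval_dz ?intrN.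
Ltac link_factor :=
  rewrite /=; do ?[apply: eq_ctr => ? ?]; links; by rewrite ?mul1r.
Ltac link_comb_with lk := rewrite lk //; apply: mul_congr; first link_coef.
Ltac link_term :=
  first [link_comb_with link2 | link_comb_with link3 | link_comb_with link1]; link_factor.

(** Each of the twenty-four summands is matched with its symbolic counterpart. *)
Lemma link_rhs i k x (Ux : U x) :
  E Ux flow_rhs [:: i; k] = bach_flow_rhs (G t) i k x.
Proof.
rewrite /bach_flow_rhs; cbv zeta.
rewrite /ctr2 -regroup.
rewrite /flow_rhs /evA eval_flatten !big_cons big_nil addr0 !evD.
do 15 (congr (_ + _); first by link_term).
do 3 (congr (_ + _); first by link_comb_with link2; apply: mul_congr;
  [rewrite link2 // dval_dz mul1r; link_factor | rewrite link_Met]).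
do 5 (congr (_ + _); first by link_term).
by link_term.
Qed.

End AtTime.

(** The Ricci flow as an equation in the ring. *)
Lemma flowA i j : pd None (gA i j) = cf cstf (dz (-2)) * ricAA i j.
Proof.
apply: ev_inj => -[[t x] [It Ux]].
rewrite -[LHS](@pd_at None _ (fun t x => G t x i j) t x It Ux); last first.
  by move=> s y Is Uy; rewrite ext_restr.
rewrite /= (G_flow It Ux i j).2 [RHS]evM -link_ric; congr (_ * _).
by rewrite -[RHS]/(dval R (dz (-2))) dval_dz.
Qed.

Lemma bachA i k :
  pd None (evE Bach [:: i; k]) - evE (lap 2 Bach) [:: i; k] = evE flow_rhs [:: i; k].
Proof.
by apply: (bach_evolution evm_inj evm_cst (fun l => pdD (Some l)) (fun l => pdM (Some l))
  (fun l => pd_cst (Some l)) (fun l m => pdC (Some l) (Some m)) gA_sym gA_hA frameA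
  (pdD None) (pdM None) (pd_cst None) (fun l => pdC None (Some l)) flowA).
Qed.

(** The evolution equation in one chart, as the value at a point of the identity in the
    ring; the time derivative there is the one along the interval since the families
    agree at all instants of the interval. *)
Lemma bach_local t x (It : I t) (Ux : U x) i k :
  derivable_in I (fun s => bach (G s) i k x) t /\
  deriv_in I (fun s => bach (G s) i k x) t - lap2 (G t) (bach (G t)) i k x
    = bach_flow_rhs (G t) i k x.
Proof.
have bE s : I s -> ext (sfval (evE Bach [:: i; k])) s x = bach (G s) i k x.
  by move=> Is; rewrite (link_Bach Is _ _ Ux) (ext_at _ (conj Is Ux)).
split.
  apply: (derivable_in_eq bE It).
  by have [_ /(_ t x It Ux) []] := sfam_smooth (evE Bach [:: i; k]) [::].
rewrite -(deriv_in_eq bE It) (link_lapBach It _ _ Ux) -(link_rhs It _ _ Ux) -bachA evB.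
by congr (_ - _); exact: (@pd_at None _ _ t x It Ux).
Qed.

Lemma nabA0 w : nabA (fun=> 0) w = 0.
Proof. by apply: nabla0 => *; first [exact: pdD | exact: pdM]. Qed.

Lemma cov2_0 t T (It : I t) : (forall i j x, U x -> T i j x = 0) ->
  forall l i j x, U x -> cov2 (G t) T l i j x = 0.
Proof.
move=> T0 l i j x Ux; rewrite (@link_cov2 _ It T (fun=> 0)).
  by rewrite nabA0 rmorph0.
by move=> a b y Uy; rewrite T0 // rmorph0.
Qed.

Lemma cov3_0 t T (It : I t) : (forall i j k x, U x -> T i j k x = 0) ->
  forall l i j k x, U x -> cov3 (G t) T l i j k x = 0.
Proof.
move=> T0 l i j k x Ux; rewrite (@link_cov3 _ It T (fun=> 0)).
  by rewrite nabA0 rmorph0.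
by move=> a b c y Uy; rewrite T0 // rmorph0.
Qed.

(** When the Bach tensor vanishes on the whole chart and at all times, so do its time
    derivative and its Laplacian. *)
Lemma bach_flat_local t x (It : I t) (Ux : U x) i k :
  (forall s y, I s -> U y -> forall a b, bach (G s) a b y = 0) ->
  bach_flat_rhs (G t) i k x = 0.
Proof.
move=> B0; rewrite -flow_rhs_flat; last exact: B0.
have [_ <-] := bach_local It Ux i k.
have -> : deriv_in I (fun s => bach (G s) i k x) t = 0.
  rewrite (@deriv_in_eq _ I _ (fun=> 0)) //; last by move=> s Is; exact: B0.
  by have [_ ->] := is_deriv_in_val I_itv I_nd It (is_deriv_in_cst I 0 t).
rewrite sub0r [lap2 _ _ _ _ _]ctr0 ?oppr0 // => p q.
apply: cov3_0 => // a b c y Uy; apply: cov2_0 => // a' b' z Uz; exact: B0.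
Qed.

End Ring.

(** * The evolution of the Bach tensor *)

Theorem proposition5p2 (R : realType) (M : manifold3 R) (I : set R)
    (g : chart R M -> R -> 'rV[R]_3 -> 'M[R]_3)
    (I_interval : is_interval I)
    (I_nondegenerate : exists s t : R, [/\ I s, I t & s < t])
    (g_metric : metric_family I g)
    (g_flow : ricci_flow I g) :
  (forall (c : chart R M) (t : R) (x : 'rV[R]_3),
     atlas c -> I t -> chart_cod c x -> forall i k : 'I_3,
       derivable_in I (fun s => bach (g c s) i k x) t /\
       deriv_in I (fun s => bach (g c s) i k x) t
         - lap2 (g c t) (bach (g c t)) i k x
       = bach_flow_rhs (g c t) i k x)
  /\
  ((forall (c : chart R M) (t : R) (x : 'rV[R]_3),
      atlas c -> I t -> chart_cod c x -> forall i k : 'I_3,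
        bach (g c t) i k x = 0) ->
   forall (c : chart R M) (t : R) (x : 'rV[R]_3),
     atlas c -> I t -> chart_cod c x -> forall i k : 'I_3,
       0 = bach_flat_rhs (g c t) i k x).
Proof.
have [gS gT gP _] := g_metric.
split=> [c t x ac It Ux i k|B0 c t x ac It Ux i k].
  exact: (bach_local I_interval I_nondegenerate (@chart_cod_open _ _ c)
    (mk It Ux) (gS c ac) (fun s y => gT c s y ac) (fun s y => gP c s y ac)
    (fun s y => g_flow c s y ac)).
apply/esym/(bach_flat_local I_interval I_nondegenerate (@chart_cod_open _ _ c)
  (mk It Ux) (gS c ac) (fun s y => gT c s y ac) (fun s y => gP c s y ac)
  (fun s y => g_flow c s y ac) It Ux) => s y; exact: B0.
Qed.
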